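(* Let $x^{(1)},x^{(2)},\dots$ be a uniformly product-amenable sequence of point processes on $\mathbb{R}$, and denote the points of $x^{(n)}$ by $x^{(n)}_i$. Define $$c_n(s) := \lim_{B\to\infty} e^{i\pi s}\prod_{|x_i^{(n)}|\le B}\Big(1-\frac{s}{x_i^{(n)}}\Big).$$ This product converges almost surely for all $n$ and all $s\in\mathbb{C}$. Moreover, if the point processes $x^{(n)}$ converge in law, as $n\to\infty$, to the Sine process $y$, then $$c_n(s)\to \xi_\infty(s)$$ in law, in the topology of uniform convergence on compact subsets of $\mathbb{C}$.
   Context: For a sequence of point processes $x^{(n)}$ on $\mathbb{R}$ with points $\{x_i^{(n)}\}_i$ (point configurations with finitely many points are allowed), let $X_I^{(n)}:=\#\{i: x_i^{(n)}\in I\}$ for an interval $I$, and let $-I=\{-t:t\in I\}$, $|I|$ the length of $I$. The sequence is called uniformly product-amenable if for every $n$ the limit $\lim_{B\to\infty}\sum_{|x_i^{(n)}|\le B} 1/x_i^{(n)}$ exists almost surely and the sum $\sum_i 1/|x_i^{(n)}|^2$ converges almost surely, and if for some constant $\delta>0$ the following hold, with implied constants uniform in $n$ and in all intervals $I$ with $|I|\ge 1$: (i) $\mathbb{E}X_I^{(n)}=\mathbb{E}X_{-I}^{(n)}+O(|I|^{1-\delta})$; (ii) $\mathbb{E}X_I^{(n)}=O(|I|)$; (iii) $\mathrm{Var}\,X_I^{(n)}=O(|I|^{2-\delta})$. The Sine process $y$, with points $y_i$, is the determinantal point process on $\mathbb{R}$ with kernel $\frac{\sin \pi(u-v)}{\pi(u-v)}$.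 The limiting characteristic polynomial is the random entire function $\xi_\infty(s):=\lim_{B\to\infty}e^{i\pi s}\prod_{|y_i|\le B}(1-s/y_i)$; it is known that almost surely this limit exists for all $s\in\mathbb{C}$ and is entire. *)

(* Defs.v *)
From HB Require Import structures.
From mathcomp Require Import all_boot all_order all_algebra.
From mathcomp Require Import all_classical all_reals all_analysis.
From mathcomp.real_closed Require Import complex.

Set Implicit Arguments.
Unset Strict Implicit.
Unset Printing Implicit Defensive.

Import Order.TTheory GRing.Theory Num.Theory.
Import numFieldNormedType.Exports.

Local Open Scope classical_set_scope.
Local Open Scope ring_scope.

(* A locally finite multiset of points of the line: [c x] is the multiplicity
   of [x] in [c]. *)
Record configuration (R : realType) := Configuration {
  multiplicity :> R -> nat;
  locally_finite : forall B : R,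
    finite_set [set x | `|x| <= B /\ multiplicity x <> 0%N] }.

(* #{i : x_i \in A}; the sum has finite support when [A] is bounded. *)
Definition count_in (R : realType) (c : configuration R) (A : set R) : R :=
  \sum_(x \in A) ((c x)%:R : R).

HB.instance Definition _ (R : realType) := gen_eqMixin (configuration R).
HB.instance Definition _ (R : realType) := gen_choiceMixin (configuration R).

Definition test_function (R : realType) :=
  {f : R -> R | continuous f /\ exists B : R, forall x, B < `|x| -> f x = 0}.

Definition linear_statistics (R : realType) (c : configuration R) :
    {ptws test_function R -> R} :=
  fun f => \sum_(x \in [set: R]) (c x)%:R * sval f x.

(* Configurations carry the vague topology. *)
HB.instance Definition _ (R : realType) :=
  Topological.copy (configuration R)
    (initial_topology (@linear_statistics R)).

Record point_process d (T : measurableType d) (R : realType) := PointProcess {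
  points :> T -> configuration R;
  measurable_count : forall A : set R, measurable A -> bounded_set A ->
    measurable_fun setT (fun w => count_in (points w) A) }.

(* Convergence in law of (almost surely defined) random elements of the
   subspace [A] of the topological space [S]. *)
Definition cvg_in_law (R : realType) (S : topologicalType) (A : set S)
    (d : nat -> measure_display) (T : forall n, measurableType (d n))
    (P : forall n, probability (T n) R) (X : forall n, T n -> S)
    (d' : measure_display) (T' : measurableType d') (P' : probability T' R)
    (Y : T' -> S) : Prop :=
  [/\ forall n, {ae P n, forall w, A (X n w)},
      {ae P', forall w, A (Y w)} &
      forall F : S -> R, {within A, continuous F} ->
        (exists M : R, forall x, A x -> `|F x| <= M) ->
        'E_(P n)[F \o X n]%E @[n --> \oo] --> 'E_P'[F \o Y]%E ].

(* Since [0^-1 = 0] here, the requirement that [0] is not a point, implicit in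
   the convergence of the two sums of inverses, is stated separately. *)
Definition uniformly_product_amenable (R : realType)
    (d : nat -> measure_display) (T : forall n, measurableType (d n))
    (P : forall n, probability (T n) R)
    (X : forall n, point_process (T n) R) : Prop :=
  [/\ forall n, {ae P n, forall w, X n w 0 = 0%N},
      forall n, {ae P n, forall w,
        cvg (\sum_(x \in [set x | `|x| <= B]) (X n w x)%:R / x
             @[B --> +oo])},
      forall n, {ae P n, forall w,
        (\esum_(x in [set: R]) ((X n w x)%:R / `|x| ^+ 2)%:E < +oo)%E} &
      exists2 delta : R, 0 < delta & exists K : R,
        forall (n : nat) (bl br : bool) (a b : R), 1 <= b - a ->
        let I := [set` Interval (BSide bl a) (BSide br b)] in
        let I' := [set - t | t in I] in
        let N (A : set R) := fun w => count_in (X n w) A in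
        [/\ (`|'E_(P n)[N I] - 'E_(P n)[N I']|
               <= (K * (b - a) `^ (1 - delta))%:E)%E,
            ('E_(P n)[N I] <= (K * (b - a))%:E)%E &
            ('V_(P n)[N I] <= (K * (b - a) `^ (2 - delta))%:E)%E ] ].

(* Integral over the product of the sets [Ds], iterated one variable at a
   time. *)
Fixpoint iter_integral (R : realType) (Ds : seq (set R)) (g : seq R -> R) :
    \bar R :=
  match Ds with
  | [::] => (g [::])%:E
  | D :: Ds' =>
      (\int[@lebesgue_measure R]_(x in D)
         iter_integral Ds' (fun xs => g (x :: xs)))%E
  end.

(* A simple point process whose joint intensities with respect to Lebesgue
   measure are the determinants of [K]. *)
Definition determinantal (R : realType) d (T : measurableType d)
    (P : probability T R) (X : point_process T R) (K : R -> R -> R) : Prop :=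
  {ae P, forall w, forall x, (X w x <= 1)%N} /\
  forall (k : nat) (D : 'I_k -> set R),
    (forall i, measurable (D i)) -> (forall i, bounded_set (D i)) ->
    trivIset setT D ->
    'E_P[(fun w => \prod_(i < k) count_in (X w) (D i))%R]%E =
    iter_integral [seq D i | i <- enum 'I_k]
      (fun xs => \det (\matrix_(i < k, j < k) K xs`_i xs`_j)).

Definition sine_kernel (R : realType) (u v : R) : R :=
  if u == v then 1 else sin (pi * (u - v)) / (pi * (u - v)).

Definition sine_process (R : realType) d (T : measurableType d)
    (P : probability T R) (y : point_process T R) : Prop :=
  determinantal P y (@sine_kernel R).

Definition cexp (R : realType) (z : R[i]) : R[i] :=
  (expR (complex.Re z))%:C%C *
  (cos (complex.Im z) +i* sin (complex.Im z))%C.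

(* [R[i]^o] is [R[i]] with its norm topology. *)
Definition truncated_product (R : realType) (c : configuration R) (s : R[i])
    (B : R) : R[i]^o :=
  cexp ('i%C * pi%:C%C * s) *
  \big[*%R/1]_(x \in [set x : R | `|x| <= B]) (1 - s / x%:C%C) ^+ c x.

Definition characteristic_limit (R : realType) (c : configuration R) :
    {family compact, R[i]^o -> R[i]^o} :=
  fun s => lim (truncated_product c s B @[B --> +oo]).

(* Main.v *)
Require Import Defs.
From mathcomp Require Import all_boot all_order all_algebra finmap.
From mathcomp Require Import all_classical all_reals all_analysis.
From mathcomp Require Import measurable_realfun.
From mathcomp.real_closed Require Import complex.
From mathcomp Require Import ring lra zify.

Set Implicit Arguments.
Unset Strict Implicit.
Unset Printing Implicit Defensive.

Import Order.TTheory GRing.Theory Num.Theory.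
Import numFieldNormedType.Exports.
Import Normc.

Local Open Scope classical_set_scope.
Local Open Scope ring_scope.

(* Write D(j) for the number of points in ]0, j] minus that in [-j, 0[.
   Summation by parts bounds the sum of 1/x over k < |x| <= J by |D(J)|/J,
   |D(k)|/k, the sum of |D(j)|/j^2 and the sum over the points of 1/x^2. The
   amenability bounds give E|D(j)| = O(j^(1-a)), so these tails are small in mean,
   uniformly in n, and the product over |x| <= k, which is a polynomial up to the
   exponential factor, approximates the characteristic function uniformly on
   compact sets outside an event of small probability. The coefficients of this
   polynomial are, by Newton's identities, polynomials in linear statistics, so
   they converge in law with the point processes, once 1/x is cut off near 0; the
   probability of a point near 0 is bounded by comparison with the limit process.
   Testing against functionals that are Lipschitz for a metric of locally uniform
   convergence suffices, as in the portmanteau theorem.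

   The same bounds hold for the sine process, since Var N(I) <= E N(I) = |I|.
   Summing the variances along the squares m^2 also gives D(j)/j -> 0 almost
   surely, hence the convergence of its product. *)

(** * Elementary factors *)

(** The product converges only conditionally: the sum of [1 / x] has just a principal value, so the
    points beyond a cutoff cannot be handled in absolute value. Factors of genus one isolate the
    difficulty: a finite product is an exponential in the sum of the inverses times factors
    controlled by the sum of their squares. Standard deviations of counts are
    [O(j ^ (1 - delta / 2))], so the exponent [a] is half of [delta], capped at one.

    Two scales [k0 <= k] are used. The product over the inner points is bounded in terms of [k0],
    independently of [k], so that the error allowed beyond [k] can be chosen afterwards, small
    enough to beat it.

    The functionals to be tested are only continuous on a set of functions, and measurability of
    their compositions with the random function has to be produced. Lipschitz envelopes answer this:
    compositions with them are limits of functions of finitely many coefficients, and they converge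
    to the functional from below. *)

Section RealEstimates.
Variable R : realType.
Implicit Types x y : R.

Lemma expR_sub1_le x : `|expR x - 1| <= `|x| * expR `|x|.
Proof.
have h1 := expR_ge1Dx x; have h2 := expR_ge1Dx (- x).
have e0 := expR_gt0 x; have p : expR (- x) * expR x = 1.
  by rewrite mulrC expRxMexpNx_1.
case: (ger0P x) => x0.
- rewrite ger0_norm; last by rewrite subr_ge0; lra.
  have : (1 - x) * expR x <= 1.
    by rewrite -[leRHS]p ler_wpM2r // ?(ltW e0)//; lra.
  lra.
- rewrite ler0_norm ?opprB; last by rewrite subr_le0 ltW// expR_lt1.
  have h3 := expR_ge1Dx (- x).
  have : 1 <= expR (- x) by lra.
  move=> h4; have : - x * 1 <= - x * expR (- x) by rewrite ler_wpM2l//; lra.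
  lra.
Qed.

Lemma expR_taylor2 x : `|expR x - 1 - x| <= x ^+ 2 * expR `|x|.
Proof.
have h1 := expR_ge1Dx x; rewrite ger0_norm; last by lra.
have h2 := expR_sub1_le x.
have e0 := expR_gt0 x; have p : expR (- x) * expR x = 1.
  by rewrite mulrC expRxMexpNx_1.
have h3 : expR x - 1 <= x * expR x.
  have : (1 - x) * expR x <= 1.
    by rewrite -[leRHS]p ler_wpM2r // ?(ltW e0) //; have := expR_ge1Dx (- x); lra.
  lra.
apply: (@le_trans _ _ (x * (expR x - 1))); first by lra.
apply: (le_trans (ler_norm _)); rewrite normrM.
apply: (le_trans (ler_wpM2l (normr_ge0 x) h2)).
by rewrite mulrA -expr2 real_normK ?num_real.
Qed.

Let mvt0 (f f' : R -> R) (M y : R) : (forall x : R, is_derive x (1 : R) f (f' x)) ->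
  f 0 = 0 -> (forall x, `|x| <= `|y| -> `|f' x| <= M) -> `|f y| <= M * `|y|.
Proof.
move=> df f0 fM.
have cf : forall a b : R, {within `[a, b], continuous f}.
  move=> a b; apply: derivable_within_continuous => z _; exact: ex_derive.
have [y0|y0] := leP 0 y.
- have [c + e] := MVT_segment y0 (fun x _ => df x) (cf _ _).
  rewrite in_itv/= => /andP[c0 cy].
  have -> : f y = f' c * y by move: e; rewrite f0 !subr0.
  rewrite normrM ler_wpM2r// fM// !ger0_norm//.
- have [c + e] := MVT_segment (ltW y0) (fun x _ => df x) (cf _ _).
  rewrite in_itv/= => /andP[c0 cy].
  have -> : f y = f' c * y by move: e; rewrite f0 !sub0r mulrN => /eqP; rewrite eqr_opp => /eqP.
  rewrite normrM ler_wpM2r// fM// !ler0_norm// ?lerN2//.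
  exact: ltW.
Qed.

Lemma norm_sin_le y : `|sin y| <= `|y|.
Proof.
rewrite -[leRHS]mul1r; apply: (@mvt0 sin cos); rewrite ?sin0// => x _; exact: cos_max.
Qed.

Lemma norm_cos_sub1_le y : `|cos y - 1| <= y ^+ 2.
Proof.
have := @mvt0 (fun x => cos x - 1) (fun x => - sin x) `|y| y.
rewrite cos0 subrr -expr2 real_normK ?num_real//; apply=> //.
- move=> x; have := is_deriveB (is_derive_cos x) (is_derive_cst (1 : R) x 1).
  by rewrite subr0.
- by move=> x xy; rewrite normrN (le_trans (norm_sin_le x)).
Qed.

Lemma norm_sin_sub_le y : `|sin y - y| <= `|y| ^+ 3.
Proof.
have := @mvt0 (fun x => sin x - x) (fun x => cos x - 1) (`|y| ^+ 2) y.
rewrite sin0 subrr -exprSr; apply=> //.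
move=> x xy; rewrite (le_trans (norm_cos_sub1_le x))//.
by rewrite -[x ^+ 2]real_normK ?num_real// lerXn2r ?nnegrE.
Qed.

End RealEstimates.

Section ComplexEstimates.
Variable R : realType.
Local Notation C := R[i].
Implicit Types z w s : C.

Lemma normc_ge0 z : 0 <= normc z.
Proof. by case: z => a b; rewrite /= sqrtr_ge0. Qed.

Lemma normcEC z : `|z| = (normc z)%:C%C.
Proof. by case: z. Qed.

Lemma normc_real (x : R) : normc x%:C%C = `|x|.
Proof. by rewrite /= expr0n /= addr0 sqrtr_sqr. Qed.

Lemma normc_Re z : `|complex.Re z| <= normc z.
Proof.
case: z => a b /=; rewrite -sqrtr_sqr ler_wsqrtr// lerDl sqr_ge0//.
Qed.

Lemma normc_Im z : `|complex.Im z| <= normc z.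
Proof.
case: z => a b /=; rewrite -sqrtr_sqr ler_wsqrtr// lerDr sqr_ge0//.
Qed.

Lemma normc_leReIm z : normc z <= `|complex.Re z| + `|complex.Im z|.
Proof.
case: z => a b /=; rewrite -(@ger0_norm _ (`|a| + `|b|)) ?addr_ge0//.
rewrite -sqrtr_sqr ler_wsqrtr// sqrrD !real_normK ?num_real//.
by rewrite addrAC lerDl mulrn_wge0 ?mulr_ge0.
Qed.

Lemma normc_sqr z : normc z ^+ 2 = complex.Re z ^+ 2 + complex.Im z ^+ 2.
Proof. by case: z => a b /=; rewrite sqr_sqrtr// addr_ge0 ?sqr_ge0. Qed.

Lemma normc_subC z w : normc (z - w) = normc (w - z).
Proof. by rewrite -normcN opprB. Qed.

Lemma le_normcB z w : normc (z - w) <= normc z + normc w.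
Proof. by rewrite (le_trans (le_normcD _ _))// normcN. Qed.

Lemma normc_prod (I : Type) (l : seq I) (F : I -> C) :
  normc (\prod_(i <- l) F i) = \prod_(i <- l) normc (F i).
Proof. exact: (big_morph _ (@normcM R) (normc1 R)). Qed.

Lemma cexpD z w : cexp (z + w) = cexp z * cexp w.
Proof.
case: z w => a b [c d]; rewrite /cexp /= expRD cosD sinD.
apply/eqP; rewrite eq_complex /=; apply/andP; split; apply/eqP; ring.
Qed.

Lemma cexp0 : cexp 0 = 1 :> C.
Proof.
by rewrite /cexp /= expR0 cos0 sin0; apply/eqP; rewrite eq_complex /= ; apply/andP; split; apply/eqP; ring.
Qed.

Lemma cexp_sum (I : Type) (l : seq I) (F : I -> C) :
  cexp (\sum_(i <- l) F i) = \prod_(i <- l) cexp (F i).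
Proof. exact: (big_morph _ cexpD cexp0). Qed.

Lemma normc_cexp z : normc (cexp z) = expR (complex.Re z).
Proof.
case: z => a b; rewrite /cexp normcM normc_real ger0_norm ?expR_ge0//=.
by rewrite cos2Dsin2 sqrtr1 mulr1.
Qed.

Lemma normc_cexp_le z : normc (cexp z) <= expR (normc z).
Proof. by rewrite normc_cexp ler_expR (le_trans (ler_norm _))// normc_Re. Qed.

Lemma cexp_taylor2 z : normc z <= 1 ->
  normc (cexp z - 1 - z) <= 4 * expR 1 * normc z ^+ 2.
Proof.
move=> z1; have := normc_sqr z; have := normc_Re z; have := normc_Im z.
move=> h1 h2 h3; apply: le_trans (normc_leReIm _) _; move: h1 h2 h3.
case: z z1 => x y /=; set r := Num.sqrt _ => r1 yr xr r2.
have e1 : 1 <= expR (1 : R) by rewrite -expR0 ler_expR.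
have ex : expR `|x| <= expR (1 : R) by rewrite ler_expR (le_trans xr).
have r0 : 0 <= r by rewrite sqrtr_ge0.
have x1 : `|x| <= 1 by lra.
have y1 : `|y| <= 1 by lra.
have xx : 0 <= x ^+ 2 by rewrite sqr_ge0.
have yy : 0 <= y ^+ 2 by rewrite sqr_ge0.
have exx : expR x <= expR 1 by rewrite ler_expR (le_trans (ler_norm x)).
have h1 : `|expR x * cos y - 0 * sin y - 1 - x| <= x^+2 * expR 1 + expR 1 * y ^+2.
  have -> : expR x * cos y - 0 * sin y - 1 - x = (expR x - 1 - x) + expR x * (cos y - 1) by ring.
  rewrite (le_trans (ler_normD _ _))// lerD//.
    by rewrite (le_trans (expR_taylor2 _))// ler_wpM2l.
  rewrite normrM ler_pM// ?norm_cos_sub1_le// ger0_norm ?expR_ge0//.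
have h2 : `|expR x * sin y + 0 * cos y - 0 - y| <= `|x| * `|y| * expR 1 + y ^+ 2.
  have -> : expR x * sin y + 0 * cos y - 0 - y = (expR x - 1) * sin y + (sin y - y) by ring.
  rewrite (le_trans (ler_normD _ _))// lerD//.
    rewrite normrM mulrAC ler_pM ?norm_sin_le//.
    by rewrite (le_trans (expR_sub1_le _))// ler_wpM2l.
  rewrite (le_trans (norm_sin_sub_le _))// -[y ^+ 2]real_normK ?num_real// exprS.
  by rewrite -[leRHS]mul1r ler_wpM2r// ?exprn_ge0.
rewrite !oppr0 in h1 h2 *.
have xy : `|x| * `|y| <= (x ^+ 2 + y ^+ 2).
  rewrite -[x ^+ 2]real_normK ?num_real// -[y ^+ 2]real_normK ?num_real//.
  have := sqr_ge0 (`|x| - `|y|); have := sqr_ge0 `|x|; have := sqr_ge0 `|y|.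
  by rewrite sqrrB; lra.
rewrite (le_trans (lerD h1 h2))// r2.
have : `|x| * `|y| * expR 1 <= (x ^+ 2 + y ^+ 2) * expR 1 by rewrite ler_wpM2r ?expR_ge0.
have : y ^+ 2 * 1 <= y ^+ 2 * expR 1 by rewrite ler_wpM2l.
have : 0 <= x ^+ 2 * expR 1 by rewrite mulr_ge0 ?expR_ge0.
have : 0 <= y ^+ 2 * expR 1 by rewrite mulr_ge0 ?expR_ge0.
lra.
Qed.

Lemma cexp_sub1_le z : normc z <= 1 ->
  normc (cexp z - 1) <= 5 * expR 1 * normc z.
Proof.
move=> z1; have -> : cexp z - 1 = (cexp z - 1 - z) + z by ring.
rewrite (le_trans (le_normcD _ _))//.
have h := cexp_taylor2 z1; have z0 := normc_ge0 z.
have : 4 * expR 1 * (normc z * normc z) <= 4 * expR 1 * (normc z * 1).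
  by rewrite ler_wpM2l ?mulr_ge0 ?expR_ge0// ler_wpM2l.
have : 1 * normc z <= expR 1 * normc z by rewrite ler_wpM2r// -expR0 ler_expR.
rewrite expr2 in h; lra.
Qed.

(* [weier z] is the Weierstrass primary factor of genus one. *)
Definition weier z : C := (1 - z) * cexp z.

Lemma weier_sub1_le z : normc z <= 1 ->
  normc (weier z - 1) <= 9 * expR 1 * normc z ^+ 2.
Proof.
move=> z1; have -> : weier z - 1 = - (z * z) + (1 - z) * (cexp z - 1 - z).
  by rewrite /weier; ring.
rewrite (le_trans (le_normcD _ _))// normcN !normcM.
have h := cexp_taylor2 z1; have z0 := normc_ge0 z.
have h2 : normc (1 - z) <= 2 by rewrite (le_trans (le_normcB _ _))// normc1; lra.
have := ler_pM (normc_ge0 _) (normc_ge0 _) h2 h.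
have : 1 * normc z ^+ 2 <= expR 1 * normc z ^+ 2.
  by rewrite ler_wpM2r ?sqr_ge0// -expR0 ler_expR.
rewrite -expr2; lra.
Qed.

(** Since [|1 - z| ^ 2 = 1 - 2 Re z + |z| ^ 2 <= exp (- 2 Re z + |z| ^ 2)], the exponential in
    [weier] cancels the linear term. This holds for every [z], so it serves for points of any
    size. *)
Lemma normc_weier_le z : normc (weier z) <= expR (normc z ^+ 2).
Proof.
rewrite /weier normcM normc_cexp normc_sqr; case: z => x y /=.
rewrite sub0r sqrrN -(@ger0_norm _ (expR (x ^+2 + y ^+2))) ?expR_ge0//.
rewrite -(@ger0_norm _ (expR x)) ?expR_ge0// -!sqrtr_sqr -sqrtrM ?addr_ge0 ?sqr_ge0//.
rewrite ler_wsqrtr//.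
rewrite -!expRM_natl.
have h := expR_ge1Dx (- (2 * x) + x ^+ 2 + y ^+ 2).
have -> : (1 - x) ^+ 2 + y ^+ 2 = 1 + (- (2 * x) + x ^+ 2 + y ^+ 2) by ring.
rewrite (le_trans (ler_wpM2r (expR_ge0 _) h))// -expRD ler_expR.
have := sqr_ge0 x; have := sqr_ge0 y; lra.
Qed.

Lemma prod_sub1_le (I : Type) (l : seq I) (w : I -> C) :
  normc (\prod_(i <- l) (1 + w i) - 1) <= expR (\sum_(i <- l) normc (w i)) - 1.
Proof.
elim: l => [|a l IH]; first by rewrite !big_nil subrr normc0 expR0 subrr.
rewrite !big_cons expRD; set p := \prod_(_ <- _) _; set q := \sum_(_ <- _) _.
have -> : (1 + w a) * p - 1 = (1 + w a) * (p - 1) + w a by ring.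
rewrite (le_trans (le_normcD _ _))// normcM.
have h := expR_ge1Dx (normc (w a)).
have h2 : normc (1 + w a) <= 1 + normc (w a) by rewrite (le_trans (le_normcD _ _))// normc1.
have h3 : normc (1 + w a) <= expR (normc (w a)) by lra.
have := ler_pM (normc_ge0 _) (normc_ge0 _) h3 IH.
rewrite -/q; lra.
Qed.

(* [l] lists the inverses of the zeros. *)
Definition lprod (l : seq R) s : C := \prod_(a <- l) (1 - s * a%:C%C).

Lemma lprod_cat l1 l2 s : lprod (l1 ++ l2) s = lprod l1 s * lprod l2 s.
Proof. by rewrite /lprod big_cat. Qed.

(** The sum of the [a], which in the limit converges only as a principal value, is kept in one piece
    with its cancellations; the remaining factors are quadratically close to one. *)
Lemma lprodE l s : lprod l s =
  cexp (- (s * (\sum_(a <- l) a)%:C%C)) * \prod_(a <- l) weier (s * a%:C%C).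
Proof.
rewrite big_split /= -/(lprod l s) -cexp_sum mulrC -mulrA -cexpD.
rewrite raddf_sum /= mulr_sumr subrr cexp0 mulr1 //.
Qed.

Lemma normc_sM s (a : R) : normc (s * a%:C%C) = normc s * `|a|.
Proof. by rewrite normcM normc_real. Qed.

Lemma normc_lprod_le l s : normc (lprod l s) <=
  expR (normc s * `|\sum_(a <- l) a| + normc s ^+ 2 * \sum_(a <- l) a ^+ 2).
Proof.
rewrite lprodE normcM expRD ler_pM ?normc_ge0//.
  by rewrite (le_trans (normc_cexp_le _))// normcN normc_sM.
rewrite normc_prod mulr_sumr expR_sum.
apply: ler_prod => a _; rewrite normc_ge0/= (le_trans (normc_weier_le _))//.
by rewrite normc_sM exprMn real_normK ?num_real.
Qed.

(** The second hypothesis puts every [s * a] in the unit disc, where the Taylor bound on [weier]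
    holds; the third makes the total deviation [t] of the factors at most one, so that
    [expR t - 1 <= expR 1 * t]. *)
Lemma lprod_sub1_le (S : R) l s : normc s <= S ->
  (forall a, a \in l -> S * `|a| <= 1) ->
  9 * expR 1 * (S * `|\sum_(a <- l) a| + S ^+ 2 * \sum_(a <- l) a ^+ 2) <= 1 ->
  normc (lprod l s - 1) <=
    9 * expR 1 ^+ 2 * (S * `|\sum_(a <- l) a| + S ^+ 2 * \sum_(a <- l) a ^+ 2).
Proof.
move=> sS al; set A := S * _; set Q := S ^+ 2 * _ => h.
have s0 := normc_ge0 s; have S0 : 0 <= S by lra.
have A0 : 0 <= A by rewrite mulr_ge0.
have Q0 : 0 <= Q by rewrite mulr_ge0 ?sqr_ge0// sumr_ge0// => i _; rewrite sqr_ge0.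
have e1 : 1 <= expR (1 : R) by rewrite -expR0 ler_expR.
have A1 : A <= 1.
  have : 1 * (A + Q) <= 9 * expR 1 * (A + Q) by rewrite ler_wpM2r ?addr_ge0//; lra.
  lra.
(* The exponential prefactor counts as one more factor, indexed by [None], so that [prod_sub1_le]
   treats all of them at once. *)
set w : option R -> C := fun o => if o is Some a then weier (s * a%:C%C) - 1
  else cexp (- (s * (\sum_(a <- l) a)%:C%C)) - 1.
have e : lprod l s = \prod_(o <- None :: map some l) (1 + w o).
  rewrite lprodE big_cons /= subrKC big_map; congr (_ * _).
  by apply: eq_bigr => a _; rewrite subrKC.
have sle : \sum_(o <- None :: map some l) normc (w o) <= 9 * expR 1 * (A + Q).
  rewrite big_cons big_map mulrDr lerD//.
    have nA : normc (- (s * (\sum_(a <- l) a)%:C%C)) <= A.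
      by rewrite normcN normc_sM ler_wpM2r.
    rewrite /= (le_trans (cexp_sub1_le _))//; first by lra.
    apply: ler_pM => //; rewrite ?mulr_ge0 ?expR_ge0 ?normc_ge0//.
    by rewrite ler_wpM2r ?expR_ge0//; lra.
  rewrite /Q !mulr_sumr.
  rewrite big_seq [leRHS]big_seq ler_sum// => a la /=.
  have na : normc (s * a%:C%C) <= S * `|a| by rewrite normc_sM ler_wpM2r.
  have := al _ la => al1.
  rewrite (le_trans (weier_sub1_le _))//; first by lra.
  rewrite ler_wpM2l ?mulr_ge0 ?expR_ge0//.
  rewrite -[a ^+ 2]real_normK ?num_real// -exprMn lerXn2r ?nnegrE ?normc_ge0 ?mulr_ge0//.
rewrite e (le_trans (prod_sub1_le _ _))//.
set t := \sum_(_ <- _) _ in sle *.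
have t0 : 0 <= t by apply: sumr_ge0 => i _; exact: normc_ge0.
have := expR_sub1_le t; rewrite ger0_norm; last first.
  by rewrite subr_ge0 -expR0 ler_expR.
rewrite ger0_norm// => /le_trans; apply.
have te : expR t <= expR 1 by rewrite ler_expR; lra.
have := ler_pM t0 (expR_ge0 t) sle te; rewrite expr2; lra.
Qed.

End ComplexEstimates.

(** * Configurations as lists of points *)

Section Points.
Variable R : realType.
Implicit Types (c : configuration R) (B : R) (x : R).

Definition window c B := [set x | `|x| <= B /\ c x <> 0%N].

(** Points are repeated according to multiplicity, in an order that carries no meaning; hence two
    windows are compared only up to permutation. *)
Definition pts c B : seq R :=
  flatten [seq nseq (c x) x | x <- fset_set (window c B)].

Lemma mem_pts c B x : (x \in pts c B) = (`|x| <= B) && (c x != 0%N).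
Proof.
apply/flatten_mapP/andP => [[y]|[xB cx]].
- rewrite in_fset_set; last exact: locally_finite.
  by rewrite inE => -[yB /eqP cy]; rewrite mem_nseq => /andP[_ /eqP ->].
- exists x; last by rewrite mem_nseq lt0n cx eqxx.
  by rewrite in_fset_set ?inE; [split => //; exact/eqP|exact: locally_finite].
Qed.

Lemma big_pts (T : Type) (idx : T) (op : Monoid.com_law idx) c B (F : R -> T) :
  \big[op/idx]_(x <- pts c B) F x =
  \big[op/idx]_(x <- fset_set (window c B)) iterop (c x) op (F x) idx.
Proof.
rewrite big_flatten big_map; apply: eq_bigr => x _.
by rewrite big_nseq Monoid.iteropE.
Qed.

Lemma count_pts c B x : count_mem x (pts c B) = if `|x| <= B then c x else 0%N.
Proof.
rewrite count_flatten -map_comp sumnE big_map.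
have fw : finite_set (window c B) by exact: locally_finite.
have [xB|xB] := boolP (`|x| <= B); last first.
  rewrite big1_seq// => y /andP[_]; rewrite in_fset_set// inE => -[yB _] /=.
  rewrite count_nseq /=; case: eqP => [e|]; last by rewrite mul0n.
  by move: xB; rewrite -e yB.
have [cx|cx] := eqVneq (c x) 0%N.
  rewrite cx big1_seq// => y /andP[_] _ /=; rewrite count_nseq /=.
  by case: eqP => [->|]; rewrite ?cx ?mul0n.
rewrite (big_fsetD1 x) /=; last first.
  by rewrite in_fset_set// inE; split => //; exact/eqP.
rewrite count_nseq /= eqxx mul1n big1_seq ?addn0// => y /andP[_].
by rewrite !inE => /andP[/negPf yx _]; rewrite /= count_nseq /= yx.
Qed.

Lemma pts_filter c B B' : B <= B' ->
  perm_eq (pts c B) [seq x <- pts c B' | `|x| <= B].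
Proof.
move=> BB; rewrite /perm_eq; apply/allP => x _ /=; apply/eqP.
rewrite count_filter; set p := predI _ _.
have [xB|xB] := boolP (`|x| <= B).
  rewrite (@eq_count _ p (pred1 x)); last first.
    by move=> y /=; case: eqP => [->|//]; rewrite xB.
  by rewrite !count_pts xB (le_trans xB BB).
rewrite (@eq_count _ p pred0); last first.
  by move=> y /=; case: eqP => [->|//]; rewrite (negPf xB).
by rewrite count_pred0 count_pts (negPf xB).
Qed.

Lemma sum_pts_filter c B B' (F : R -> R) : B <= B' ->
  \sum_(x <- pts c B) F x = \sum_(x <- pts c B' | `|x| <= B) F x.
Proof. by move=> BB; rewrite -[RHS]big_filter; apply: perm_big; exact: pts_filter. Qed.

Lemma fsum_pts c B (A : set R) (F : R -> R) :
  (forall x, A x -> `|x| <= B) ->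
  \sum_(x \in A) (c x)%:R * F x = \sum_(x <- pts c B | x \in A) F x.
Proof.
move=> AB; have fw : finite_set (window c B) by exact: locally_finite.
rewrite [RHS]big_mkcond big_pts fsbig_mkcond.
rewrite (@fsbigTE _ _ _ _ (fset_set (window c B))); last first.
  move=> x; rewrite in_fset_set// /patch; case: ifPn => //.
  rewrite inE => /AB xB; rewrite notin_setE => /not_andP[//|].
  by move=> /contrapT ->; rewrite mul0r.
apply: eq_bigr => x _; rewrite Monoid.iteropE /= iter_addr_0 /patch.
by case: ifPn => _; rewrite ?mul0rn // mulr_natl.
Qed.

Lemma count_in_pts c B (A : set R) : (forall x, A x -> `|x| <= B) ->
  count_in c A = \sum_(x <- pts c B | x \in A) 1.
Proof.
move=> AB; rewrite -(fsum_pts c (fun=> 1) AB) /count_in.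
by apply: eq_fsbigr => x _; rewrite mulr1.
Qed.

Lemma truncated_product_pts c s B : truncated_product c s B =
  cexp ('i%C * pi%:C%C * s) * lprod [seq x^-1 | x <- pts c B] s.
Proof.
rewrite /truncated_product; congr (_ * _).
have fw : finite_set (window c B) by exact: locally_finite.
rewrite /lprod big_map big_pts fsbig_mkcond.
rewrite (@fsbigTE _ _ _ _ (fset_set (window c B))); last first.
  move=> x; rewrite in_fset_set// /patch; case: ifPn => //.
  rewrite inE => /= xB; rewrite notin_setE => /not_andP[//|].
  by move=> /contrapT ->; rewrite expr0.
apply: eq_big_seq => x; rewrite in_fset_set// inE => -[xB _].
rewrite /patch ifT; last by rewrite inE.
rewrite Monoid.iteropE /= iter_mulr_1; congr (_ ^+ _); congr (1 - s * _).
by rewrite (fmorphV (real_complex R)).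
Qed.

Lemma linear_statistics_pts c B (f : test_function R) :
  (forall x, B < `|x| -> sval f x = 0) ->
  linear_statistics c f = \sum_(x <- pts c B) sval f x.
Proof.
move=> fB; rewrite /linear_statistics.
rewrite -(@fsbig_widen _ _ _ _ [set x | `|x| <= B])//; last first.
  by move=> x [_ /= /negP]; rewrite -ltNge => /fB ->; rewrite mulr0.
rewrite (@fsum_pts c B) //.
rewrite big_seq_cond [RHS]big_seq; apply: eq_bigl => x.
by rewrite mem_pts; case: (boolP (_ <= _)) => //= xB; rewrite mem_set//= andbT.
Qed.

End Points.

(** * Coefficients of the product and Newton's identities *)

Section Coefficients.
Variable R : realType.
Implicit Types (l : seq R) (a x : R).

(** The coefficient of [s ^ m] in the product of the [1 - s a], that is [(-1) ^ m] times the
    elementary symmetric polynomial of degree [m]; the sign is built in. *)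
Fixpoint lcoef l (m : nat) : R :=
  if l is a :: l' then
    lcoef l' m - a * (if m is m'.+1 then lcoef l' m' else 0)
  else (m == 0%N)%:R.

Lemma lcoef0 l : lcoef l 0 = 1.
Proof. by elim: l => //= a l ->; rewrite mulr0 subr0. Qed.

Lemma lcoef_oversize l m : (size l < m)%N -> lcoef l m = 0.
Proof.
elim: l m => [[]//|a l IH [//|m]] /= lm.
by rewrite !IH ?mulr0 ?subr0// ltnW.
Qed.

Lemma real_complexB (x y : R) : (x - y)%:C%C = x%:C%C - y%:C%C.
Proof. by apply/eqP; rewrite eq_complex /= subr0 !eqxx. Qed.

Lemma real_complexM (x y : R) : (x * y)%:C%C = x%:C%C * y%:C%C.
Proof. by apply/eqP; rewrite eq_complex /= !mulr0 mul0r subr0 addr0 !eqxx. Qed.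

Lemma lprod_lcoef l (s : R[i]) M : (size l < M)%N ->
  lprod l s = \sum_(m < M) (lcoef l m)%:C%C * s ^+ m.
Proof.
rewrite /lprod; elim: l M => [|a l IH] [//|M] lM.
  rewrite big_nil big_ord_recl /= expr0 mulr1 big1 ?addr0//.
  by move=> i _; rewrite mul0r.
rewrite big_cons (IH M)//= big_ord_recl /= mulr0 subr0 lcoef0 expr0 mulr1.
under [in RHS]eq_bigr do rewrite real_complexB real_complexM mulrBl.
rewrite sumrB addrA.
have -> : 1%:C%C + \sum_(i < M) (lcoef l (bump 0 i))%:C%C * s ^+ bump 0 i =
    \sum_(m < M.+1) (lcoef l m)%:C%C * s ^+ m.
  by rewrite [RHS]big_ord_recl /= lcoef0 expr0 mulr1.
rewrite big_ord_recr /= lcoef_oversize// mul0r addr0 mulrBl mul1r; congr (_ - _).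
rewrite mulr_sumr; apply: eq_bigr => i _.
by rewrite /bump /= add1n exprS; ring.
Qed.

(** Comparison of coefficients in [P' = - P Q], where [P] is the product and [Q] the generating
    series of the power sums. The induction adds one element of the list at a time. *)
Lemma newton_identity l m : m.+1%:R * lcoef l m.+1 =
  - \sum_(i < m.+1) lcoef l (m - i) * \sum_(a <- l) a ^+ i.+1.
Proof.
elim: l m => [|a l IH] m.
  by rewrite /= mulr0 big1 ?oppr0// => i _; rewrite big_nil mulr0.
have IH' k : k%:R * lcoef l k =
    - \sum_(i < k) lcoef l (k.-1 - i) * \sum_(b <- l) b ^+ i.+1.
  by case: k => [|k]; [rewrite mul0r big_ord0 oppr0|rewrite IH].
under eq_bigr do rewrite big_cons.
set p := fun i => \sum_(b <- l) b ^+ i.+1.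
(* The powers of the new element itself: the recursion for [lcoef] makes the sum telescope, leaving
   only [a * lcoef l m]. *)
have geo : \sum_(i < m.+1) lcoef (a :: l) (m - i) * a ^+ i.+1 = a * lcoef l m.
  case: m => [|m]; first by rewrite big_ord1 /= expr1 mulr0 subr0 mulrC.
  rewrite big_ord_recr /= subnn mulr0 subr0 lcoef0 mul1r.
  transitivity (\sum_(i < m.+1) (lcoef l (m - i).+1 * a ^+ i.+1 -
      lcoef l (m - i) * a ^+ i.+2) + a ^+ m.+2).
    congr (_ + _); apply: eq_bigr => i _; rewrite subSn; last by rewrite -ltnS ltn_ord.
    by rewrite /= !exprS; ring.
  rewrite sumrB big_ord_recl [X in _ - X]big_ord_recr /= subnn lcoef0 mul1r subn0 expr1.
  have -> : \sum_(i < m) lcoef l (m - bump 0 i).+1 * a ^+ (bump 0 i).+1 =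
            \sum_(i < m) lcoef l (m - i) * a ^+ i.+2.
    by apply: eq_bigr => i _; rewrite /bump /= add1n subnSK.
  by ring.
have -> : \sum_(i < m.+1) lcoef (a :: l) (m - i) * (a ^+ i.+1 + p i) =
   a * lcoef l m + \sum_(i < m.+1) lcoef (a :: l) (m - i) * p i.
  by rewrite -geo -big_split; apply: eq_bigr => i _; rewrite mulrDr.
have -> : \sum_(i < m.+1) lcoef (a :: l) (m - i) * p i =
  \sum_(i < m.+1) lcoef l (m - i) * p i - a * \sum_(i < m) lcoef l (m.-1 - i) * p i.
  rewrite !big_ord_recr /= subnn mulr0 subr0 -addrA [X in _ = _ + X]addrC addrA.
  congr (_ + _); rewrite mulr_sumr -sumrB; apply: eq_bigr => i _.
  have -> : (m - i = (m.-1 - i).+1)%N by have := ltn_ord i; lia.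
  by rewrite mulrBl mulrA.
have h1 := IH m; have h2 := IH' m.
rewrite -/(p _) in h1 h2.
rewrite /=.
have -> : \sum_(i < m.+1) lcoef l (m - i) * p i = - (m.+1%:R * lcoef l m.+1) by rewrite h1 opprK.
have -> : \sum_(i < m) lcoef l (m.-1 - i) * p i = - (m%:R * lcoef l m) by rewrite h2 opprK.
by rewrite -(@natr1 R m); ring.
Qed.

(** [M] is fixed in advance: coefficients beyond the number of points vanish, so one [M] serves all
    configurations with fewer points, and the function depends on finitely many real statistics. *)
Definition polyfun (v : nat -> R) (M : nat) (s : R[i]) : R[i] :=
  cexp ('i%C * pi%:C%C * s) * \sum_(m < M) (v m)%:C%C * s ^+ m.

End Coefficients.

(** * Summation by parts *)

Section Abel.
Variable R : realType.
Implicit Types (l : seq R) (x : R).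

Definition imbal l (j : nat) : R :=
  \sum_(x <- l) ((0 < x <= j%:R)%R%:R - (- j%:R <= x < 0)%R%:R).

Definition shell l (j : nat) : R := \sum_(x <- l) (j%:R < `|x| <= j.+1%:R)%R%:R.

(** The imbalance enters at [j.+1] because summation by parts leaves
    [1 / j - 1 / j.+1 = 1 / (j * j.+1)] in front of it. The shell term is the cost of replacing
    [|x|] by [j] on the shell, at most [1 / j ^ 2] per point. *)
Definition varterm l (j : nat) : R :=
  `|imbal l j.+1| / (j%:R * j.+1%:R) + shell l j / j%:R ^+ 2.

Lemma shell_ge0 l j : 0 <= shell l j.
Proof. by apply: sumr_ge0 => x _; rewrite ler0n. Qed.

Let shell_split (k J : nat) x : (k <= J)%N ->
  (k%:R < `|x| <= J.+1%:R) = (k%:R < `|x| <= J%:R) || (J%:R < `|x| <= J.+1%:R).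
Proof.
move=> kJ; have kJ' : k%:R <= J%:R :> R by rewrite ler_nat.
have JJ : J%:R <= J.+1%:R :> R by rewrite ler_nat.
case: (leP `|x| J%:R) => xJ /=; first by rewrite andbT orbF (le_trans xJ JJ) andbT.
by rewrite andbF /= (le_lt_trans kJ' xJ).
Qed.

Let shell_disj (k J : nat) x :
  (k%:R < `|x| <= J%:R) && (J%:R < `|x| <= J.+1%:R) = false.
Proof. by case: (leP `|x| J%:R); rewrite ?andbF. Qed.

Let sum_shell_split (F : R -> R) l (k J : nat) : (k <= J)%N ->
  \sum_(x <- l | k%:R < `|x| <= J.+1%:R) F x =
  \sum_(x <- l | k%:R < `|x| <= J%:R) F x +
  \sum_(x <- l | J%:R < `|x| <= J.+1%:R) F x.
Proof.
move=> kJ; rewrite big_mkcond [in RHS]big_mkcond [X in _ = _ + X]big_mkcond -big_split.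
apply: eq_bigr => x _; rewrite shell_split//.
have := shell_disj k J x; case: (k%:R < `|x| <= J%:R) => /=; first by move=> ->; rewrite addr0.
by rewrite add0r.
Qed.

Let sum_shell0 (F : R -> R) l (k : nat) :
  \sum_(x <- l | k%:R < `|x| <= k%:R) F x = 0.
Proof. by rewrite big_pred0// => x; case: ltgtP. Qed.

Lemma sum_sqr_shell_le l (k J : nat) : (0 < k)%N -> (k <= J)%N ->
  \sum_(x <- l | k%:R < `|x| <= J%:R) x^-1 ^+ 2 <=
  \sum_(k <= j < J) shell l j / j%:R ^+ 2.
Proof.
move=> k0; elim: J => [|J IH]; first by rewrite leqn0 => /eqP ->; rewrite sum_shell0 sumr_ge0// => j _; rewrite divr_ge0 ?shell_ge0 ?sqr_ge0.
rewrite leq_eqVlt ltnS => /orP[/eqP ->|kJ].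
  by rewrite sum_shell0 big_geq.
rewrite sum_shell_split// big_nat_recr//= lerD ?IH//.
rewrite /shell mulr_suml big_mkcond ler_sum// => x _.
case: ifPn => [/andP[Jx xJ]|_]; last by rewrite mul0r.
have J0 : 0 < J%:R :> R by rewrite ltr0n (leq_trans k0).
rewrite mul1r -exprVn -[x^-1 ^+ 2]real_normK ?num_real// normfV.
by rewrite lerXn2r ?nnegrE ?invr_ge0// lef_pV2 ?posrE// ?(lt_trans J0)// ltW.
Qed.

(** With every [|x|] on the shell replaced by [J], only the signs are left, and the sum of the signs
    is the increment of the imbalance. *)
Lemma shell_inv_approx l (J : nat) : (0 < J)%N ->
  `|\sum_(x <- l | J%:R < `|x| <= J.+1%:R) x^-1 - (imbal l J.+1 - imbal l J) / J%:R|
  <= shell l J / J%:R ^+ 2.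
Proof.
move=> J0'; have J0 : 0 < J%:R :> R by rewrite ltr0n.
have JS : J.+1%:R = J%:R + 1 :> R by rewrite natr1.
rewrite big_mkcond /imbal -sumrB mulr_suml -sumrB /shell mulr_suml.
apply: (le_trans (ler_norm_sum _ _ _)); apply: ler_sum => x _.
case: (ltgtP x 0) => [x0|x0|x0]; last first.
- have -> : `|x| = 0 by apply/eqP; rewrite normr_eq0 x0.
  have -> : (J%:R < 0 :> R) = false by apply/negbTE; rewrite -leNgt ltW.
  by rewrite /= !andbF /= !(subr0, mul0r, normr0).
- have -> : `|x| = x by exact: gtr0_norm.
  rewrite /= !andbF !subr0.
  case: (ltP J%:R x) => Jx /=; last first.
    rewrite (le_trans Jx) ?ler_nat// subrr mul0r subr0 normr0 mul0r//.
  case: (leP x J.+1%:R) => xJ /=; last by rewrite subr0 mul0r subr0 normr0 mul0r.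
  rewrite subr0 !mul1r.
  have -> : x^-1 - J%:R^-1 = - ((x - J%:R) / (J%:R * x)) by field; rewrite !gt_eqF.
  rewrite normrN ger0_norm; last by rewrite divr_ge0 ?mulr_ge0 ?subr_ge0 ?ltW.
  rewrite ler_pdivrMr ?mulr_gt0// expr2 invfM mulrACA mulVf ?gt_eqF// mul1r.
  rewrite mulrC ler_pdivlMr//.
  apply: le_trans (ltW Jx); rewrite -[leRHS]mul1r ler_wpM2r ?(ltW J0)//.
  by rewrite lerBlDl -JS.
- have -> : `|x| = - x by exact: ltr0_norm.
  rewrite /= !andbT !sub0r.
  have e1 : (- J.+1%:R <= x) = (- x <= J.+1%:R) by apply/idP/idP; lra.
  have e2 : (- J%:R <= x) = (- x <= J%:R) by apply/idP/idP; lra.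
  rewrite e1 e2 opprK; have {x0 e1 e2}: 0 < - x by lra.
  rewrite -[x^-1]opprK -invrN; move: (- x) => {}x x0.
  case: (ltP J%:R x) => Jx /=; last first.
    by rewrite (le_trans Jx) ?ler_nat// addNr mul0r subr0 normr0 mul0r//.
  case: (leP x J.+1%:R) => xJ /=; last by rewrite oppr0 addr0 mul0r subr0 normr0 mul0r.
  rewrite addr0 !mul1r mulNr mul1r opprK.
  have -> : - x^-1 + J%:R^-1 = ((x - J%:R) / (J%:R * x)) by field; rewrite !gt_eqF.
  rewrite ger0_norm; last by rewrite divr_ge0 ?mulr_ge0 ?subr_ge0 ?ltW.
  rewrite ler_pdivrMr ?mulr_gt0// expr2 invfM mulrACA mulVf ?gt_eqF// mul1r.
  rewrite mulrC ler_pdivlMr//.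
  apply: le_trans (ltW Jx); rewrite -[leRHS]mul1r ler_wpM2r ?(ltW J0)//.
  by rewrite lerBlDl -JS.
Qed.

(* Summation by parts: the sum of the inverses is the Stieltjes integral of
   [1 / t] against the imbalance. *)
Lemma sum_inv_shell_le l (k J : nat) : (0 < k)%N -> (k <= J)%N ->
  `|\sum_(x <- l | k%:R < `|x| <= J%:R) x^-1 - imbal l J / J%:R + imbal l k / k%:R|
  <= \sum_(k <= j < J) varterm l j.
Proof.
move=> k0; elim: J => [|J IH]; first by rewrite leqNgt k0.
rewrite leq_eqVlt ltnS => /orP[/eqP ->|kJ].
  by rewrite sum_shell0 sub0r addNr normr0 big_geq.
have J0 : (0 < J)%N by rewrite (leq_trans k0).
have J0' : 0 < J%:R :> R by rewrite ltr0n.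
have JS0 : 0 < J.+1%:R :> R by rewrite ltr0n.
have k0' : 0 < k%:R :> R by rewrite ltr0n.
rewrite sum_shell_split// big_nat_recr//=.
have h1 := IH kJ; have h2 := shell_inv_approx l J0.
set T := \sum_(x <- l | _) _ in h1 *; set t := \sum_(x <- l | _) _ in h2 *.
have -> : T + t - imbal l J.+1 / J.+1%:R + imbal l k / k%:R =
  (T - imbal l J / J%:R + imbal l k / k%:R) +
  ((t - (imbal l J.+1 - imbal l J) / J%:R) + imbal l J.+1 / (J%:R * J.+1%:R)).
  rewrite -[J.+1%:R]natr1; field.
  by rewrite natr1 !gt_eqF.
rewrite (le_trans (ler_normD _ _))// lerD// (le_trans (ler_normD _ _))//.
rewrite addrC /varterm lerD// normrM normfV.
by rewrite (@ger0_norm _ (J%:R * J.+1%:R))// mulr_ge0.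
Qed.

End Abel.

(** * Tail control of the product *)

Section ComplexLimits.
Variable R : realType.

Lemma cvg_normcP (f : R -> R[i]^o) (l : R[i]^o) :
  (f B @[B --> +oo] --> l) <->
  (forall e : R, 0 < e -> exists B0, forall B, B0 <= B -> normc (f B - l) <= e).
Proof.
split => [/cvgrPdist_le fl e e0|fl].
  have e0' : 0 < e%:C%C :> R[i] by rewrite ltcR.
  have [B0 [_ hB]] := fl _ e0'.
  exists (B0 + 1) => B BB; have := hB B.
  rewrite normcEC lecR normc_subC; apply; apply: lt_le_trans BB; rewrite ltrDl//.
apply/cvgrPdist_le => -[e e'] /=; rewrite ltcE /= => /andP[/eqP -> e0].
have [B0 hB] := fl _ e0; exists B0; split; first exact: num_real.
by move=> B /ltW /hB; rewrite normcEC (lecR _ e) normc_subC.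
Qed.

Lemma real_cauchy_cvg (f : R -> R) :
  (forall e : R, 0 < e -> exists l B0, forall B, B0 <= B -> `|f B - l| <= e) ->
  cvg (f B @[B --> +oo]).
Proof.
move=> fC; apply/cauchy_cvgP; apply: cauchy_exP => e e0.
have e20 : 0 < e / 2 by rewrite divr_gt0.
have [l [B0 hB]] := fC _ e20; exists l; exists B0; split; first exact: num_real.
move=> B /ltW BB /=; rewrite /ball /= distrC (le_lt_trans (hB _ BB))//.
by rewrite ltr_pdivrMr// ltr_pMr// ltr1n.
Qed.

Lemma complex_cauchy_cvg (f : R -> R[i]^o) :
  (forall e : R, 0 < e -> exists B0, forall B B', B0 <= B -> B <= B' ->
     normc (f B' - f B) <= e) ->
  cvg (f B @[B --> +oo]).
Proof.
move=> fC.
have part (g : R[i] -> R) : (forall x y, g (x - y) = g x - g y) ->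
    (forall x, `|g x| <= normc x) -> cvg (g (f B) @[B --> +oo]).
  move=> gB gn; apply: real_cauchy_cvg => e /fC[B0 hB]; exists (g (f B0)), B0 => B BB.
  by rewrite -gB (le_trans (gn _))// hB.
have cre : cvg (complex.Re (f B) @[B --> +oo]).
  by apply: part => [[a b] [c d]//|x]; exact: normc_Re.
have cim : cvg (complex.Im (f B) @[B --> +oo]).
  by apply: part => [[a b] [c d]//|x]; exact: normc_Im.
apply/cvg_ex; exists ((lim (complex.Re (f B) @[B --> +oo])) +i* (lim (complex.Im (f B) @[B --> +oo])))%C.
apply/cvg_normcP => e e0.
have e20 : 0 < e / 2 by rewrite divr_gt0.
move/cvgrPdist_le : cre => /(_ _ e20) [B1 [_ h1]].
move/cvgrPdist_le : cim => /(_ _ e20) [B2 [_ h2]].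
exists (Num.max B1 B2 + 1) => B BB.
rewrite (le_trans (normc_leReIm _))//.
have l1 : B1 < B by apply: lt_le_trans BB; rewrite (@le_lt_trans _ _ (Num.max B1 B2)) ?ltrDl// le_max lexx.
have l2 : B2 < B by apply: lt_le_trans BB; rewrite (@le_lt_trans _ _ (Num.max B1 B2)) ?ltrDl// le_max lexx orbT.
have := h1 _ l1; have := h2 _ l2; rewrite distrC [X in _ -> X <= _ -> _]distrC.
case: (f B) => a b /=; lra.
Qed.

End ComplexLimits.

Section Control.
Variable R : realType.
Implicit Types (c : configuration R) (x : R) (j k : nat).

Definition imbalance c j : R :=
  count_in c [set` `]0, j%:R]] - count_in c [set` `[- j%:R, 0[].

Definition annulus c j : R :=
  count_in c [set` `]j%:R, j.+1%:R]] + count_in c [set` `[- j.+1%:R, - j%:R[].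

Definition tail_term c j : R :=
  `|imbalance c j.+1| / (j%:R * j.+1%:R) + annulus c j / j%:R ^+ 2.

(* Bounds both the principal value sum of [1 / x] and the sum of [1 / x ^ 2] over
   the points with [k < |x|]. *)
Definition tail_control c k : \bar R :=
  (((`|imbalance c k| + annulus c k) / k%:R)%:E +
   \sum_(0 <= i <oo) (tail_term c (i + k))%:E)%E.

Lemma imbalance_pts c j (B : R) : j%:R <= B -> imbalance c j = imbal (pts c B) j.
Proof.
move=> jB; have j0 : 0 <= j%:R :> R by rewrite ler0n.
rewrite /imbalance !(@count_in_pts _ _ B); first last.
- move=> x /=; rewrite in_itv/= => /andP[h1 h2]; rewrite ler_norml; apply/andP; split; lra.
- move=> x /=; rewrite in_itv/= => /andP[h1 h2]; rewrite ler_norml; apply/andP; split; lra.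
rewrite big_mkcond [X in _ - X]big_mkcond -sumrB; apply: eq_bigr => x _.
rewrite !mem_setE !in_itv/=.
by case: (_ && _); case: (_ && _).
Qed.

Lemma annulus_pts c j (B : R) : j.+1%:R <= B -> annulus c j = shell (pts c B) j.
Proof.
move=> jB; have j0 : 0 <= j%:R :> R by rewrite ler0n.
have jj : j%:R < j.+1%:R :> R by rewrite ltr_nat.
rewrite /annulus !(@count_in_pts _ _ B); first last.
- move=> x /=; rewrite in_itv/= => /andP[h1 h2]; rewrite ler_norml; apply/andP; split; lra.
- move=> x /=; rewrite in_itv/= => /andP[h1 h2]; rewrite ler_norml; apply/andP; split; lra.
rewrite big_mkcond [X in _ + X]big_mkcond -big_split; apply: eq_bigr => x _.
rewrite !mem_setE !in_itv/=.
have [x0|x0] := leP 0 x.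
  rewrite ger0_norm//; have -> : (x < - j%:R) = false by apply/negbTE; rewrite -leNgt; lra.
  by rewrite andbF addr0; case: (_ && _).
rewrite ltr0_norm//; have -> : (j%:R < x) = false by apply/negbTE; rewrite -leNgt; lra.
rewrite /= add0r ltrNr [- x <= _]lerNl andbC; by case: (_ && _).
Qed.

Lemma tail_term_pts c j (B : R) : j.+1%:R <= B -> tail_term c j = varterm (pts c B) j.
Proof. by move=> jB; rewrite /tail_term (imbalance_pts _ jB) (annulus_pts _ jB). Qed.

Lemma annulus_ge0 c j : 0 <= annulus c j.
Proof. by rewrite (@annulus_pts c j j.+1%:R)// shell_ge0. Qed.

Lemma tail_term_ge0 c j : 0 <= tail_term c j.
Proof. by rewrite addr_ge0// divr_ge0 ?annulus_ge0 ?sqr_ge0 ?mulr_ge0. Qed.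

(** With [J = k] the sum is empty, and the boundary terms at [k] are bounded by themselves. *)
Lemma tail_control_partial c k J (v : R) : (tail_control c k <= v%:E)%E ->
  (`|imbalance c k| + annulus c k) / k%:R + \sum_(k <= j < J) tail_term c j <= v.
Proof.
move=> h; rewrite -lee_fin (le_trans _ h)// EFinD leeD2l// -sumEFin.
have -> : (\sum_(k <= i < J) (tail_term c i)%:E = \sum_(0 <= i < J - k) (tail_term c (i + k))%:E)%E.
  by rewrite -{1}[k]add0n big_addn.
by apply: nneseries_lim_ge => j _ _; rewrite lee_fin tail_term_ge0.
Qed.

(* A continuous, compactly supported substitute for [1 / x], exact for
   [1 / k <= |x| <= k]. *)
Definition inv_cut k x : R :=
  Num.min 1 (Num.max 0 (k.+1%:R - `|x|)) * (x / Num.max (x ^+ 2) (k%:R^-1 ^+ 2)).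

Lemma cut_inv k x : (0 < k)%N -> k%:R^-1 <= `|x| -> `|x| <= k%:R -> inv_cut k x = x^-1.
Proof.
move=> k0 kx xk; have k0' : 0 < k%:R :> R by rewrite ltr0n.
have x0 : x != 0 by rewrite -normr_gt0 (lt_le_trans _ kx)// invr_gt0.
rewrite /inv_cut min_l; last first.
  by rewrite le_max; apply/orP; right; rewrite -natr1 lerBrDl lerD2r.
rewrite max_l; last by rewrite -[x ^+ 2]real_normK ?num_real// lerXn2r ?nnegrE ?invr_ge0// ltW.
by field.
Qed.

Lemma norm_cut_le k x : `|inv_cut k x| <= `|x|^-1.
Proof.
rewrite /inv_cut normrM -[leRHS]mul1r ler_pM//.
  rewrite ger0_norm; last by rewrite le_min ler01 le_max lexx.
  by rewrite ge_min lexx.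
have [->|x0] := eqVneq x 0; first by rewrite mul0r normr0 invr0.
rewrite normrM normfV.
have m0 : 0 < Num.max (x ^+ 2) (k%:R^-1 ^+ 2) by rewrite lt_max exprn_even_gt0// x0.
rewrite (gtr0_norm m0) ler_pdivrMr// mulrC ler_pdivlMr ?normr_gt0//.
by rewrite -expr2 real_normK ?num_real// le_max lexx.
Qed.

Lemma cut_eq0 k x : k.+1%:R <= `|x| -> inv_cut k x = 0.
Proof. by move=> kx; rewrite /inv_cut [X in Num.min _ X]max_l ?subr_le0// min_r ?mul0r. Qed.

Lemma continuous_cut k : (0 < k)%N -> continuous (inv_cut k).
Proof.
move=> k0 x; have k0' : 0 < k%:R :> R by rewrite ltr0n.
have c1 : continuous (fun x : R => k.+1%:R - `|x|).
  by move=> z; apply: cvgB; [exact: cvg_cst|exact: norm_continuous].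
have cc (a : R) : continuous (fun _ : R => a) by move=> z; exact: cvg_cst.
have c2 := max_fun_continuous (cc 0) c1.
have c3 := min_fun_continuous (cc 1) c2.
have c4 : continuous (fun x : R => x ^+ 2).
  by move=> z; rewrite /continuous_at expr2; under eq_fun do rewrite expr2; apply: cvgM; exact: cvg_id.
have c5 := max_fun_continuous c4 (cc (k%:R^-1 ^+ 2)).
apply: cvgM; first exact: c3.
apply: cvgM; first exact: cvg_id.
apply: cvgV; last exact: c5.
by rewrite gt_eqF// lt_max; apply/orP; right; rewrite exprn_gt0// invr_gt0.
Qed.

End Control.

Section Approximation.
Variable R : realType.
Implicit Types (c : configuration R) (x : R) (j k : nat).

Lemma perm_lprod (l1 l2 : seq R) (s : R[i]) : perm_eq l1 l2 -> lprod l1 s = lprod l2 s.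
Proof. by move=> h; apply: perm_big. Qed.

Lemma normc_cexp_ipi (s : R[i]) (S : R) : normc s <= S ->
  normc (cexp ('i%C * pi%:C%C * s)) <= expR (pi * S).
Proof.
move=> sS; rewrite (le_trans (normc_cexp_le _))// ler_expR.
by rewrite [X in normc X](_ : _ = s * pi%:C%C * 'i%C); [rewrite normcM normc_sM /= expr0n add0r expr1n sqrtr1 mulr1 mulrC ger0_norm ?pi_ge0// ler_wpM2l ?pi_ge0|ring].
Qed.

Lemma size_pts_sum c (B : R) : (size (pts c B))%:R = \sum_(x <- pts c B) 1 :> R.
Proof. by rewrite big_const_seq count_predT iter_addr_0. Qed.

(** Everything happens in a window [|x| <= J]. The points with [|x| <= k] give a factor common to
    the product and to the polynomial, since [inv_cut] is exact there: the gap keeps them away from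
    zero. What remains is the product over [k < |x| <= J] on one side and the cut-off contributions
    of [k < |x| <= k.+1] on the other, each within a multiple of [eta] of one. The common factor is
    bounded through [k0] and [L], not through [k], which leaves [eta] free to be chosen small
    against it. *)
Lemma char_approx c (S : R) k0 k (L eta : R) M (s : R[i]) :
  (0 < k0)%N -> (k0 <= k)%N -> 1 <= S -> S <= k%:R -> 0 < eta -> eta <= 1 ->
  cvg (truncated_product c s B @[B --> +oo]) ->
  (forall e : R, 0 < e -> forall J0, exists2 J, (J0 <= J)%N &
     `|imbalance c J| <= e * J%:R) ->
  (forall x, `|x| <= k0%:R^-1 -> c x = 0%N) ->
  (size (pts c k0%:R))%:R <= L -> (tail_control c k0 <= L%:E)%E ->
  (tail_control c k <= eta%:E)%E -> (size (pts c k.+1%:R) < M)%N ->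
  normc s <= S -> 9 * expR 1 * (2 * S + S ^+ 2) * eta <= 1 ->
  normc (characteristic_limit c s -
         polyfun (lcoef [seq inv_cut k x | x <- pts c k.+1%:R]) M s) <=
  expR (pi * S + (S * (k0%:R * L + (L + 1)) + S ^+ 2 * (k0%:R ^+ 2 * L + L))) *
    (18 * expR 1 ^+ 2 * (2 * S + S ^+ 2) * eta) + eta.
Proof.
move=> k00 k0k S1 Sk e0 e1 cv imb gap szL VL Ve szM sS small.
have k0p : (0 < k)%N by apply: leq_trans k0k.
have k00' : 0 < k0%:R :> R by rewrite ltr0n.
have k0' : 0 < k%:R :> R by rewrite ltr0n.
have [B0 hB0] := (cvg_normcP _ _).1 cv _ e0.
(* One [J] has to lie beyond the point where the truncated product is [eta]-close to its limit and
   also have a small imbalance; the latter is known only for arbitrarily large [J], so [imb] makes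
   the choice. *)
have [J J0 hJ] := imb _ e0 (maxn k.+1 (Num.truncn B0).+1).
have kJ : (k < J)%N by rewrite (leq_trans _ J0)// leq_maxl.
have kJ' : k%:R <= J%:R :> R by rewrite ler_nat ltnW.
have kSJ : k.+1%:R <= J%:R :> R by rewrite ler_nat.
have Jp : 0 < J%:R :> R by rewrite ltr0n (leq_trans _ kJ).
have BJ : B0 <= J%:R.
  apply: ltW; apply: (lt_le_trans (truncnS_gt _)).
  by rewrite ler_nat; apply: leq_trans J0; exact: leq_maxr.
have k0J : k0%:R <= J%:R :> R by rewrite (le_trans _ kJ')// ler_nat.
set l := pts c J%:R.
have lJ x : x \in l -> `|x| <= J%:R by rewrite mem_pts => /andP[].
have lgap x : x \in l -> k0%:R^-1 <= `|x|.
  rewrite mem_pts => /andP[_ cx]; rewrite leNgt; apply/negP => /ltW /gap h.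
  by rewrite h in cx.
set A := [seq x^-1 | x <- l & `|x| <= k%:R].
set A' := [seq x^-1 | x <- l & k%:R < `|x| <= J%:R].
set B' := [seq inv_cut k x | x <- l & k%:R < `|x| <= k.+1%:R].
have eT : truncated_product c s J%:R = cexp ('i%C * pi%:C%C * s) * (lprod A s * lprod A' s).
  rewrite truncated_product_pts -lprod_cat -map_cat; congr (_ * _).
  apply/perm_lprod/perm_map; rewrite -/l -(perm_filterC (fun x => `|x| <= k%:R) l) perm_cat2l.
  rewrite (@eq_in_filter _ (predC (fun x => `|x| <= k%:R)) (fun x => k%:R < `|x| <= J%:R))//.
  by move=> x xl /=; rewrite ltNge lJ ?andbT.
have eP : polyfun (lcoef [seq inv_cut k x | x <- pts c k.+1%:R]) M s =
    cexp ('i%C * pi%:C%C * s) * (lprod A s * lprod B' s).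
  rewrite /polyfun -lprod_lcoef ?size_map//; congr (_ * _).
  have -> : A = [seq inv_cut k x | x <- l & `|x| <= k%:R].
    apply/eq_in_map => x; rewrite mem_filter => /andP[xk xl].
    by rewrite cut_inv// (le_trans _ (lgap _ xl))// lef_pV2 ?posrE// ler_nat.
  rewrite -lprod_cat -map_cat; apply/perm_lprod/perm_map.
  rewrite (perm_trans (pts_filter c kSJ))// -/l.
  rewrite -(perm_filterC (fun x => `|x| <= k%:R) [seq x <- l | `|x| <= k.+1%:R]).
  rewrite -!filter_predI.
  rewrite (@eq_filter _ (predI _ _) (fun x => `|x| <= k%:R)); last first.
    move=> x /=; case: (leP `|x| k%:R) => //= xk; rewrite (le_trans xk)// ler_nat//.
  by rewrite perm_cat2l (@eq_filter _ (predI _ _) (fun x => k%:R < `|x| <= k.+1%:R))// => x /=; rewrite ltNge.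
have V0 J' := tail_control_partial J' VL.
have V1 J' := tail_control_partial J' Ve.
have tt J' K : (J' <= J)%N -> \sum_(K <= j < J') tail_term c j = \sum_(K <= j < J') varterm l j.
  move=> JJ; rewrite !big_nat; apply: eq_bigr => j /andP[_ jJ].
  by rewrite (@tail_term_pts R c j J%:R)// ler_nat (leq_trans jJ).
have ttW J' K : (J' <= J)%N -> \sum_(K <= j < J') shell l j / j%:R ^+ 2 <= \sum_(K <= j < J') tail_term c j.
  move=> JJ; rewrite tt// ler_sum// => j _; rewrite /varterm lerDr.
  by rewrite divr_ge0// mulr_ge0.
have im j : (j <= J)%N -> imbal l j = imbalance c j.
  by move=> jJ; rewrite (@imbalance_pts R c j J%:R)// ler_nat.
have ann j : 0 <= annulus c j := annulus_ge0 c j.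
have q0 j K : 0 <= annulus c j / K%:R :> R by rewrite divr_ge0.
have i0 j K : 0 <= `|imbalance c j| / K%:R :> R by rewrite divr_ge0.
have nI j K : (0 < K)%N -> `|imbalance c j / K%:R| = `|imbalance c j| / K%:R.
  by move=> K0; rewrite normrM normfV (@ger0_norm _ K%:R).
have esz : (size (pts c k0%:R))%:R = \sum_(x <- l | `|x| <= k0%:R) 1 :> R.
  by rewrite size_pts_sum; apply: sum_pts_filter.
have spl (F : R -> R) : \sum_(x <- l | `|x| <= k%:R) F x =
   \sum_(x <- l | `|x| <= k0%:R) F x + \sum_(x <- l | k0%:R < `|x| <= k%:R) F x.
  rewrite (bigID (fun x => `|x| <= k0%:R)) /=; congr (_ + _); apply: eq_bigl => x.
    by case: (leP `|x| k0%:R) => h; rewrite ?andbF// andbT (le_trans h)// ler_nat.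
  by rewrite -ltNge andbC.
(* Inside [k0] there are at most [L] points, with inverses at most [k0]. Between [k0] and [k],
   summation by parts costs at most [L], boundary term at [k0] included, plus the boundary term at
   [k], which is at most [eta <= 1]. *)
have hA1 : `|\sum_(a <- A) a| <= k0%:R * L + (L + 1).
  rewrite big_map big_filter spl (le_trans (ler_normD _ _))// lerD//.
    rewrite (le_trans (ler_norm_sum _ _ _))//.
    rewrite (@le_trans _ _ (k0%:R * (\sum_(x <- l | `|x| <= k0%:R) 1)))//; last first.
      by rewrite -esz ler_wpM2l// ltW.
    rewrite mulr_sumr big_seq_cond [leRHS]big_seq_cond ler_sum// => x /andP[xl _].
    rewrite mulr1 normfV -[leRHS]invrK lef_pV2 ?lgap// posrE ?invr_gt0//.
    by rewrite (lt_le_trans _ (lgap _ xl))// invr_gt0.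
  have h := sum_inv_shell_le l k00 k0k; rewrite -tt ?(ltnW kJ)// in h.
  rewrite (im k) ?(ltnW kJ)// (im k0) in h; last by rewrite (leq_trans k0k)// ltnW.
  set T := \sum_(_ <- _ | _) _ in h *.
  have -> : T = (T - imbalance c k / k%:R + imbalance c k0 / k0%:R) + (imbalance c k / k%:R - imbalance c k0 / k0%:R) by ring.
  rewrite (le_trans (ler_normD _ _))// (le_trans (lerD h (ler_normB _ _)))//.
  rewrite !nI//.
  have := V0 k; rewrite mulrDl; have := q0 k0 k0.
  have := V1 k; rewrite mulrDl big_geq// addr0; have := q0 k k; have := i0 k k; lra.
have hA2 : \sum_(a <- A) a ^+ 2 <= k0%:R ^+ 2 * L + L.
  rewrite big_map big_filter spl lerD//.
    rewrite (@le_trans _ _ (k0%:R ^+ 2 * (\sum_(x <- l | `|x| <= k0%:R) 1)))//; last first.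
      by rewrite -esz ler_wpM2l// sqr_ge0.
    rewrite mulr_sumr big_seq_cond [leRHS]big_seq_cond ler_sum// => x /andP[xl _].
    rewrite mulr1 -[x^-1 ^+ 2]real_normK ?num_real// lerXn2r ?nnegrE ?(ltW k00')//.
    rewrite normfV -[leRHS]invrK lef_pV2 ?lgap// posrE ?invr_gt0//.
    by rewrite (lt_le_trans _ (lgap _ xl))// invr_gt0.
  rewrite (le_trans (sum_sqr_shell_le _ _ _))//.
  rewrite (le_trans (ttW _ _ _)) ?(ltnW kJ)//.
  by have := V0 k; rewrite mulrDl; have := q0 k0 k0; have := i0 k0 k0; lra.
have hA'1 : `|\sum_(a <- A') a| <= 2 * eta.
  rewrite big_map big_filter.
  have h := sum_inv_shell_le l k0p (ltnW kJ); rewrite -tt// in h.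
  rewrite (im k) ?(ltnW kJ)// (im J)// in h.
  set T := \sum_(_ <- _ | _) _ in h *.
  have -> : T = (T - imbalance c J / J%:R + imbalance c k / k%:R) + (imbalance c J / J%:R - imbalance c k / k%:R) by ring.
  rewrite (le_trans (ler_normD _ _))// (le_trans (lerD h (ler_normB _ _)))//.
  rewrite !nI// ?(leq_trans _ kJ)//.
  have : `|imbalance c J| / J%:R <= eta by rewrite ler_pdivrMr.
  have := V1 J; rewrite mulrDl; have := q0 k k; lra.
have hA'2 : \sum_(a <- A') a ^+ 2 <= eta.
  rewrite big_map big_filter (le_trans (sum_sqr_shell_le _ _ _)) ?(ltnW kJ)//.
  rewrite (le_trans (ttW _ _ _))//.
  by have := V1 J; rewrite mulrDl; have := q0 k k; have := i0 k k; lra.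
have ek : shell l k = annulus c k by rewrite (@annulus_pts R c k J%:R).
have ca x : k%:R < `|x| -> `|inv_cut k x| <= k%:R^-1.
  move=> xk; rewrite (le_trans (norm_cut_le _ _))// lef_pV2 ?posrE//; first exact: ltW.
  exact: lt_trans xk.
(* On this shell the inverses are bounded one by one: it has at most [eta * k] points, which is why
   [tail_control] contains the annulus at [k], and each contributes at most [1 / k]. *)
have hB'1 : `|\sum_(a <- B') a| <= 2 * eta.
  rewrite big_map big_filter (le_trans (ler_norm_sum _ _ _))//.
  rewrite (@le_trans _ _ (shell l k / k%:R))//; last first.
    by rewrite ek; have := V1 k; rewrite mulrDl big_geq//; have := i0 k k; lra.
  rewrite /shell mulr_suml big_mkcond ler_sum// => x _.
  by case: ifPn => [/andP[xk _]|_]; [rewrite mul1r ca|rewrite mul0r].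
have hB'2 : \sum_(a <- B') a ^+ 2 <= eta.
  rewrite big_map big_filter.
  rewrite (@le_trans _ _ (shell l k / k%:R))//; last first.
    by rewrite ek; have := V1 k; rewrite mulrDl big_geq//; have := i0 k k; lra.
  rewrite /shell mulr_suml big_mkcond ler_sum// => x _.
  case: ifPn => [/andP[xk _]|_]; last by rewrite mul0r.
  rewrite mul1r -[_ ^+ 2]real_normK ?num_real// expr2 -[leRHS]mul1r ler_pM ?ca//.
  by rewrite (le_trans (ca _ xk))// invf_le1 // ler1n.
have e10 := expR_gt0 (1 : R).
have SS0 : 0 <= S ^+ 2 by rewrite sqr_ge0.
have S0 : 0 <= S by lra.
have sm (X : seq R) : `|\sum_(a <- X) a| <= 2 * eta -> \sum_(a <- X) a ^+ 2 <= eta ->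
    (forall a, a \in X -> `|a| <= k%:R^-1) ->
    normc (lprod X s - 1) <= 9 * expR 1 ^+ 2 * ((2 * S + S ^+ 2) * eta).
  move=> X1 X2 X3.
  have X4 : S * `|\sum_(a <- X) a| + S ^+ 2 * \sum_(a <- X) a ^+ 2 <= (2 * S + S ^+ 2) * eta.
    rewrite mulrDl lerD//; last by rewrite ler_wpM2l.
    by rewrite [2 * S]mulrC -mulrA ler_wpM2l.
  rewrite (le_trans (lprod_sub1_le sS _ _))//.
  - move=> a /X3 ha; rewrite (le_trans (ler_pM _ _ Sk ha))// divff// gt_eqF//.
  - by apply: le_trans small; rewrite -[leRHS]mulrA ler_wpM2l// mulr_ge0// ltW.
  - by rewrite ler_wpM2l// mulr_ge0 ?sqr_ge0.
have sA' := sm _ hA'1 hA'2 _; have sB' := sm _ hB'1 hB'2 _.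
have {}sA' : normc (lprod A' s - 1) <= 9 * expR 1 ^+ 2 * ((2 * S + S ^+ 2) * eta).
  apply: sA' => a /mapP[x]; rewrite mem_filter => /andP[/andP[xk _] _] ->.
  by rewrite normfV lef_pV2 ?posrE ?ltW// (lt_trans _ xk).
have {}sB' : normc (lprod B' s - 1) <= 9 * expR 1 ^+ 2 * ((2 * S + S ^+ 2) * eta).
  by apply: sB' => a /mapP[x]; rewrite mem_filter => /andP[/andP[xk _] _] ->; exact: ca.
have -> : characteristic_limit c s - polyfun (lcoef [seq inv_cut k x | x <- pts c k.+1%:R]) M s =
   (cexp ('i%C * pi%:C%C * s) * lprod A s) * ((lprod A' s - 1) - (lprod B' s - 1)) -
   (truncated_product c s J%:R - characteristic_limit c s).
  by rewrite eP eT; ring.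
rewrite (le_trans (le_normcB _ _))// lerD//; last exact: hB0.
rewrite normcM ler_pM ?normc_ge0//.
  rewrite normcM expRD ler_pM ?normc_ge0//; first exact: normc_cexp_ipi.
  rewrite (le_trans (normc_lprod_le _ _))// ler_expR lerD// ler_pM ?normc_ge0// ?sqr_ge0//.
    by apply: sumr_ge0 => a _; rewrite sqr_ge0.
  by rewrite lerXn2r ?nnegrE ?normc_ge0.
rewrite (le_trans (le_normcB _ _))// (le_trans (lerD sA' sB'))//.
by rewrite -mulrDl -mulrDr; lra.
Qed.

End Approximation.

(** * Locally uniform convergence of the truncated products *)

Section TruncatedLimit.
Variable R : realType.
Implicit Types (c : configuration R) (x : R).

(** The [+ 1] keeps the threshold meaningful when [a = 0]; many small parameters are chosen this
    way. *)
Lemma prodM3_le (a b e : R) : 0 <= a -> 0 < e -> b <= e / (a + 1) -> a * b <= e.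
Proof.
move=> a0 e0 h; have a1 : 0 < a + 1 by lra.
rewrite (le_trans (ler_wpM2l a0 h))// mulrCA -[leRHS]mulr1 ler_pM2l//.
by rewrite ler_pdivrMr// mul1r lerDl.
Qed.

(** Passing from [B] to [B'] multiplies by the product over [B < |x| <= B'], which is near one
    because the principal value is Cauchy and the sum of squares is almost exhausted. The bounds
    depend on [s] only through [S]. *)
Lemma truncated_cauchy c :
  cvg (\sum_(x <- pts c B) x^-1 @[B --> +oo]) ->
  (exists Q : R, forall B, \sum_(x <- pts c B) x^-1 ^+ 2 <= Q) ->
  forall S e : R, 0 < e -> exists B0, forall B B', B0 <= B -> B <= B' ->
    forall s : R[i], normc s <= S ->
    normc (truncated_product c s B' - truncated_product c s B) <= e.
Proof.
move=> cv [Q hQ] S0 e e0.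
set S := Num.max S0 1.
have S1 : 1 <= S by rewrite /S le_max lexx orbT.
have SS0 : S0 <= S by rewrite /S le_max lexx.
have Sp : 0 < S by lra.
set l := lim _ in cv; have {}cv : (\sum_(x <- pts c B) x^-1 @[B --> +oo]) --> l by [].
set K := expR (pi * S + (S * (`|l| + 1) + S ^+ 2 * Q)) * (9 * expR 1 ^+ 2 * (2 * S + S ^+ 2)).
set C0 := 9 * expR 1 * (2 * S + S ^+ 2).
have S20 : 0 <= S ^+ 2 by rewrite sqr_ge0.
have e10 : 0 < expR (1 : R) by exact: expR_gt0.
have SS : 0 <= 2 * S + S ^+ 2 by lra.
have K0 : 0 <= K by rewrite /K !mulr_ge0 ?expR_ge0.
have C00 : 0 <= C0 by rewrite /C0 !mulr_ge0 ?expR_ge0.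
pose eta := Num.min 1 (Num.min (1 / (C0 + 1)) (e / (K + 1))).
have eta0 : 0 < eta by rewrite /eta !lt_min ltr01 !divr_gt0//; lra.
have eta1 : eta <= 1 by rewrite /eta ge_min lexx.
have etaC : C0 * eta <= 1.
  by apply: prodM3_le => //; rewrite /eta !ge_min lexx ?orbT.
have etaK : K * eta <= e.
  by apply: prodM3_le => //; rewrite /eta !ge_min lexx ?orbT.
move/cvgrPdist_le : cv => /(_ _ eta0) [B1 [_ h1]].
pose q B := \sum_(x <- pts c B) x^-1 ^+ 2.
(* The sum of squares is nondecreasing in the cutoff and bounded, so beyond a near-maximiser of [q]
   it grows by at most [eta]. *)
have [B2 hB2] : exists B2, forall B, q B <= q B2 + eta.
  have hs : has_sup (range q) by split; [exists (q 0), 0|exists Q => _ [B _ <-]; exact: hQ].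
  have [_ [B2 _ <-] h2] := sup_adherent eta0 hs.
  exists B2 => B; have : q B <= sup (range q) by apply: sup_upper_bound => //; exists B.
  lra.
exists (Num.max (B1 + 1) (Num.max B2 S)) => B B'.
rewrite !ge_max => /andP[BB1 /andP[BB2 BS1]] BB' s sS0.
have BS : S <= B by rewrite /S ge_max.
have sS : normc s <= S by lra.
rewrite !truncated_product_pts -mulrBr.
set f := fun P : pred R => lprod [seq x^-1 | x <- pts c B' & P x] s.
have eB : lprod [seq x^-1 | x <- pts c B] s = f (fun x => `|x| <= B).
  by apply/perm_lprod/perm_map/pts_filter.
have eB' : lprod [seq x^-1 | x <- pts c B'] s = f (fun x => `|x| <= B) * f (fun x => B < `|x|).
  rewrite /f -lprod_cat -map_cat; apply/perm_lprod/perm_map.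
  rewrite -(perm_filterC (fun x => `|x| <= B) (pts c B')) perm_cat2l.
  by rewrite (@eq_filter _ (predC _) (fun x => B < `|x|))// => x /=; rewrite ltNge.
have sig B3 : B1 + 1 <= B3 -> `|\sum_(x <- pts c B3) x^-1 - l| <= eta.
  by move=> h; rewrite distrC; apply: h1; lra.
have splitB (F : R -> R) : \sum_(x <- pts c B') F x =
    \sum_(x <- pts c B) F x + \sum_(x <- pts c B' | B < `|x|) F x.
  rewrite (sum_pts_filter c F BB') (bigID (fun x => `|x| <= B)) /=; congr (_ + _).
  by apply: eq_bigl => x; rewrite ltNge.
have t1 : `|\sum_(x <- pts c B' | B < `|x|) x^-1| <= 2 * eta.
  have -> : \sum_(x <- pts c B' | B < `|x|) x^-1 =
    (\sum_(x <- pts c B') x^-1 - l) - (\sum_(x <- pts c B) x^-1 - l).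
    by rewrite (splitB (fun x => x^-1)); ring.
  rewrite (le_trans (ler_normB _ _))//.
  have := sig _ BB1; have := sig B' (le_trans BB1 BB'); lra.
have t2 : \sum_(x <- pts c B' | B < `|x|) x^-1 ^+ 2 <= eta.
  have := splitB (fun x => x^-1 ^+ 2); rewrite -!/(q _).
  have := hB2 B'; have : q B2 <= q B.
    rewrite /q (sum_pts_filter c _ BB2) [leRHS](bigID (fun x => `|x| <= B2)) /= lerDl.
    by apply: sumr_ge0 => x _; rewrite sqr_ge0.
  lra.
have t3 : normc (f (fun x => B < `|x|) - 1) <= 9 * expR 1 ^+ 2 * ((2 * S + S ^+ 2) * eta).
  have X4 : S * `|\sum_(a <- [seq x^-1 | x <- pts c B' & B < `|x|]) a| +
      S ^+ 2 * \sum_(a <- [seq x^-1 | x <- pts c B' & B < `|x|]) a ^+ 2 <= (2 * S + S ^+ 2) * eta.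
    rewrite !big_map !big_filter mulrDl lerD//; last by rewrite ler_wpM2l.
    by rewrite [2 * S]mulrC -mulrA ler_wpM2l// ltW.
  rewrite (le_trans (lprod_sub1_le sS _ _))//.
  - move=> a /mapP[x]; rewrite mem_filter => /andP[Bx _] ->.
    rewrite normfV ler_pdivrMr ?mul1r; last by lra.
    by rewrite (le_trans BS)// ltW.
  - by apply: le_trans etaC; rewrite /C0 -[leRHS]mulrA ler_wpM2l// mulr_ge0// ltW.
  - by rewrite ler_wpM2l// mulr_ge0 ?sqr_ge0.
have t4 : normc (f (fun x => `|x| <= B)) <= expR (S * (`|l| + 1) + S ^+ 2 * Q).
  rewrite -eB (le_trans (normc_lprod_le _ _))// ler_expR !big_map lerD//.
    rewrite ler_pM ?normc_ge0//.
    have := sig _ BB1; set t := \sum_(_ <- _) _ => h.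
    have -> : t = (t - l) + l by ring.
    by rewrite (le_trans (ler_normD _ _))//; lra.
  rewrite ler_pM ?sqr_ge0 ?hQ//; first by apply: sumr_ge0 => x _; rewrite sqr_ge0.
  by rewrite lerXn2r ?nnegrE ?normc_ge0//; lra.
rewrite eB eB' -{2}[f (fun x => `|x| <= B)]mulr1 -mulrBr mulrA normcM normcM.
apply: le_trans etaK; rewrite /K expRD.
have t5 := ler_pM (normc_ge0 _) (normc_ge0 _) t4 t3.
have t6 := normc_cexp_ipi sS.
rewrite -mulrA (le_trans (ler_pM (normc_ge0 _) (mulr_ge0 (normc_ge0 _) (normc_ge0 _)) t6 t5))//.
by rewrite le_eqVlt; apply/orP; left; apply/eqP; ring.
Qed.

Definition summable_points c :=
  cvg (\sum_(x <- pts c B) x^-1 @[B --> +oo]) /\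
  (exists Q : R, forall B, \sum_(x <- pts c B) x^-1 ^+ 2 <= Q).

Lemma truncated_cvg c (s : R[i]) : summable_points c ->
  cvg (truncated_product c s B @[B --> +oo]).
Proof.
move=> [h1 h2]; apply: complex_cauchy_cvg => e e0.
have [B0 hB] := truncated_cauchy h1 h2 (normc s) e0.
by exists B0 => B B' h h'; exact: hB.
Qed.

Lemma truncated_cvg_unif c : summable_points c -> forall S e : R, 0 < e ->
  exists B0, forall B, B0 <= B -> forall s : R[i], normc s <= S ->
  normc (truncated_product c s B - characteristic_limit c s) <= e.
Proof.
move=> /[dup] sc [h1 h2] S e e0.
have e2 : 0 < e / 2 by rewrite divr_gt0.
have [B0 hB] := truncated_cauchy h1 h2 S e2.
exists B0 => B BB s sS.
have [B1 hB1] := (cvg_normcP _ _).1 (@truncated_cvg c s sc) _ e2.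
have h := hB B (Num.max B B1) BB (_ : B <= _) s sS.
have := hB1 (Num.max B B1); rewrite le_max lexx orbT => /(_ isT).
have {h} := h (_ : B <= _); rewrite le_max lexx => /(_ isT).
rewrite normc_subC /characteristic_limit.
set u := truncated_product c s B; set v := truncated_product c s _; set w := lim _.
move=> uv vw; have -> : u - w = (u - v) + (v - w) by ring.
rewrite (le_trans (le_normcD _ _))//; lra.
Qed.

End TruncatedLimit.

Section NormContinuity.
Variable R : realType.
Implicit Types (f g : R[i] -> R[i]).

(** Stated with real bounds: the norm of [R[i]] takes its values in [R[i]] itself, whose order is
    partial. *)
Definition ncont f := forall s (e : R), 0 < e ->
  exists2 d : R, 0 < d & forall t, normc (t - s) <= d -> normc (f t - f s) <= e.

Lemma ncont_continuous f : ncont f -> continuous (f : R[i]^o -> R[i]^o).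
Proof.
move=> cf s A /nbhs_ballP[[e e'] /=]; rewrite ltcE /= => /andP[/eqP -> e0] hA.
have e2 : 0 < e / 2 by rewrite divr_gt0.
have [d d0 hd] := cf s _ e2.
apply/nbhs_ballP; exists d%:C%C; first by rewrite /= ltcR.
move=> t; rewrite -ball_normE /= normcEC ltcR normc_subC => /ltW /hd td.
apply: hA; rewrite -ball_normE /= normcEC (ltcR _ e) normc_subC.
by apply: (le_lt_trans td); lra.
Qed.

Lemma ncontD f g : ncont f -> ncont g -> ncont (fun s => f s + g s).
Proof.
move=> cf cg s e e0; have e2 : 0 < e / 2 by rewrite divr_gt0.
have [d1 d10 h1] := cf s _ e2; have [d2 d20 h2] := cg s _ e2.
exists (Num.min d1 d2); first by rewrite lt_min d10.
move=> t; rewrite le_min => /andP[/h1 ht1 /h2 ht2].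
have -> : f t + g t - (f s + g s) = (f t - f s) + (g t - g s) by ring.
rewrite (le_trans (le_normcD _ _))//; lra.
Qed.

Lemma ncontM f g : ncont f -> ncont g -> ncont (fun s => f s * g s).
Proof.
move=> cf cg s e e0; set K := normc (f s) + normc (g s) + 1.
have K0 : 0 < K by have := normc_ge0 (f s); have := normc_ge0 (g s); rewrite /K; lra.
pose e' := Num.min 1 (e / (3 * K)).
have e'0 : 0 < e' by rewrite lt_min ltr01 divr_gt0// mulr_gt0.
have e'1 : e' <= 1 by rewrite ge_min lexx.
have e'K : 3 * K * e' <= e.
  by rewrite mulrC -ler_pdivlMr ?mulr_gt0// ge_min lexx orbT.
have [d1 d10 h1] := cf s _ e'0; have [d2 d20 h2] := cg s _ e'0.
exists (Num.min d1 d2); first by rewrite lt_min d10.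
move=> t; rewrite le_min => /andP[/h1 ht1 /h2 ht2].
have -> : f t * g t - f s * g s =
  (f t - f s) * (g t - g s) + (f t - f s) * g s + f s * (g t - g s) by ring.
rewrite (le_trans (le_normcD _ _))//.
have h3 := le_normcD ((f t - f s) * (g t - g s)) ((f t - f s) * g s).
rewrite !normcM in h3 *.
have p1 := ler_pM (normc_ge0 _) (normc_ge0 _) ht1 ht2.
have p2 := ler_wpM2r (normc_ge0 (g s)) ht1.
have p3 := ler_wpM2l (normc_ge0 (f s)) ht2.
have p4 : e' * e' <= 1 * e' by rewrite ler_wpM2r// ltW.
have q1 : 0 <= normc (f s) * e' by rewrite mulr_ge0 ?normc_ge0// ltW.
have q2 : 0 <= normc (g s) * e' by rewrite mulr_ge0 ?normc_ge0// ltW.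
rewrite /K in e'K; nra.
Qed.

Lemma ncont_cst a : ncont (fun=> a).
Proof. by move=> s e e0; exists 1 => // t _; rewrite subrr normc0 ltW. Qed.

Lemma ncont_id : ncont id.
Proof. by move=> s e e0; exists e. Qed.

Lemma ncont_sum n (F : 'I_n -> R[i] -> R[i]) : (forall i, ncont (F i)) ->
  ncont (fun s => \sum_(i < n) F i s).
Proof.
elim: n F => [|n IH] F cF.
  have -> : (fun s => \sum_(i < 0) F i s) = (fun=> 0) by apply/funext => s; rewrite big_ord0.
  exact: ncont_cst.
have -> : (fun s => \sum_(i < n.+1) F i s) =
    (fun s => F ord0 s + \sum_(i < n) F (lift ord0 i) s).
  by apply/funext => s; rewrite big_ord_recl.
by apply: ncontD => //; exact: IH.
Qed.

Lemma ncontX m : ncont (fun s => s ^+ m).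
Proof.
elim: m => [|m IH]; first exact: ncont_cst.
by under eq_fun do rewrite exprS; apply: ncontM => //; exact: ncont_id.
Qed.

Lemma ncont_cexp (a : R[i]) : ncont (fun s => cexp (a * s)).
Proof.
move=> s e e0; set K := normc (cexp (a * s)) * (5 * expR 1 * normc a).
have K0 : 0 <= K by rewrite /K !mulr_ge0 ?normc_ge0 ?expR_ge0.
pose d := Num.min (1 / (normc a + 1)) (e / (K + 1)).
have a0 := normc_ge0 a.
exists d; first by rewrite /d !lt_min !divr_gt0//; lra.
move=> t; rewrite le_min => /andP[h1 h2].
have -> : cexp (a * t) - cexp (a * s) = cexp (a * s) * (cexp (a * (t - s)) - 1).
  by rewrite mulrBr mulr1 -cexpD; congr (cexp _ - _); ring.
have := prodM3_le a0 ltr01 h1; have := prodM3_le K0 e0 h2.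
rewrite normcM => h3 h4; apply: le_trans h3; rewrite /K -!mulrA ler_wpM2l ?normc_ge0//.
have h5 : normc (a * (t - s)) <= 1 by rewrite normcM.
by apply: le_trans (cexp_sub1_le h5) _; rewrite normcM -!mulrA.
Qed.

Lemma ncont_polyfun (v : nat -> R) M : ncont (polyfun v M).
Proof.
apply: ncontM; first exact: ncont_cexp.
apply: ncont_sum => i; apply: ncontM; [exact: ncont_cst|exact: ncontX].
Qed.

Lemma truncated_product_polyfun (c : configuration R) (B : R) M (s : R[i]) :
  (size (pts c B) < M)%N ->
  truncated_product c s B = polyfun (lcoef [seq x^-1 | x <- pts c B]) M s.
Proof. by move=> h; rewrite truncated_product_pts /polyfun -lprod_lcoef// size_map. Qed.

Lemma ncont_characteristic_limit (c : configuration R) : summable_points c ->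
  ncont (characteristic_limit c).
Proof.
move=> sc s e e0; have e4 : 0 < e / 4 by rewrite divr_gt0.
have [B0 hB] := truncated_cvg_unif sc (normc s + 1) e4.
set f := characteristic_limit c in hB *.
pose g t := truncated_product c t B0.
have cg : ncont g.
  have -> : g = polyfun (lcoef [seq x^-1 | x <- pts c B0]) (size (pts c B0)).+1.
    by apply/funext => t; exact: truncated_product_polyfun.
  exact: ncont_polyfun.
have [d d0 hd] := cg s _ e4.
exists (Num.min d 1); first by rewrite lt_min d0 ltr01.
move=> t; rewrite le_min => /andP[/hd td t1].
have ts : normc t <= normc s + 1.
  have -> : t = s + (t - s) by ring.
  by rewrite (le_trans (le_normcD _ _))// lerD2l.
have h1 := hB B0 (lexx _) t ts.
have h2 : normc (g s - f s) <= e / 4 by apply: hB => //; lra.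
have -> : f t - f s = - (g t - f t) + (g t - g s) + (g s - f s) by ring.
rewrite (le_trans (le_normcD _ _))//.
have := le_normcD (- (g t - f t)) (g t - g s); rewrite normcN.
rewrite -/(g t) in h1; lra.
Qed.

End NormContinuity.

(** * Locally uniform convergence *)

Section Rho.
Variable R : realType.
Implicit Types (f g h : R[i] -> R[i]).

(* A metric for locally uniform convergence. *)
Definition rho_at f g z : R := Num.min (normc (f z - g z)) (1 + normc z)^-1.
Definition rho f g : R := sup (range (rho_at f g)).

Let w0 (z : R[i]) : 0 < (1 + normc z)^-1.
Proof. by rewrite invr_gt0; have := normc_ge0 z; lra. Qed.

Let w1 (z : R[i]) : (1 + normc z)^-1 <= 1.
Proof. by have := normc_ge0 z => h; rewrite invf_le1; lra. Qed.

Lemma rho_has_sup f g : has_sup (range (rho_at f g)).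
Proof.
split; first by exists (rho_at f g 0), 0.
by exists 1 => _ [z _ <-]; rewrite /rho_at ge_min w1 orbT.
Qed.

Lemma rho_at_le f g z : rho_at f g z <= rho f g.
Proof. by apply: sup_upper_bound; [exact: rho_has_sup|exists z]. Qed.

Lemma rho_le f g e : (forall z, rho_at f g z <= e) -> rho f g <= e.
Proof.
move=> h; apply: ge_sup; first by exists (rho_at f g 0), 0.
by move=> _ [z _ <-].
Qed.

Lemma rho_ge0 f g : 0 <= rho f g.
Proof.
apply: le_trans (rho_at_le f g 0).
by rewrite /rho_at le_min normc_ge0 ltW.
Qed.

Lemma rho_le1 f g : rho f g <= 1.
Proof. by apply: rho_le => z; rewrite /rho_at ge_min w1 orbT. Qed.

Lemma rhoC f g : rho f g = rho g f.
Proof.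
suff e : rho_at f g = rho_at g f by rewrite /rho e.
by apply/funext => z; rewrite /rho_at normc_subC.
Qed.

Lemma rhoxx f : rho f f = 0.
Proof.
apply/eqP; rewrite eq_le rho_ge0 andbT; apply: rho_le => z.
by rewrite /rho_at subrr normc0 ge_min lexx.
Qed.

Let min_triangle (a b c w : R) : 0 <= b -> 0 <= c -> 0 < w -> a <= b + c ->
  Num.min a w <= Num.min b w + Num.min c w.
Proof.
move=> b0 c0 w00 abc; rewrite ge_min.
case: (leP b w) => h1; case: (leP c w) => h2; apply/orP; [left|right|right|right]; lra.
Qed.

Lemma rho_triangle g f h : rho f h <= rho f g + rho g h.
Proof.
apply: rho_le => z; apply: le_trans (lerD (rho_at_le _ _ z) (rho_at_le _ _ z)).
apply: min_triangle; rewrite ?normc_ge0 ?w0//.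
by rewrite -[f z - h z](subrKA (g z)) le_normcD.
Qed.

(** One number serves as accuracy and as inverse radius: outside the disc of radius [e^-1] the
    weight [(1 + |z|)^-1] is already below [e]. *)
Lemma rho_le_unif f g (e : R) : 0 < e ->
  (forall z, normc z <= e^-1 -> normc (f z - g z) <= e) -> rho f g <= e.
Proof.
move=> e0 h; apply: rho_le => z; rewrite /rho_at ge_min.
have [/h ->//|ze] := leP (normc z) e^-1; apply/orP; right.
rewrite -[leRHS]invrK lef_pV2 ?posrE ?invr_gt0//; last by have := normc_ge0 z; lra.
by rewrite ltW// (lt_le_trans ze)// lerDr.
Qed.

Lemma rho_lt_unif f g (e S : R) : rho f g <= e -> e < (1 + S)^-1 -> 0 <= S ->
  forall z, normc z <= S -> normc (f z - g z) <= e.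
Proof.
move=> fe eS S0 z zS; have := le_trans (rho_at_le f g z) fe.
rewrite /rho_at ge_min => /orP[//|ze].
have : e < e; last by rewrite ltxx.
apply: lt_le_trans eS _; apply: le_trans ze.
by rewrite lef_pV2 ?posrE ?lerD2l//; have := normc_ge0 z; lra.
Qed.

Let S := {family compact, R[i]^o -> R[i]^o}.

(** On a compact set the weight is bounded below, so a small [rho] forces the first entry of the
    minimum to be small. Continuity for uniform convergence on compact sets is thus brought to
    [rho]. *)
Lemma rho_cvg_family (u : nat -> S) (f : S) :
  (rho (u n) f @[n --> \oo] --> (0 : R)) -> u @ \oo --> f.
Proof.
move=> uf; apply/fam_cvgP => K cK P /uniform_nbhs [E [entE EP]].
have [b hb] : exists b : R, forall z, K z -> normc z <= b.
  have cn : continuous (@normc R : R[i]^o -> R).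
    move=> z A /nbhs_ballP[e /= e0 hA].
    apply/nbhs_ballP; exists e%:C%C; first by rewrite /= ltcR.
    move=> t; rewrite -ball_normE /= normcEC ltcR => td.
    apply: hA; rewrite -ball_normE /=.
    apply: le_lt_trans td; rewrite ler_norml; apply/andP; split.
      rewrite lerNl opprB lerBlDr normc_subC; have := le_normcD (t - z) z; by rewrite subrK.
    by rewrite lerBlDr; have := le_normcD (z - t) t; rewrite subrK.
  have := @continuous_compact _ _ _ _ (continuous_subspaceT cn) cK.
  move=> /compact_bounded [M [_ hM]]; exists (M + 1) => z Kz.
  have := hM (M + 1); rewrite ltrDl ltr01 => /(_ isT (normc z)) /=.
  by rewrite ger0_norm ?normc_ge0//; apply; exists z.
have [[e e'] /= e0 hE] : exists2 e : R[i], 0 < e & [set xy : R[i]^o * R[i]^o | ball xy.1 e xy.2] `<=` E.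
  move: entE; rewrite -entourage_ballE => -[e e0 h]; by exists e.
move: e0 hE; rewrite ltcE /= => /andP[/eqP -> e0] hE.
pose b' := Num.max b 0.
have b0 : 0 <= b' by rewrite le_max lexx orbT.
pose d := Num.min (e / 2) ((1 + b')^-1 / 2).
have ib : 0 < (1 + b')^-1 by rewrite invr_gt0; lra.
have d0 : 0 < d by rewrite lt_min !divr_gt0.
have : \forall n \near \oo, rho (u n) f <= d.
  move/cvgrPdist_le : uf => /(_ _ d0); apply: filterS => n.
  by rewrite sub0r normrN ger0_norm// rho_ge0.
apply: filterS => n un; apply: EP => z Kz; apply: hE => /=.
rewrite -ball_normE /= normcEC (ltcR _ e) normc_subC.
have -> : normc ((u n : R[i] -> R[i]) z - (f : R[i] -> R[i]) z) < e => //.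
have dlt : d < (1 + b')^-1.
  by rewrite (@le_lt_trans _ _ ((1 + b')^-1 / 2)) ?ge_min ?lexx ?orbT//; lra.
rewrite (le_lt_trans (rho_lt_unif un dlt b0 _))//.
  by rewrite (le_trans (hb z Kz))// le_max lexx.
by rewrite (@le_lt_trans _ _ (e / 2)) ?ge_min ?lexx//; lra.
Qed.

End Rho.

(** * Expectations and measurability *)

Section MeasurableLimits.
Context d (T : measurableType d) (R : realType).

Lemma measurable_fun_real_lim (D : set T) (f_ : nat -> T -> R) (f : T -> R) :
  (forall n, measurable_fun D (f_ n)) ->
  (forall x, D x -> f_ n x @[n --> \oo] --> f x) -> measurable_fun D f.
Proof.
move=> mf ff; apply/measurable_EFinP.
apply: (emeasurable_fun_cvg (fun n x => (f_ n x)%:E)) => [n|x Dx].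
  exact/measurable_EFinP.
by apply: cvg_EFin; [exact: nearW|exact: ff].
Qed.

Lemma measurable_fun_countable (I : countType) (h : T -> I) (g : I -> R) :
  (forall i, measurable (h @^-1` [set i])) -> measurable_fun setT (g \o h).
Proof.
move=> mh _ Y mY; rewrite setTI.
have -> : (g \o h) @^-1` Y = \bigcup_(i : I) (if g i \in Y then h @^-1` [set i] else set0).
  apply/seteqP; split=> [x /= Yx|x [i _]].
    by exists (h x) => //; rewrite mem_set.
  by case: ifPn => // /set_mem gi /= ->.
apply: countable_bigcupT_measurable; first exact: countableP.
by move=> i; case: ifPn.
Qed.

End MeasurableLimits.

Section IntegralComparison.
Context d (T : measurableType d) (R : realType) (mu : {measure set T -> \bar R}).
Local Open Scope ereal_scope.
Import HBNNSimple.

(* No measurability is needed: the integral of a nonnegative function is the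
   supremum of the integrals of the simple functions below it. *)
Lemma ge0_integral_le_off (D N : set T) (f g : T -> \bar R) : measurable N -> mu N = 0 ->
  (forall x, D x -> 0 <= f x) -> (forall x, D x -> 0 <= g x) ->
  (forall x, D x -> ~ N x -> f x <= g x) ->
  \int[mu]_(x in D) f x <= \int[mu]_(x in D) g x.
Proof.
move=> mN N0 f0 g0 fg; rewrite integral_mkcond [leRHS]integral_mkcond.
have pos (h : T -> \bar R) : (forall x, D x -> 0 <= h x) -> forall x, 0 <= (h \_ D) x.
  by move=> h0 x; rewrite /patch; case: ifPn => //; rewrite inE => /h0.
rewrite !ge0_integralTE//; [|exact: pos|exact: pos].
apply: ge_ereal_sup => _ [h /= hf <-].
have mCN : measurable (~` N) by exact: measurableC.
apply: ereal_sup_ge; exists (sintegral mu (proj_nnsfun h mCN)).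
  exists (proj_nnsfun h mCN) => //= x; rewrite mindicE.
  case: (boolP (x \in ~` N)) => [|_]; last by rewrite mulr0; exact: pos.
  rewrite inE => /= Nx; rewrite mulr1; apply: (le_trans (hf x)).
  by rewrite /patch; case: ifPn => //; rewrite inE => Dx; exact: fg.
have e (k : {nnsfun T >-> R}) : sintegral mu k = \int[mu]_x (k x)%:E.
  by rewrite integral_nnsfun// patch_setT.
rewrite !e le_eqVlt; apply/orP; left; apply/eqP.
apply: ge0_ae_eq_integral => //.
- by apply/measurable_EFinP.
- by apply/measurable_EFinP.
- by move=> x _; rewrite lee_fin.
- by move=> x _; rewrite lee_fin.
exists N; split => // x /=; apply: contra_notP => Nx _.
by rewrite mindicE mem_set// mulr1.
Qed.

Lemma integral_le_of_cvg (f_ : nat -> T -> \bar R) (f : T -> \bar R) (N : set T) (b : \bar R) :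
  measurable N -> mu N = 0 -> (forall n, measurable_fun setT (f_ n)) ->
  (forall n x, 0 <= f_ n x) -> (forall x, 0 <= f x) ->
  (forall x, ~ N x -> f_ n x @[n --> \oo] --> f x) ->
  (forall n, \int[mu]_x f_ n x <= b) -> \int[mu]_x f x <= b.
Proof.
move=> mN N0 mf f_0 f0 fcvg fb.
have einf (u : (\bar R)^nat) l : (forall n, l <= u n) -> l <= limn_einf u.
  move=> lu; rewrite limn_einf_lim; apply: lime_ge; first exact: is_cvg_einfs.
  by apply: nearW => n; apply: le_ereal_inf_tmp => _ [k _ <-]; exact: lu.
apply: (@le_trans _ _ (\int[mu]_x limn_einf (f_^~ x))).
  apply: (ge0_integral_le_off mN N0) => [x _|x _|x _ Nx]; first exact: f0.
    by apply: einf => n; exact: f_0.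
  by have [-> _] := cvg_limn_einf_sup (fcvg _ Nx).
apply: (le_trans (fatou _ _ _ _)) => //; rewrite limn_einf_lim.
apply: lime_le; first exact: is_cvg_einfs.
apply: nearW => n; apply: le_trans (fb n); apply: ereal_inf_lbound; exists n => //=.
Qed.

End IntegralComparison.

Section IntegralBounds.
Context d (T : measurableType d) (R : realType) (P : probability T R).

Lemma integral_scale_le (f : T -> R) (k b : R) : measurable_fun setT f -> (forall w, 0 <= f w) ->
  0 <= k -> (\int[P]_w (f w)%:E <= b%:E)%E -> (\int[P]_w (f w * k)%:E <= (b * k)%:E)%E.
Proof.
move=> mf f0 k0 h; under eq_integral do rewrite mulrC EFinM.
rewrite ge0_integralZl//; do ?[exact/measurable_EFinP | by move=> w _; rewrite lee_fin].
by rewrite mulrC EFinM lee_wpmul2l.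
Qed.

Lemma integral_add_le (f g : T -> R) (b b' : R) : measurable_fun setT f -> (forall w, 0 <= f w) ->
  measurable_fun setT g -> (forall w, 0 <= g w) ->
  (\int[P]_w (f w)%:E <= b%:E)%E -> (\int[P]_w (g w)%:E <= b'%:E)%E ->
  (\int[P]_w (f w + g w)%:E <= (b + b')%:E)%E.
Proof.
move=> mf f0 mg g0 h h'; under eq_integral do rewrite EFinD.
rewrite ge0_integralD//; do ?[exact/measurable_EFinP | by move=> w _; rewrite lee_fin].
by rewrite EFinD leeD.
Qed.

End IntegralBounds.

Section Expectation.
Context d (T : measurableType d) (R : realType) (P : probability T R).
Local Open Scope ereal_scope.

Lemma expectation_null (N : set T) (f g : T -> R) : measurable N -> P N = 0 ->
  (forall x, ~ N x -> f x = g x) -> 'E_P[f] = 'E_P[g].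
Proof.
move=> mN N0 fg; rewrite unlock.
have H (u v : T -> \bar R) : (forall x, 0 <= u x) -> (forall x, 0 <= v x) ->
    (forall x, ~ N x -> u x = v x) -> \int[P]_x u x = \int[P]_x v x.
  move=> u0 v0 uv; apply/eqP; rewrite eq_le; apply/andP; split;
    by apply: (ge0_integral_le_off mN N0) => // x _ /uv ->.
rewrite integralE [RHS]integralE; congr (_ - _); apply: H => // x /fg h.
- by rewrite !funeposE h.
- by rewrite !funenegE h.
Qed.

Lemma bounded_integrable (g : T -> R) (M : R) : measurable_fun setT g ->
  (forall x, `|g x| <= M)%R -> P.-integrable setT (EFin \o g).
Proof.
move=> mg gM; apply: measurable_bounded_integrable => //.
  by rewrite (le_lt_trans (probability_le1 _ _)) ?ltry.
exists M; split; first exact: num_real.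
by move=> y My x _ /=; rewrite (le_trans (gM x))// ltW.
Qed.

Lemma bounded_expectation_fin (g : T -> R) (M : R) : measurable_fun setT g ->
  (forall x, `|g x| <= M)%R -> 'E_P[g] = (fine 'E_P[g])%:E.
Proof.
move=> mg gM; rewrite fineK// unlock; apply: integrable_fin_num => //.
exact: bounded_integrable gM.
Qed.

Lemma expectation_diff_le (g1 g2 : T -> R) (M dlt eps : R) (N : set T) :
  measurable_fun setT g1 -> measurable_fun setT g2 ->
  (forall x, `|g1 x| <= M)%R -> (forall x, `|g2 x| <= M)%R ->
  measurable N -> P N <= eps%:E -> (0 <= dlt)%R ->
  (forall x, ~ N x -> `|g1 x - g2 x| <= dlt)%R ->
  (`|fine 'E_P[g1] - fine 'E_P[g2]| <= dlt + 2 * M * eps)%R.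
Proof.
move=> mg1 mg2 g1M g2M mN Ne d0 g12.
(* A point of [T] yields [0 <= M]; an empty [T] would contradict total mass one. *)
have [[w _]|T0] := pselect (exists w : T, True); last first.
  have : P setT = 0.
    by rewrite (_ : setT = set0) ?measure0//; apply/seteqP; split=> // w _; apply: T0; exists w.
  by rewrite probability_setT => /eqP; rewrite onee_eq0.
have M0 : (0 <= M)%R by exact: le_trans (g1M w).
have i1 := bounded_integrable mg1 g1M; have i2 := bounded_integrable mg2 g2M.
rewrite -lee_fin -abse_EFin EFinB -(bounded_expectation_fin mg1 g1M).
rewrite -(bounded_expectation_fin mg2 g2M) unlock -integralB//.
apply: le_trans (le_abse_integral _ _ _) _ => //.
  by apply: emeasurable_funB; apply/measurable_EFinP.
apply: (@le_trans _ _ (\int[P]_x ((dlt%:E) + (2 * M)%:E * (\1_N x)%:E))).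
  apply: ge0_le_integral => //.
  - by apply: measurableT_comp => //; apply: emeasurable_funB; apply/measurable_EFinP.
  - apply: emeasurable_funD => //; apply: emeasurable_funM => //.
    by apply/measurable_EFinP.
  move=> x _; rewrite -EFinB abse_EFin -EFinM -EFinD lee_fin indicE.
  case: (boolP (x \in N)) => [_|]; last first.
    by rewrite notin_setE => /g12; rewrite mulr0 addr0.
  rewrite mulr1 (le_trans (ler_normB _ _))//; have := g1M x; have := g2M x; lra.
rewrite ge0_integralD//; last 2 first.
- by move=> x _; rewrite -EFinM lee_fin !mulr_ge0.
- by apply: emeasurable_funM => //; apply/measurable_EFinP.
rewrite (_ : \int[P]_x dlt%:E = dlt%:E); last first.
  transitivity (dlt%:E * P setT); last by rewrite probability_setT mule1.
  exact: integral_cst.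
rewrite ge0_integralZl//; last 2 first.
- by apply/measurable_EFinP.
- by rewrite lee_fin mulr_ge0.
rewrite integral_indic// setIT EFinD leeD2l// [leRHS]EFinM lee_wpmul2l// lee_fin mulr_ge0//.
Qed.

Lemma expectation_bounded_cvg (g_ : nat -> T -> R) (g : T -> R) (M : R) :
  (forall n, measurable_fun setT (g_ n)) -> measurable_fun setT g ->
  (forall n x, `|g_ n x| <= M)%R ->
  (forall x, g_ n x @[n --> \oo] --> g x) ->
  fine 'E_P[g_ n] @[n --> \oo] --> fine 'E_P[g].
Proof.
move=> mg_ mg gM gg.
have gMx x : (`|g x| <= M)%R.
  apply: (@closed_cvg _ _ \oo _ (fun n => g_ n x) [set y | `|y| <= M]%R) => //.
  - rewrite (_ : [set y | _] = (fun y => `|y|)%R @^-1` [set y | y <= M]%R)//.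
    by apply: preimage_closed; (exact: closed_le || exact: norm_continuous || (move=> *; exact: norm_continuous)).
  - by apply: nearW => n; exact: gM.
have h0 x : setT x -> (g_ n x)%:E @[n --> \oo] --> (g x)%:E.
  by move=> _; apply: cvg_EFin; [exact: nearW|exact: gg].
have hM : P.-integrable setT (fun=> M%:E) by exact: finite_measure_integrable_cst.
have hg x : forall n, setT x -> `|(g_ n x)%:E| <= M%:E by move=> n _; rewrite abse_EFin lee_fin.
have [_ _ h] := @dominated_convergence _ _ _ P setT measurableT
  (fun n x => (g_ n x)%:E) (EFin \o g) (fun=> M%:E)
  (fun n => (measurable_EFinP _ _).2 (mg_ n)) ((measurable_EFinP _ _).2 mg)
  (aeW _ h0) hM (aeW _ hg).
apply: fine_cvg; rewrite -(bounded_expectation_fin mg gMx) unlock.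
exact: h.
Qed.

Lemma bounded_expectation_le (g1 g2 : T -> R) (M : R) :
  measurable_fun setT g1 -> measurable_fun setT g2 ->
  (forall x, `|g1 x| <= M)%R -> (forall x, `|g2 x| <= M)%R ->
  (forall x, g1 x <= g2 x)%R -> (fine 'E_P[g1] <= fine 'E_P[g2])%R.
Proof.
move=> mg1 mg2 g1M g2M g12; rewrite -lee_fin -(bounded_expectation_fin mg1 g1M).
rewrite -(bounded_expectation_fin mg2 g2M) unlock; apply: le_integral => //.
- exact: bounded_integrable g1M.
- exact: bounded_integrable g2M.
- by move=> x _; rewrite lee_fin.
Qed.

Lemma bounded_expectationN (g : T -> R) (M : R) : measurable_fun setT g ->
  (forall x, `|g x| <= M)%R -> fine 'E_P[(fun x => - g x)%R] = (- fine 'E_P[g])%R.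
Proof.
move=> mg gM; have ig := bounded_integrable mg gM.
rewrite unlock -fineN; congr fine.
rewrite -mulN1e -EFinN -(integralZl measurableT ig).
by apply: eq_integral => x _; rewrite /= -EFinM mulN1r.
Qed.

Lemma markov_le (f : T -> \bar R) (a : R) (b : R) : measurable_fun setT f ->
  (forall x, 0 <= f x) -> (0 < a)%R -> \int[P]_x f x <= b%:E ->
  P [set x | a%:E <= f x] <= (b / a)%:E.
Proof.
move=> mf f0 a0 fb; have := @le_integral_abse _ _ _ P setT measurableT f a mf a0.
rewrite setTI; under eq_set do rewrite gee0_abs//.
under eq_integral do rewrite gee0_abs//.
move=> /le_trans /(_ fb); rewrite muleC EFinM lee_pdivlMr//.
Qed.

End Expectation.

Lemma cvg_sum_seq (R : realType) (T : Type) (F : set_system T) (FF : Filter F)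
    (I : Type) (l : seq I) (f : I -> T -> R) (a : I -> R) :
  (forall i, f i t @[t --> F] --> a i) ->
  \sum_(i <- l) f i t @[t --> F] --> \sum_(i <- l) a i.
Proof.
move=> fa; elim: l => [|i l IH].
  by under eq_fun do rewrite big_nil; rewrite big_nil; exact: cvg_cst.
by under eq_fun do rewrite big_cons; rewrite big_cons; exact: cvgD.
Qed.

Section PolyfunRho.
Variable R : realType.

Lemma lcoefS (l : seq R) m : lcoef l m.+1 =
  - m.+1%:R^-1 * \sum_(i < m.+1) lcoef l (m - i) * \sum_(a <- l) a ^+ i.+1.
Proof.
by rewrite mulNr -mulrN -newton_identity mulKf// pnatr_eq0.
Qed.

Lemma polyfun_rho M (e : R) : 0 < e -> exists2 dlt : R, 0 < dlt &
  forall v w : nat -> R, (forall i, (i < M)%N -> `|v i - w i| <= dlt) ->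
  rho (polyfun v M) (polyfun w M) <= e.
Proof.
move=> e0; have S0 : 0 < e^-1 by rewrite invr_gt0.
set S := e^-1 in S0; set K := expR (pi * S) * \sum_(i < M) S ^+ i.
have K0 : 0 <= K.
  by rewrite mulr_ge0 ?expR_ge0// sumr_ge0// => i _; rewrite exprn_ge0// ltW.
exists (e / (K + 1)); first by rewrite divr_gt0//; lra.
move=> v w vw; apply: rho_le_unif => // z zS.
rewrite /polyfun -mulrBr -sumrB normcM.
have h : normc (\sum_(i < M) ((v i)%:C%C * z ^+ i - (w i)%:C%C * z ^+ i)) <=
    (\sum_(i < M) S ^+ i) * (e / (K + 1)).
  rewrite mulr_suml; elim/big_ind2: _ => [|x1 x2 y1 y2 h1 h2|i _].
  - by rewrite normc0.
  - by rewrite (le_trans (le_normcD _ _))// lerD.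
  rewrite -mulrBl -real_complexB normcM normc_real mulrC ler_pM ?normc_ge0 ?vw//.
  elim: (i : nat) => [|n IH]; first by rewrite !expr0 normc1.
  by rewrite !exprS normcM ler_pM ?normc_ge0.
have := ler_pM (normc_ge0 _) (normc_ge0 _) (normc_cexp_ipi zS) h.
by move=> /le_trans; apply; rewrite mulrA -/K; apply: prodM3_le.
Qed.

End PolyfunRho.

Definition lipschitz_rho (R : realType) (L : R) (G : (R[i] -> R[i]) -> R) :=
  forall f g, `|G f - G g| <= L * rho f g.

(** The continuous functions [x / (x ^ 2 + 1 / n.+1)] converge to [x^-1] everywhere, including at
    zero, where [0^-1 = 0]. *)
Lemma measurable_inv (R : realType) : measurable_fun setT (fun x : R => x^-1).
Proof.
pose f n (x : R) := x / (x ^+ 2 + n.+1%:R^-1).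
have cX : continuous (fun x : R => x ^+ 2) by exact: exprn_continuous.
apply: (@measurable_fun_real_lim _ _ _ _ f) => [n|x _].
  apply: continuous_measurable_fun => x; apply: cvgM; first exact: cvg_id.
  apply: cvgV; last by apply: cvgD; [exact: cX|exact: cvg_cst].
  by rewrite gt_eqF// ltr_wpDl ?sqr_ge0// invr_gt0.
rewrite /f; have [->|x0] := eqVneq x 0.
  by rewrite invr0; under eq_fun do rewrite mul0r; exact: cvg_cst.
have -> : x^-1 = x / (x ^+ 2 + 0) by field.
apply: cvgM; first exact: cvg_cst.
apply: cvgV; first by rewrite addr0 expf_neq0.
by apply: cvgD; [exact: cvg_cst|exact: cvg_harmonic].
Qed.

(** * Measurability of statistics and of Lipschitz functionals *)

Section MeasurableStatistics.
Context d (T : measurableType d) (R : realType) (X : point_process T R).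
Import HBNNSimple.

Lemma measurable_count_pts (B : R) (A : set R) : measurable A ->
  measurable_fun setT (fun w => \sum_(x <- pts (X w) B | x \in A) (1 : R)).
Proof.
move=> mA; pose A' := A `&` [set x | - B <= x <= B].
have A'B x : A' x -> `|x| <= B by move=> [_]; rewrite ler_norml.
have -> : (fun w => \sum_(x <- pts (X w) B | x \in A) (1 : R)) =
    (fun w => count_in (X w) A').
  apply/funext => w; rewrite (count_in_pts _ A'B) big_seq_cond [RHS]big_seq_cond.
  apply: eq_bigl => x; rewrite mem_pts; case: (boolP (`|x| <= B)) => //= xB.
  congr (_ && _); apply/idP/idP; rewrite !inE; last by case.
  by move=> Ax; split=> //=; rewrite -ler_norml.
apply: measurable_count.
  apply: measurableI => //; rewrite (_ : [set x | _] = [set` `[- B, B]])//.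
exists B; split; first exact: num_real.
by move=> y By x /A'B /= /le_trans; apply; exact: ltW.
Qed.

Let measurable_sum_nnsfun (B : R) (h : {nnsfun R >-> R}) :
  measurable_fun setT (fun w => \sum_(x <- pts (X w) B) h x).
Proof.
pose S := fset_set (range h).
have -> : (fun w => \sum_(x <- pts (X w) B) h x) =
  (fun w => \sum_(y <- S) y * \sum_(x <- pts (X w) B | x \in h @^-1` [set y]) 1).
  apply/funext => w; under eq_bigr do rewrite fimfunE fsbig_finite//=.
  rewrite exchange_big /=; apply: eq_bigr => y _.
  rewrite -mulr_sumr [in RHS]big_mkcond; congr (_ * _); apply: eq_bigr => x _.
  by rewrite indicE; case: (_ \in _).
apply: measurable_sum => y; apply: measurable_funM => //.
by apply: measurable_count_pts; apply: measurable_funPTI; exact: measurable_set1.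
Qed.

(** Simple functions reduce to counts in their level sets; as the sum over a window is finite,
    pointwise limits pass through it, and a general [h] is split into positive and negative
    parts. *)
Lemma measurable_sum_pts (B : R) (h : R -> R) : measurable_fun setT h ->
  measurable_fun setT (fun w => \sum_(x <- pts (X w) B) h x).
Proof.
move=> mh.
have pos (k : R -> R) : measurable_fun setT k -> (forall x, 0 <= k x) ->
    measurable_fun setT (fun w => \sum_(x <- pts (X w) B) k x).
  move=> mk k0; have mk' : measurable_fun setT (EFin \o k) by exact/measurable_EFinP.
  pose u := nnsfun_approx measurableT mk'.
  apply: (@measurable_fun_real_lim _ _ _ _ (fun n w => \sum_(x <- pts (X w) B) u n x)).
    by move=> n; exact: measurable_sum_nnsfun.
  move=> w _; apply: cvg_sum_seq => x.
  have := @cvg_nnsfun_approx _ _ _ _ measurableT _ mk' (fun y _ => k0 y) x I.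
  by move/fine_cvg.
have -> : (fun w => \sum_(x <- pts (X w) B) h x) =
  (fun w => \sum_(x <- pts (X w) B) Num.max (h x) 0) \- (fun w => \sum_(x <- pts (X w) B) Num.max (- h x) 0).
  apply/funext => w /=; rewrite -sumrB; apply: eq_bigr => x _.
  case: (leP (h x) 0) => hx; [rewrite max_l|rewrite max_r]; lra.
apply: measurable_funB; apply: pos => //.
- by apply: measurable_maxr => //; exact: measurable_cst.
- by move=> x; rewrite le_max lexx orbT.
- by apply: measurable_maxr => //; exact: measurableT_comp.
- by move=> x; rewrite le_max lexx orbT.
Qed.

Lemma measurable_lcoef (B : R) (g : R -> R) m : measurable_fun setT g ->
  measurable_fun setT (fun w => lcoef [seq g x | x <- pts (X w) B] m).
Proof.
move=> mg; have [n] := ubnP m; elim: n m => // n IH [|m] mn.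
  by under eq_fun do rewrite lcoef0; exact: measurable_cst.
under eq_fun do rewrite lcoefS; apply: measurable_funM => //.
apply: measurable_sum => i; apply: measurable_funM.
  by apply: IH; rewrite (leq_ltn_trans (leq_subr _ _)).
under eq_fun do rewrite big_map.
by apply: measurable_sum_pts; exact: measurable_funX.
Qed.

End MeasurableStatistics.

Section MeasurableLipschitz.
Context d (T : measurableType d) (R : realType).
Variables (L : R) (G : (R[i] -> R[i]) -> R).
Hypothesis lipG : lipschitz_rho L G.

Lemma lipschitz_rho_cvg (u : nat -> R[i] -> R[i]) f :
  (forall e : R, 0 < e -> exists N, forall n, (N <= n)%N -> rho (u n) f <= e) ->
  G (u n) @[n --> \oo] --> G f.
Proof.
move=> uf; apply/cvgrPdist_le => e e0.
have L0 : 0 <= `|L| by [].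
have e' : 0 < e / (`|L| + 1) by rewrite divr_gt0//; lra.
have [N hN] := uf _ e'; exists N => // n /= Nn.
rewrite distrC (le_trans (lipG _ _))//.
rewrite (@le_trans _ _ (`|L| * rho (u n) f))//.
  by rewrite ler_wpM2r ?rho_ge0// ler_norm.
by apply: prodM3_le => //; exact: hN.
Qed.

(** The space of functions carries no sigma-algebra here. Rounding the coefficients down to
    multiples of [1 / r.+1] leaves countably many polynomials, hence a measurable function, and the
    Lipschitz bound lets the mesh go to zero. *)
Lemma measurable_lipschitz_polyfun (v : T -> nat -> R) M :
  (forall i, measurable_fun setT (v ^~ i)) ->
  measurable_fun setT (fun w => G (polyfun (v w) M)).
Proof.
move=> mv.
pose q (r : nat) w : M.-tuple int := [tuple Num.floor (r.+1%:R * v w i) | i < M].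
pose V (r : nat) (t : M.-tuple int) (i : nat) : R := (nth 0 t i)%:~R / r.+1%:R.
apply: (@measurable_fun_real_lim _ _ _ _ (fun r w => G (polyfun (V r (q r w)) M))).
  move=> r; apply: (@measurable_fun_countable _ _ _ _ (q r) (fun t => G (polyfun (V r t) M))).
  move=> t; rewrite (_ : _ @^-1` _ = \big[setI/setT]_(i < M)
     ((fun w => r.+1%:R * v w i) @^-1` [set` `[(tnth t i)%:~R, (tnth t i + 1)%:~R[])).
    apply: bigsetI_measurable => i _; rewrite -[X in measurable X]setTI.
    by apply: measurable_funM => //; exact: measurable_cst.
  apply/seteqP; split => w /=.
    move=> <-; rewrite -bigcap_seq => i _ /=; rewrite in_itv/= tnth_mktuple.
    exact: floor_itv.
  rewrite -bigcap_seq => h; apply: eq_from_tnth => i; rewrite tnth_mktuple.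
  by apply: floor_def; have := h i; rewrite /= in_itv/=; apply; rewrite mem_index_enum.
move=> w _; apply: lipschitz_rho_cvg => e e0.
have [dlt d0 hd] := polyfun_rho M e0.
exists (Num.truncn dlt^-1).+1 => r Nr; apply: hd => i iM.
rewrite /V.
have -> : (q r w)`_i = Num.floor (r.+1%:R * v w i).
  by rewrite -(tnth_nth 0 (q r w) (Ordinal iM)) tnth_mktuple.
have r0 : 0 < r.+1%:R :> R by rewrite ltr0n.
have /andP[h1 h2] := floor_itv (r.+1%:R * v w i).
rewrite intrD in h2.
set fl := (Num.floor _)%:~R in h1 h2 *.
have -> : fl / r.+1%:R - v w i = - ((r.+1%:R * v w i - fl) / r.+1%:R).
  by field; rewrite gt_eqF.
rewrite normrN ger0_norm; last by rewrite divr_ge0 ?subr_ge0// ltW.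
rewrite (@le_trans _ _ (1 / r.+1%:R))//.
  by rewrite ler_pM2r ?invr_gt0//; lra.
rewrite ler_pdivrMr// mulrC -ler_pdivrMr// mul1r.
apply: ltW; apply: (lt_le_trans (truncnS_gt _)); rewrite ler_nat.
by rewrite (leq_trans Nr).
Qed.

Lemma measurable_lipschitz_truncated (X : point_process T R) (B : R) :
  measurable_fun setT (fun w => G (fun s => truncated_product (X w) s B)).
Proof.
(* The number of points depends on [w], so no single [M] covers them all; for each [w] the sequence
   in [M] is eventually constant. *)
apply: (@measurable_fun_real_lim _ _ _ _ (fun M w =>
  G (polyfun (lcoef [seq x^-1 | x <- pts (X w) B]) M))).
  move=> M; apply: measurable_lipschitz_polyfun => i.
  by apply: measurable_lcoef; exact: measurable_inv.
move=> w _; apply: lipschitz_rho_cvg => e e0.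
exists (size (pts (X w) B)).+1 => M hM; apply: rho_le_unif => // z _.
by rewrite (@truncated_product_polyfun _ _ _ M)// subrr normc0 ltW.
Qed.

Lemma lipschitz_characteristic_limit_cvg (c : configuration R) : summable_points c ->
  G (fun s => truncated_product c s n%:R) @[n --> \oo] --> G (characteristic_limit c).
Proof.
move=> sc; apply: lipschitz_rho_cvg => e e0.
have [B0 hB] := truncated_cvg_unif sc e^-1 e0.
exists (Num.truncn B0).+1 => n Nn; apply: rho_le_unif => // z zS; apply: hB => //.
by apply: ltW; apply: (lt_le_trans (truncnS_gt _)); rewrite ler_nat.
Qed.

End MeasurableLipschitz.

(** * Continuity of the approximants for the vague topology *)

Section VagueContinuity.
Variable R : realType.

Lemma continuous_linear_statistics (f : test_function R) :
  continuous (fun c : configuration R => linear_statistics c f).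
Proof.
have h1 : continuous (@linear_statistics R) by exact: initial_continuous.
have h2 : continuous (fun u : {ptws test_function R -> R} => u f).
  move=> u; have /cvg_sup/(_ f) h : (u : {ptws test_function R -> R}) -->
      (u : {ptws test_function R -> R}) by exact: cvg_id.
  apply: cvg_trans; last first.
    apply: (@initial_continuous _ _ (@proj _ (fun=> R) f) u).
  by apply: cvg_app; exact: h.
by move=> c; apply: (@continuous_comp _ _ _ _ (fun u : {ptws test_function R -> R} => u f)); [exact: h1|exact: h2].
Qed.

Lemma continuous_sum_pts (k : nat) (g : R -> R) : continuous g ->
  (forall x, k%:R < `|x| -> g x = 0) ->
  continuous (fun c : configuration R => \sum_(x <- pts c k%:R) g x).
Proof.
move=> cg g0; have Pg : continuous g /\ exists B : R, forall x, B < `|x| -> g x = 0.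
  by split => //; exists k%:R.
have -> : (fun c : configuration R => \sum_(x <- pts c k%:R) g x) =
    (fun c => linear_statistics c (exist _ g Pg)).
  by apply/funext => c; rewrite (linear_statistics_pts c (B := k%:R)).
exact: continuous_linear_statistics.
Qed.

(** The window [k.+1] contains the support of [inv_cut k], so the power sums over it are linear
    statistics of continuous functions; the recursion [lcoefS] does the rest. *)
Lemma continuous_lcoef_cut (k m : nat) : (0 < k)%N ->
  continuous (fun c : configuration R => lcoef [seq inv_cut k x | x <- pts c k.+1%:R] m).
Proof.
move=> k0; have [n] := ubnP m; elim: n m => // n IH [|m] mn.
  under eq_fun do rewrite lcoef0; move=> c; have FF := nbhs_filter c.
  exact: cvg_cst.
under eq_fun do rewrite lcoefS; move=> c; have FF := nbhs_filter c.
apply: cvgM; first exact: cvg_cst.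
apply: cvg_sum_seq => i; apply: cvgM.
  by apply: IH; rewrite (leq_ltn_trans (leq_subr _ _)).
under eq_fun do rewrite big_map; rewrite big_map.
apply: (@continuous_sum_pts _ (fun x => inv_cut k x ^+ i.+1)).
  move=> x; apply: (@continuous_comp _ _ _ (inv_cut k) (fun y : R => y ^+ i.+1)).
    exact: continuous_cut.
  exact: exprn_continuous.
by move=> x /ltW kx; rewrite cut_eq0// expr0n.
Qed.

Lemma continuous_lipschitz_polyfun (L : R) (G : (R[i] -> R[i]) -> R) k M : (0 < k)%N ->
  lipschitz_rho L G -> continuous (fun c : configuration R =>
    G (polyfun (lcoef [seq inv_cut k x | x <- pts c k.+1%:R]) M)).
Proof.
move=> k0 lipG c; have FF := nbhs_filter c; apply/(@cvgrPdist_le _ _ _ _ FF) => e e0.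
have L0 : 0 <= `|L| by [].
have e' : 0 < e / (`|L| + 1) by rewrite divr_gt0//; lra.
have [dlt d0 hd] := polyfun_rho M e'.
have h (i : 'I_M) : \forall c' \near c, `|lcoef [seq inv_cut k x | x <- pts c k.+1%:R] i -
    lcoef [seq inv_cut k x | x <- pts c' k.+1%:R] i| <= dlt.
  by have := @continuous_lcoef_cut k i k0 c; move/(@cvgrPdist_le _ _ _ _ FF); exact.
have hh := @filter_forall _ _ (fun (i : 'I_M) (c' : configuration R) =>
    `|lcoef [seq inv_cut k x | x <- pts c k.+1%:R] i -
      lcoef [seq inv_cut k x | x <- pts c' k.+1%:R] i| <= dlt) _ FF h.
apply: (filterS _ hh) => c' hc'; rewrite (le_trans (lipG _ _))//.
rewrite (@le_trans _ _ (`|L| * rho (polyfun (lcoef [seq inv_cut k x | x <- pts c k.+1%:R]) M)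
   (polyfun (lcoef [seq inv_cut k x | x <- pts c' k.+1%:R]) M)))//.
  by rewrite ler_wpM2r ?rho_ge0// ler_norm.
apply: prodM3_le => //; apply: hd => i iM; exact: (hc' (Ordinal iM)).
Qed.

End VagueContinuity.

(** * Reduction to Lipschitz functionals *)

Section Envelope.
Variable R : realType.
Let S := {family compact, R[i]^o -> R[i]^o}.
Let A : set S := [set f : S | continuous (f : R[i]^o -> R[i]^o)].
Variables (F : S -> R) (M : R).
Hypothesis FM : forall f, A f -> `|F f| <= M.

(* The largest [m]-Lipschitz minorant of [F] on [A]. *)
Definition lip_envelope (m : R) (f : R[i] -> R[i]) : R :=
  inf [set F g + m * rho f g | g in A].

Let A0 : A (fun=> 0).
Proof. exact: (ncont_continuous (@ncont_cst R 0)). Qed.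

Let lb (m : R) f : 0 <= m -> lbound [set F g + m * rho f g | g in A] (- M).
Proof.
move=> m0 _ [g Ag <-]; have := FM Ag; rewrite ler_norml => /andP[h _].
by rewrite -[leLHS]addr0 lerD// mulr_ge0 ?rho_ge0.
Qed.

Let has_inf_env (m : R) f : 0 <= m -> has_inf [set F g + m * rho f g | g in A].
Proof.
move=> m0; split; first by exists (F (fun=> 0) + m * rho f (fun=> 0)); exists (fun=> 0).
by exists (- M); exact: lb.
Qed.

Lemma lip_envelope_ge (m : R) f : 0 <= m -> - M <= lip_envelope m f.
Proof. by move=> m0; apply: lb_le_inf; [exact: (has_inf_env f m0).1|exact: lb]. Qed.

Lemma lip_envelope_le_at (m : R) f g : 0 <= m -> A g ->
  lip_envelope m f <= F g + m * rho f g.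
Proof.
move=> m0 Ag; apply: ge_inf; first exact: (has_inf_env f m0).2.
by exists g.
Qed.

Lemma lip_envelope_le (m : R) f : 0 <= m -> A f -> lip_envelope m f <= F f.
Proof.
by move=> m0 Af; have := lip_envelope_le_at f m0 Af; rewrite rhoxx mulr0 addr0.
Qed.

Lemma lip_envelope_bound (m : R) f : 0 <= m -> `|lip_envelope m f| <= M + m.
Proof.
move=> m0; rewrite ler_norml; apply/andP; split.
  by have := lip_envelope_ge f m0; lra.
apply: (le_trans (lip_envelope_le_at f m0 A0)).
have := FM A0; rewrite ler_norml => /andP[_ h]; rewrite lerD//.
by rewrite -[leRHS]mulr1 ler_wpM2l ?rho_le1.
Qed.

Lemma lip_envelope_lipschitz (m : R) : 0 <= m -> lipschitz_rho m (lip_envelope m).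
Proof.
move=> m0.
have H f g : lip_envelope m f - m * rho f g <= lip_envelope m g.
  apply: lb_le_inf; first exact: (has_inf_env g m0).1.
  move=> _ [h Ah <-]; have := lip_envelope_le_at f m0 Ah.
  by have := ler_wpM2l m0 (rho_triangle g f h); rewrite mulrDr; lra.
move=> f g; rewrite ler_norml; have := H f g; have := H g f; rewrite (rhoC g f).
by move=> h1 h2; apply/andP; split; lra.
Qed.

(** A failure would give a sequence in [A] tending to [f] for [rho], hence uniformly on compact
    sets, with [F] staying away from [F f]. *)
Lemma within_rho_continuous : {within A, continuous F} -> forall f, A f ->
  forall e : R, 0 < e -> exists2 dlt : R, 0 < dlt &
    forall g, A g -> rho g f <= dlt -> `|F f - F g| <= e.
Proof.
move=> /subspace_continuousP cF f Af e e0; apply: contrapT => Hn.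
have H (n : nat) : exists g : S, [/\ A g, rho g f <= n.+1%:R^-1 & ~ (`|F f - F g| <= e)].
  apply: contrapT => Hg; apply: Hn; exists n.+1%:R^-1; first by rewrite invr_gt0.
  move=> g Ag gf; apply: contrapT => h; apply: Hg; by exists g.
have [g Hgs] := choice H.
have gf : g @ \oo --> (f : S).
  apply: rho_cvg_family; apply/cvgrPdist_le => e' e'0.
  have /cvgrPdist_le /(_ _ e'0) := @cvg_harmonic R.
  apply: filterS => n; rewrite !sub0r !normrN /= => h.
  have [_ h1 _] := Hgs n; rewrite ger0_norm ?rho_ge0//.
  by apply: (le_trans h1); apply: le_trans h; exact: ler_norm.
have := cF f Af; move/cvgrPdist_le => /(_ _ e0) h.
have := gf _ h; move=> [N _ hN].
have [Ag _ ng] := Hgs N; apply: ng; exact: (hN N (leqnn N) Ag).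
Qed.

Lemma lip_envelope_cvg : {within A, continuous F} -> forall f, A f ->
  lip_envelope n%:R f @[n --> \oo] --> F f.
Proof.
move=> cF f Af; apply/cvgrPdist_le => e e0.
have [dlt d0 hd] := within_rho_continuous cF Af e0.
(* Beyond [2 M / dlt], a competitor farther than [dlt] from [f] pays a penalty of at least [2 M],
   the largest possible oscillation of [F] on [A]; nearer competitors are handled by continuity. *)
exists (Num.truncn (2 * M / dlt)).+1 => // n /= Nn.
have n0 : 0 <= n%:R :> R by rewrite ler0n.
rewrite ger0_norm; last by rewrite subr_ge0 lip_envelope_le.
rewrite lerBlDr addrC -lerBlDr; apply: lb_le_inf; first exact: (has_inf_env f n0).1.
move=> _ [g Ag <-].
have [gd|gd] := leP (rho g f) dlt.
  have := hd g Ag gd; rewrite ler_norml => /andP[_ h].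
  have : 0 <= n%:R * rho f g by rewrite mulr_ge0 ?rho_ge0.
  lra.
have := FM Ag; have := FM Af; rewrite !ler_norml => /andP[_ h1] /andP[h2 _].
have : 2 * M <= n%:R * rho f g.
  rewrite rhoC (@le_trans _ _ (n%:R * dlt))//; last by rewrite ler_wpM2l// ltW.
  rewrite -ler_pdivrMr//; apply: ltW; apply: (lt_le_trans (truncnS_gt _)).
  by rewrite ler_nat.
lra.
Qed.

End Envelope.

Section Portmanteau.
Variable R : realType.
Let S := {family compact, R[i]^o -> R[i]^o}.
Let A : set S := [set f : S | continuous (f : R[i]^o -> R[i]^o)].

(* [X] is almost surely continuous, and its images by Lipschitz functionals are
   almost surely measurable. *)
Definition lipschitz_measurable d (T : measurableType d) (P : probability T R)
    (X : T -> S) := exists N : set T, [/\ measurable N, P N = 0%E,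
  forall w, ~ N w -> A (X w) & forall (L : R) (G : (R[i] -> R[i]) -> R), lipschitz_rho L G ->
    exists2 h : T -> R, measurable_fun setT h & forall w, ~ N w -> h w = G (X w)].

Let indicC d (T : measurableType d) (N : set T) : measurable N ->
  measurable_fun setT (\1_(~` N) : T -> R).
Proof. by move=> mN; apply: measurable_indic; exact: measurableC. Qed.

(** Measurability of [F (X w)] has to come from the envelopes, whose compositions with [X] are
    measurable up to a null set. Multiplying by the indicator of its complement gives versions that
    are measurable and bounded everywhere, ready for dominated convergence. *)
Lemma lipschitz_measurable_envelope d (T : measurableType d) (P : probability T R)
    (X : T -> S) (F : S -> R) (M : R) :
  (forall f, A f -> `|F f| <= M) -> {within A, continuous F} ->
  lipschitz_measurable P X ->
  exists (hF : T -> R) (hm : nat -> T -> R),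
   [/\ measurable_fun setT hF /\ (forall m, measurable_fun setT (hm m)),
       (forall w, `|hF w| <= M) /\ (forall m w, `|hm m w| <= M),
       forall m w, hm m w <= hF w,
       forall w, hm m w @[m --> \oo] --> hF w &
       (exists N : set T, [/\ measurable N, P N = 0%E & forall w, ~ N w -> hF w = F (X w)]) /\
       forall m, 'E_P[lip_envelope F m%:R \o X]%E = 'E_P[hm m]%E].
Proof.
move=> FM cF [N [mN N0 NA hN]].
have M0 : 0 <= M.
  have A0 : A (fun=> 0) by exact: (ncont_continuous (@ncont_cst R 0)).
  exact: le_trans (FM _ A0).
have Nat0 (m : nat) : 0 <= m%:R :> R by rewrite ler0n.
have /choice[h Hh] : forall m : nat, exists h : T -> R, measurable_fun setT h /\
    forall w, ~ N w -> h w = lip_envelope F m%:R (X w).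
  move=> m; have [h mh e] := hN _ _ (lip_envelope_lipschitz FM (Nat0 m)).
  by exists h.
pose hm m w := h m w * \1_(~` N) w.
pose hF w := F (X w) * \1_(~` N) w.
have hmN m w : N w -> hm m w = 0.
  by move=> Nw; rewrite /hm indicE memNset ?mulr0.
have hFN w : N w -> hF w = 0.
  by move=> Nw; rewrite /hF indicE memNset ?mulr0.
have hmE m w : ~ N w -> hm m w = lip_envelope F m%:R (X w).
  by move=> Nw; rewrite /hm indicE mem_set// mulr1 (Hh m).2.
have hFE w : ~ N w -> hF w = F (X w).
  by move=> Nw; rewrite /hF indicE mem_set// mulr1.
have mhm m : measurable_fun setT (hm m).
  by apply: measurable_funM; [exact: (Hh m).1|exact: indicC].
have cvgm w : hm m w @[m --> \oo] --> hF w.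
  have [Nw|Nw] := pselect (N w).
    by rewrite hFN//; under eq_fun do rewrite hmN//; exact: cvg_cst.
  rewrite hFE//; under eq_fun do rewrite hmE//.
  exact: (lip_envelope_cvg FM cF (NA _ Nw)).
exists hF, hm; split => //.
- split=> //; apply: (@measurable_fun_real_lim _ _ _ _ hm) => // w _; exact: cvgm.
- split => [w|m w].
    by have [Nw|Nw] := pselect (N w); [rewrite hFN// normr0|rewrite hFE// FM//; exact: NA].
  have [Nw|Nw] := pselect (N w); [by rewrite hmN// normr0|rewrite hmE//].
  have := lip_envelope_le FM (Nat0 m) (NA _ Nw); have := lip_envelope_ge FM (X w) (Nat0 m).
  have := FM _ (NA _ Nw); rewrite !ler_norml => /andP[_ h1] h2 h3; apply/andP; split; lra.
- move=> m w; have [Nw|Nw] := pselect (N w); first by rewrite hmN// hFN.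
  by rewrite hmE// hFE//; exact: (lip_envelope_le FM (Nat0 m) (NA _ Nw)).
- split => [|m]; first by exists N.
  by apply: (expectation_null mN N0) => w Nw /=; rewrite hmE.
Qed.

Theorem portmanteau (d : nat -> measure_display) (T : forall n, measurableType (d n))
    (P : forall n, probability (T n) R) (X : forall n, T n -> S)
    (d' : measure_display) (T' : measurableType d') (P' : probability T' R)
    (Y : T' -> S) :
  (forall n, lipschitz_measurable (P n) (X n)) -> lipschitz_measurable P' Y ->
  (forall (L C : R) (G : (R[i] -> R[i]) -> R), lipschitz_rho L G ->
     (forall f, `|G f| <= C) ->
     fine 'E_(P n)[G \o X n]%E @[n --> \oo] --> fine 'E_P'[G \o Y]%E) ->
  forall F : S -> R, {within A, continuous F} ->
    (exists M : R, forall f, A f -> `|F f| <= M) ->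
    'E_(P n)[F \o X n]%E @[n --> \oo] --> 'E_P'[F \o Y]%E.
Proof.
move=> mX mY lipcvg F cF [M FM].
have Eeq d1 (T1 : measurableType d1) (P1 : probability T1 R) (Z : T1 -> S) (K : S -> R) hF :
    (exists N : set T1, [/\ measurable N, P1 N = 0%E & forall w, ~ N w -> hF w = K (Z w)]) ->
    'E_P1[K \o Z]%E = 'E_P1[hF]%E.
  by move=> [N [mN N0 h]]; apply: (expectation_null mN N0) => w /h.
(* Minorants give only a lower bound: pass from [K] to an envelope under [Y], move to [X n] by the
   hypothesis on Lipschitz functionals, and climb back to [K]. The upper bound for [F] is this lower
   bound for [- F]. *)
have lower (K : S -> R) : {within A, continuous K} -> (forall f, A f -> `|K f| <= M) ->
    forall e : R, 0 < e -> \forall n \near \oo,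
      fine 'E_P'[K \o Y]%E - e <= fine 'E_(P n)[K \o X n]%E.
  move=> cK KM e e0; have e2 : 0 < e / 2 by rewrite divr_gt0.
  have [hF [hm [[mF mm] [bF bm] le_m cm [/Eeq EF Em]]]] := lipschitz_measurable_envelope KM cK mY.
  have := @expectation_bounded_cvg _ _ _ P' _ _ _ mm mF bm cm.
  move/cvgrPdist_le => /(_ _ e2) [m _ hm1]; have {}hm1 := hm1 m (leqnn m).
  have m0 : 0 <= m%:R :> R by rewrite ler0n.
  have := lipcvg _ _ _ (lip_envelope_lipschitz KM m0) (fun f => lip_envelope_bound KM f m0).
  move/cvgrPdist_le => /(_ _ e2); apply: filterS => n.
  have [kF [km [[nF nm] [cF' cm'] le_k _ [/Eeq EFn Emn]]]] := lipschitz_measurable_envelope KM cK (mX n).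
  rewrite EF EFn Em Emn => h.
  have := @bounded_expectation_le _ _ _ (P n) _ _ _ (nm m) nF (cm' m) cF' (le_k m).
  move: hm1 h; rewrite /= !ler_norml => /andP[_ h1] /andP[_ h2] h3; lra.
have NF : {within A, continuous (fun f : S => - F f)}.
  by move=> f; apply: cvgN; exact: cF.
have NFM f : A f -> `|- F f| <= M by move=> Af; rewrite normrN FM.
have fin d1 (T1 : measurableType d1) (P1 : probability T1 R) (Z : T1 -> S) :
    lipschitz_measurable P1 Z -> 'E_P1[F \o Z]%E = (fine 'E_P1[F \o Z]%E)%:E.
  move=> mZ; have [k [_ [[mk _] [bk _] _ _ [/Eeq Ek _]]]] := lipschitz_measurable_envelope FM cF mZ.
  by rewrite Ek; exact: bounded_expectation_fin bk.
have opp d1 (T1 : measurableType d1) (P1 : probability T1 R) (Z : T1 -> S) :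
    lipschitz_measurable P1 Z ->
    fine 'E_P1[(fun f : S => (- F f)%R) \o Z]%E = - fine 'E_P1[F \o Z]%E.
  move=> mZ; have [k [_ [[mk _] [bk _] _ _ [Nk _]]]] := lipschitz_measurable_envelope FM cF mZ.
  rewrite (Eeq _ _ _ _ _ _ Nk) -(bounded_expectationN P1 mk bk).
  congr fine; apply: Eeq; case: Nk => N [mN N0 h]; exists N; split => // w /h ->//.
rewrite (fin _ _ _ _ mY); under eq_fun do rewrite (fin _ _ _ _ (mX _)).
apply: cvg_EFin; first exact: nearW.
apply/cvgrPdist_le => e e0.
have l1 := lower F cF FM e e0; have l2 := lower _ NF NFM e e0.
near=> n; rewrite ler_norml /=.
have h1 : fine 'E_P'[F \o Y]%E - e <= fine 'E_(P n)[F \o X n]%E by near: n.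
have h2 : fine 'E_P'[(fun f : S => (- F f)%R) \o Y]%E - e <= fine 'E_(P n)[(fun f : S => (- F f)%R) \o X n]%E.
  by near: n.
rewrite !opp// in h2; apply/andP; split; lra.
Unshelve. all: by end_near. Qed.

End Portmanteau.

(** * Moment bounds on the tails *)

Section PowerSums.
Variable R : realType.

(** The series of [j ^ (- 1 - a)] is bounded by a telescoping one. With [h = 1 / j] and [u = a h],
    one has [ln (1 + h) >= h / 2], so [(1 + h) ^ (- a) <= 1 / (1 + u / 2) <= 1 - u / 3] as [u <= 1];
    this is the source of the factor 3. *)
Lemma powR_telescope (a : R) (j : nat) : 0 < a -> a <= 1 -> (0 < j)%N ->
  j%:R `^ (- a) / j%:R <= 3 / a * (j%:R `^ (- a) - j.+1%:R `^ (- a)).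
Proof.
move=> a0 a1 j0; have j0' : 0 < j%:R :> R by rewrite ltr0n.
have j1 : 1 <= j%:R :> R by rewrite ler1n.
pose h : R := j%:R^-1.
have h0 : 0 < h by rewrite invr_gt0.
have h1 : h <= 1 by rewrite invf_le1.
have -> : j.+1%:R = j%:R * (1 + h) :> R by rewrite mulrDr mulr1 divff ?natr1// gt_eqF.
have h10 : 0 < 1 + h by lra.
rewrite powRM ?(ltW j0') ?(ltW h10)//.
have p0 : 0 < j%:R `^ (- a) by rewrite powR_gt0.
have l1 : h / 2 <= ln (1 + h).
  have := @le_ln1Dx R (- (h / (1 + h))).
  have -> : 1 + - (h / (1 + h)) = (1 + h)^-1 by field; rewrite gt_eqF.
  have hh : h / (1 + h) < 1 by rewrite ltr_pdivrMr//; lra.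
  rewrite ltrN2 hh lnV ?posrE// => /(_ isT); rewrite lerN2.
  apply: le_trans; rewrite ler_pdivlMr// mulrAC ler_pdivrMr//.
  by rewrite -[h * 2]/(h * (1 + 1)) ler_wpM2l ?(ltW h0)//; lra.
pose t := a * ln (1 + h).
have t0 : a * h / 2 <= t by rewrite -mulrA /t ler_wpM2l ?(ltW a0).
have e1 : (1 + h) `^ (- a) <= (1 + t)^-1.
  rewrite /powR gt_eqF// mulNr expRN -/t lef_pV2 ?posrE ?expR_gt0 ?expR_ge1Dx//.
  have : 0 < a * h by rewrite mulr_gt0.
  lra.
have ah : a * h <= 1 by rewrite -[leRHS]mulr1 ler_pM ?(ltW a0) ?(ltW h0).
have ah0 : 0 < a * h by rewrite mulr_gt0.
have e2 : a * h / 3 <= 1 - (1 + h) `^ (- a).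
  have e3 : (1 + t)^-1 <= (1 + a * h / 2)^-1 by rewrite lef_pV2 ?posrE; lra.
  have e4 : (1 + a * h / 2)^-1 <= 1 - a * h / 3.
    rewrite -[leLHS]mul1r ler_pdivrMr; last by lra.
    nra.
  lra.
rewrite -/h -{2}[j%:R `^ (- a)]mulr1 -mulrBr.
have -> : 3 / a * (j%:R `^ (- a) * (1 - (1 + h) `^ (- a))) =
  j%:R `^ (- a) * (3 / a * (1 - (1 + h) `^ (- a))) by ring.
rewrite ler_wpM2l ?(ltW p0)//.
rewrite [leLHS](_ : h = 3 / a * (a * h / 3)); last by field; rewrite gt_eqF.
by rewrite ler_wpM2l// divr_ge0 ?(ltW a0).
Qed.

Lemma powR_inv_le (a : R) (j : nat) : a <= 1 -> (0 < j)%N -> j%:R^-1 <= j%:R `^ (- a) :> R.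
Proof.
move=> a1 j0; have j1 : 1 <= j%:R :> R by rewrite ler1n.
by rewrite -powR_inv1// ler_powR//; lra.
Qed.

Lemma powR_opp_small (a e : R) : 0 < a -> 0 < e ->
  exists K, forall k, (K <= k)%N -> k%:R `^ (- a) <= e.
Proof.
move=> a0 e0; pose b := e `^ (- a^-1).
have b0 : 0 < b by rewrite powR_gt0.
exists (Num.truncn b).+1 => k kK.
have bk : b <= k%:R.
  by apply: ltW; apply: (lt_le_trans (truncnS_gt _)); rewrite ler_nat.
have k0 : 0 < k%:R :> R by exact: lt_le_trans bk.
have eb : e = b `^ (- a).
  by rewrite /b -powRrM mulNr mulrN opprK mulVf ?gt_eqF// powRr1// ltW.
rewrite eb !powRN lef_pV2 ?posrE ?powR_gt0//.
by apply: ge0_ler_powR; rewrite ?nnegrE ?(ltW a0) ?(ltW b0) ?(ltW k0).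
Qed.

End PowerSums.

Lemma bounded_set_interval (R : realType) b1 b2 (x y : R) :
  bounded_set [set` Interval (BSide b1 x) (BSide b2 y)].
Proof.
exists (`|x| + `|y|); split; first exact: num_real.
move=> z hz t /=; rewrite itv_boundlr => /andP[h1 h2]; apply: ltW; apply: le_lt_trans hz.
have {}h1 : x <= t by move: h1; case: b1; rewrite ?bnd_simp// => /ltW.
have {}h2 : t <= y by move: h2; case: b2; rewrite ?bnd_simp// => /ltW.
rewrite ler_norml; have := ler_norm y; have := ler_norm (- x); rewrite normrN.
by move=> *; have := normr_ge0 x; have := normr_ge0 y => *; apply/andP; split; lra.
Qed.

Section Controlled.
Context d (T : measurableType d) (R : realType) (P : probability T R)
  (X : point_process T R).

(* The mean bounds that make the principal value sums tight. *)
Definition controlled (C a : R) :=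
  (forall j, (\int[P]_w (annulus (X w) j)%:E <= C%:E)%E) /\
  (forall j, (0 < j)%N ->
     (\int[P]_w (`|imbalance (X w) j|)%:E <= (C * j%:R `^ (1 - a))%:E)%E).

Lemma measurable_count_itv b1 b2 (x y : R) :
  measurable_fun setT (fun w => count_in (X w) [set` Interval (BSide b1 x) (BSide b2 y)]).
Proof.
by apply: measurable_count; [exact: measurable_itv|exact: bounded_set_interval].
Qed.

Lemma measurable_annulus j : measurable_fun setT (fun w => annulus (X w) j).
Proof. by apply: measurable_funD; exact: measurable_count_itv. Qed.

Lemma measurable_imbalance j : measurable_fun setT (fun w => imbalance (X w) j).
Proof. by apply: measurable_funB; exact: measurable_count_itv. Qed.

Lemma measurable_norm_imbalance j : measurable_fun setT (fun w => `|imbalance (X w) j|).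
Proof. by apply: measurableT_comp => //; exact: measurable_imbalance. Qed.

Lemma measurable_tail_term j : measurable_fun setT (fun w => tail_term (X w) j).
Proof.
apply: measurable_funD; apply: measurable_funM => //.
- exact: measurable_norm_imbalance.
- exact: measurable_annulus.
Qed.

Lemma measurable_tail_sum k :
  measurable_fun setT (fun w => (\sum_(0 <= i <oo) (tail_term (X w) (i + k))%:E)%E).
Proof.
apply: (@ge0_emeasurable_sum _ _ _ _ (fun i w => (tail_term (X w) (i + k))%:E) xpredT).
  by move=> i w _ _; rewrite lee_fin tail_term_ge0.
by move=> i _; apply/measurable_EFinP; exact: measurable_tail_term.
Qed.

Lemma measurable_tail_control k : measurable_fun setT (fun w => tail_control (X w) k).
Proof.
apply: emeasurable_funD.
  apply/measurable_EFinP; apply: measurable_funM => //; apply: measurable_funD.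
  - exact: measurable_norm_imbalance.
  - exact: measurable_annulus.
exact: measurable_tail_sum.
Qed.

Lemma tail_control_ge0 (c : configuration R) k : (0 <= tail_control c k)%E.
Proof.
rewrite adde_ge0//; first by rewrite lee_fin divr_ge0// addr_ge0// annulus_ge0.
by apply: nneseries_ge0 => i _ _; rewrite lee_fin tail_term_ge0.
Qed.

Variables (C a : R).
Hypotheses (C0 : 0 <= C) (a0 : 0 < a) (a1 : a <= 1) (ctrl : controlled C a).

Let pow_split (j : nat) : (0 < j)%N -> j%:R `^ (1 - a) = j%:R * j%:R `^ (- a) :> R.
Proof. 
by move=> j0; rewrite powRD ?powRr1//; apply/implyP => _; rewrite pnatr_eq0 -lt0n. Qed.

Lemma integral_tail_term j : (0 < j)%N ->
  (\int[P]_w (tail_term (X w) j)%:E <= (2 * C * (j%:R `^ (- a) / j%:R))%:E)%E.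
Proof.
move=> j0; have j0' : 0 < j%:R :> R by rewrite ltr0n.
have jS : 0 < j.+1%:R :> R by rewrite ltr0n.
have h := integral_add_le (P := P) (b := C * (j%:R `^ (- a) / j%:R)) (b' := C * (j%:R `^ (- a) / j%:R))
  (f := fun w => `|imbalance (X w) j.+1| / (j%:R * j.+1%:R))
  (g := fun w => annulus (X w) j / j%:R ^+ 2).
have -> : 2 * C * (j%:R `^ (- a) / j%:R) = C * (j%:R `^ (- a) / j%:R) + C * (j%:R `^ (- a) / j%:R) by ring.
apply: h.
- by apply: measurable_funM => //; exact: measurable_norm_imbalance.
- by move=> w; rewrite divr_ge0// mulr_ge0 ?ltW.
- by apply: measurable_funM => //; exact: measurable_annulus.
- by move=> w; rewrite divr_ge0 ?annulus_ge0 ?sqr_ge0.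
- have := integral_scale_le (measurable_norm_imbalance j.+1) (fun w => normr_ge0 _)
    (_ : 0 <= (j%:R * j.+1%:R)^-1) (ctrl.2 _ (ltn0Sn j)).
  rewrite invr_ge0 mulr_ge0 ?(ltW j0') ?(ltW jS)// => /(_ isT) /le_trans; apply.
  rewrite lee_fin pow_split// -mulrA ler_wpM2l//.
  have -> : j.+1%:R * j.+1%:R `^ (- a) / (j%:R * j.+1%:R) = j.+1%:R `^ (- a) / j%:R.
    by field; rewrite !gt_eqF.
  rewrite ler_wpM2r ?invr_ge0 ?(ltW j0')// !powRN lef_pV2 ?posrE ?powR_gt0//.
  by apply: ge0_ler_powR; rewrite ?nnegrE ?ltW// ltr_nat.
- have := integral_scale_le (measurable_annulus j) (fun w => annulus_ge0 _ _)
    (_ : 0 <= (j%:R ^+ 2)^-1) (ctrl.1 j).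
  rewrite invr_ge0 sqr_ge0 => /(_ isT) /le_trans; apply.
  rewrite lee_fin ler_wpM2l// expr2 invfM ler_wpM2r ?invr_ge0 ?(ltW j0')//.
  exact: powR_inv_le.
Qed.

(** The boundary terms give [2 C], and the series gives [2 C] times the factor [3 / a] of
    [powR_telescope]. The decay depends on the process only through [C] and [a]. *)
Lemma integral_tail_control k : (0 < k)%N ->
  (\int[P]_w tail_control (X w) k <= ((2 * C + 6 * C / a) * k%:R `^ (- a))%:E)%E.
Proof.
move=> k0; have k0' : 0 < k%:R :> R by rewrite ltr0n.
rewrite ge0_integralD//; first last.
- exact: measurable_tail_sum.
- by move=> w _; apply: nneseries_ge0 => i _ _; rewrite lee_fin tail_term_ge0.
- apply/measurable_EFinP; apply: measurable_funM => //; apply: measurable_funD.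
  + exact: measurable_norm_imbalance.
  + exact: measurable_annulus.
- by move=> w _; rewrite lee_fin divr_ge0// addr_ge0// annulus_ge0.
rewrite mulrDl EFinD leeD//.
  have h := integral_add_le (measurable_norm_imbalance k) (fun w => normr_ge0 _)
    (measurable_annulus k) (fun w => annulus_ge0 _ _) (ctrl.2 _ k0) (ctrl.1 k).
  have := integral_scale_le (measurable_funD (measurable_norm_imbalance k) (measurable_annulus k))
    (fun w => addr_ge0 (normr_ge0 _) (annulus_ge0 _ _)) (_ : 0 <= k%:R^-1) h.
  rewrite invr_ge0 (ltW k0') => /(_ isT) /le_trans; apply.
  rewrite lee_fin pow_split// mulrDl.
  have -> : C * (k%:R * k%:R `^ (- a)) / k%:R = C * k%:R `^ (- a) by field; rewrite gt_eqF.
  have -> : 2 * C * k%:R `^ (- a) = C * k%:R `^ (- a) + C * k%:R `^ (- a) by ring.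
  by rewrite lerD2l ler_wpM2l// powR_inv_le.
rewrite integral_nneseries//; first last.
- by move=> i w _; rewrite lee_fin tail_term_ge0.
- by move=> i; apply/measurable_EFinP; exact: measurable_tail_term.
apply: lime_le.
  by apply: is_cvg_nneseries => i _ _; apply: integral_ge0 => w _; rewrite lee_fin tail_term_ge0.
apply: nearW => m.
apply: (@le_trans _ _ (\sum_(0 <= i < m) (6 * C / a * ((i + k)%:R `^ (- a) - (i + k).+1%:R `^ (- a)))%:E)%E).
  apply: lee_sum => i _; have ik : (0 < i + k)%N by rewrite addn_gt0 k0 orbT.
  apply: (le_trans (integral_tail_term ik)); rewrite lee_fin.
  have -> : 6 * C / a * ((i + k)%:R `^ (- a) - (i + k).+1%:R `^ (- a)) =
    2 * C * (3 / a * ((i + k)%:R `^ (- a) - (i + k).+1%:R `^ (- a))) by ring.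
  by rewrite ler_wpM2l ?mulr_ge0// powR_telescope.
rewrite sumEFin lee_fin -mulr_sumr ler_wpM2l//; first by rewrite divr_ge0 ?mulr_ge0 ?(ltW a0).
have -> : \sum_(0 <= i < m) ((i + k)%:R `^ (- a) - (i + k).+1%:R `^ (- a)) =
   k%:R `^ (- a) - (m + k)%:R `^ (- a) :> R.
  elim: m => [|m IH]; first by rewrite big_geq// add0n subrr.
  by rewrite big_nat_recr//= IH addSn; ring.
by rewrite lerBlDr lerDl powR_ge0.
Qed.

(** Smallness is obtained for arbitrarily large [J] only. The event that the imbalance stays above
    [J / p.+1] for all [J > J0] is contained in each single such event, and their probabilities tend
    to zero by Markov's inequality. *)
Lemma ae_small_imbalance : {ae P, forall w, forall e : R, 0 < e -> forall J0,
  exists2 J, (J0 <= J)%N & `|imbalance (X w) J| <= e * J%:R}.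
Proof.
have H (p J0 : nat) : {ae P, forall w, exists2 J, (J0 <= J)%N &
    `|imbalance (X w) J| <= p.+1%:R^-1 * J%:R}.
  have p0 : 0 < p.+1%:R^-1 :> R by rewrite invr_gt0.
  pose E J := [set w | (p.+1%:R^-1)%:E <= (`|imbalance (X w) J| * J%:R^-1)%:E]%E.
  have mE J : measurable (E J).
    rewrite -[E J]setTI; apply: emeasurable_fun_c_infty => //.
    apply/measurable_EFinP; apply: measurable_funM => //; exact: measurable_norm_imbalance.
  exists (\bigcap_(J in [set J | (J0 < J)%N]) E J); split.
  - by apply: bigcap_measurable => //; exists J0.+1 => /=.
  - apply/eqP; rewrite eq_le measure_ge0 andbT; apply/lee_addgt0Pr => e e0.
    rewrite add0e.
    have e' : 0 < e * p.+1%:R^-1 / (C + 1) by apply: divr_gt0 (mulr_gt0 e0 p0) _; rewrite ltr_wpDl.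
    have [K hK] := powR_opp_small a0 e'.
    pose J := maxn J0.+1 K.
    have JJ : (J0 < J)%N by rewrite leq_maxl.
    have Jp : (0 < J)%N by rewrite (leq_trans _ JJ).
    have Jp' : 0 < J%:R :> R by rewrite ltr0n.
    apply: (@le_trans _ _ (P (E J))).
      apply: le_measure; rewrite ?inE//; first by apply: bigcap_measurable => //; exists J0.+1 => /=.
      by move=> w; apply.
    have h := integral_scale_le (measurable_norm_imbalance J) (fun w => normr_ge0 _)
      (_ : 0 <= J%:R^-1) (ctrl.2 _ Jp).
    have {}h := h (_ : is_true _); rewrite invr_ge0 (ltW Jp') in h; have {}h := h isT.
    apply: (le_trans (markov_le _ _ p0 h)).
    + apply/measurable_EFinP; apply: measurable_funM => //; exact: measurable_norm_imbalance.
    + by move=> w; rewrite lee_fin divr_ge0.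
    rewrite lee_fin pow_split// ler_pdivrMr//.
    have -> : C * (J%:R * J%:R `^ (- a)) / J%:R = C * J%:R `^ (- a) by field; rewrite gt_eqF.
    by apply: prodM3_le => //; rewrite ?mulr_gt0//; apply: hK; rewrite leq_maxr.
  - move=> w /= Hw J /= J0J; rewrite /E /= lee_fin; apply: contrapT => /negP.
    rewrite -ltNge => h; apply: Hw; exists J; first exact: ltnW.
    have J0' : 0 < J%:R :> R by rewrite ltr0n (leq_ltn_trans _ J0J).
    by move: h; rewrite ltr_pdivrMr// => /ltW.
have := ae_foralln (fun p => ae_foralln (H p)); apply: filterS => w hw e e0 J0.
have [J JJ hJ] := hw (Num.truncn e^-1) J0; exists J => //.
rewrite (le_trans hJ)// ler_wpM2r// -[leRHS]invrK lef_pV2 ?posrE ?invr_gt0//.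
exact: ltW (truncnS_gt _).
Qed.

Lemma ae_tail_control_fin : {ae P, forall w, (tail_control (X w) 1 < +oo)%E}.
Proof.
have h : P.-integrable setT (fun w => tail_control (X w) 1).
  apply/integrableP; split; first exact: measurable_tail_control.
  under eq_integral do rewrite gee0_abs ?tail_control_ge0//.
  exact: le_lt_trans (integral_tail_control (ltn0Sn 0)) (ltry _).
have := integrable_ae measurableT h; apply: filterS => w /(_ I).
by rewrite ge0_fin_numE// tail_control_ge0.
Qed.

End Controlled.

Section SummableFromTail.
Variable R : realType.
Implicit Types (c : configuration R).

(** The annuli start at [0 < |x|], so a point at the origin would be missed. *)
Lemma size_pts_annulus c K : c 0 = 0%N ->
  (size (pts c K%:R))%:R = \sum_(0 <= j < K) annulus c j.
Proof.
move=> c0; elim: K => [|K IH].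
  rewrite big_geq//; case E : (pts c 0%:R) => [//|x l].
  have : x \in pts c 0%:R by rewrite E inE eqxx.
  by rewrite mem_pts normr_le0 => /andP[/eqP ->]; rewrite c0 eqxx.
rewrite big_nat_recr//= -IH !size_pts_sum.
have KS : K%:R <= K.+1%:R :> R by rewrite ler_nat.
rewrite (bigID (fun x => `|x| <= K%:R)) /= -(sum_pts_filter c _ KS); congr (_ + _).
rewrite (@annulus_pts R c K K.+1%:R)// /shell big_mkcond big_seq [RHS]big_seq.
apply: eq_bigr => x; rewrite mem_pts -ltNge => /andP[xK _]; rewrite xK andbT.
by case: (_ < _).
Qed.

Lemma tail_control_summable c : (tail_control c 1 < +oo)%E ->
  exists Q : R, forall B, \sum_(x <- pts c B) x^-1 ^+ 2 <= Q.
Proof.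
move=> V1; have Vf : tail_control c 1 \is a fin_num.
  by rewrite ge0_fin_numE// tail_control_ge0.
pose v := fine (tail_control c 1).
have Vv : (tail_control c 1 <= v%:E)%E by rewrite fineK.
exists (\sum_(x <- pts c 1) x^-1 ^+ 2 + v) => B.
pose J := (Num.truncn B).+2.
have BJ : B <= J%:R by apply: ltW; apply: (lt_trans (truncnS_gt _)); rewrite ltr_nat.
have J1 : (1 : R) <= J%:R by rewrite ler1n.
apply: (@le_trans _ _ (\sum_(x <- pts c J%:R) x^-1 ^+ 2)).
  rewrite (sum_pts_filter c _ BJ) [leRHS](bigID (fun x => `|x| <= B)) /= lerDl.
  by apply: sumr_ge0 => x _; rewrite sqr_ge0.
rewrite (bigID (fun x => `|x| <= 1)) /= -(sum_pts_filter c _ J1) lerD2l.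
have h := sum_sqr_shell_le (pts c J%:R) (ltn0Sn 0) (ltn0Sn _ : (1 <= J)%N).
apply: (le_trans _ (le_trans h _)).
  rewrite big_seq_cond [leRHS]big_seq_cond le_eqVlt; apply/orP; left; apply/eqP.
  apply: eq_bigl => x; rewrite mem_pts -ltNge.
  by case: (boolP (`|x| <= J%:R)) => //= _; rewrite andbT.
have := tail_control_partial J Vv; rewrite mulrDl; apply: le_trans.
rewrite -[leLHS]add0r lerD//.
  by rewrite addr_ge0 ?divr_ge0 ?annulus_ge0.
rewrite !big_nat ler_sum// => j /andP[_ jJ].
rewrite (@tail_term_pts R c j J%:R) ?ler_nat// /varterm lerDr.
by rewrite divr_ge0// mulr_ge0.
Qed.

End SummableFromTail.

Section LipschitzMeasurable.
Context d (T : measurableType d) (R : realType) (P : probability T R)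
  (X : point_process T R).

(** Off the null set, [G] of the limit is the pointwise limit of [G] of the truncated products at
    integer cutoffs, which are measurable. *)
Lemma lipschitz_measurable_characteristic : {ae P, forall w, summable_points (X w)} ->
  lipschitz_measurable P (fun w => characteristic_limit (X w)).
Proof.
move=> [N [mN N0 sub]]; exists N.
have sN w : ~ N w -> summable_points (X w) by move=> Nw; apply: contrapT => h; apply: Nw; exact: sub.
split => //.
  by move=> w /sN sw; apply: ncont_continuous; exact: ncont_characteristic_limit.
move=> L G lipG; exists (fun w => G (characteristic_limit (X w)) * \1_(~` N) w); last first.
  by move=> w Nw; rewrite indicE mem_set// mulr1.
apply: (@measurable_fun_real_lim _ _ _ _ (fun n w =>
  G (fun s => truncated_product (X w) s n%:R) * \1_(~` N) w)).
  move=> n; apply: measurable_funM; first exact: (measurable_lipschitz_truncated lipG).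
  by apply: measurable_indic; exact: measurableC.
move=> w _; have [Nw|Nw] := pselect (N w).
  rewrite indicE memNset ?mulr0//=.
  by under eq_fun do rewrite mulr0; exact: cvg_cst.
apply: cvgM; last exact: cvg_cst.
exact: (lipschitz_characteristic_limit_cvg lipG (sN _ Nw)).
Qed.

Lemma lipschitz_measurable_version (Z : T -> {family compact, R[i]^o -> R[i]^o})
    (L C : R) (G : (R[i] -> R[i]) -> R) :
  lipschitz_measurable P Z -> lipschitz_rho L G -> 0 <= C -> (forall f, `|G f| <= C) ->
  exists (N : set T) (h : T -> R), [/\ measurable N, P N = 0%E, measurable_fun setT h,
    (forall w, `|h w| <= C) /\ (forall w, ~ N w -> h w = G (Z w)) &
    'E_P[G \o Z]%E = 'E_P[h]%E].
Proof.
move=> [N [mN N0 _ hN]] lipG C0 GC; have [h mh hE] := hN _ _ lipG.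
have hE' w : ~ N w -> h w * \1_(~` N) w = G (Z w).
  by move=> Nw; rewrite indicE mem_set// mulr1 hE.
exists N, (fun w => h w * \1_(~` N) w); split => //.
- by apply: measurable_funM => //; apply: measurable_indic; exact: measurableC.
- split => // w; have [Nw|Nw] := pselect (N w).
    by rewrite indicE memNset ?mulr0 ?normr0//=; apply.
  by rewrite hE'.
- by apply: (expectation_null mN N0) => w Nw /=; rewrite hE'.
Qed.

End LipschitzMeasurable.

Section GoodEvent.
Variable R : realType.

Definition gap_count (c : configuration R) (k0 : nat) : R :=
  \sum_(x <- pts c 1 | x \in [set x : R | `|x| <= k0%:R^-1]) 1.

Lemma gap_count_eq0 (c : configuration R) k0 : (0 < k0)%N -> gap_count c k0 < 1 ->
  forall x, `|x| <= k0%:R^-1 -> c x = 0%N.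
Proof.
move=> k00 g1 x xk; apply/eqP/negPn/negP => cx.
have k1 : k0%:R^-1 <= 1 :> R by rewrite invf_le1 ?ler1n ?ltr0n.
have xp : x \in pts c 1 by rewrite mem_pts cx (le_trans xk k1).
move: g1; rewrite /gap_count (perm_big _ (perm_to_rem xp)) /= big_cons mem_set//.
by rewrite ltNge lerDl; apply/negP; rewrite negbK; apply: sumr_ge0.
Qed.

(** [k] and [M] are found before the process is given, which makes the approximation uniform in [n]
    and valid for the limit process too. The exceptional set is a null set together with five events
    of probability at most [e]: a point too close to zero, too many points within [k0],
    [tail_control] too large at [k0] or at [k], too many points within [k.+1]. *)
Lemma good_event (C a e : R) k0 : 0 <= C -> 0 < a -> a <= 1 -> 0 < e -> (0 < k0)%N ->
  exists k M, (0 < k)%N /\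
  forall d (T : measurableType d) (P : probability T R) (X : point_process T R),
    controlled P X C a ->
    {ae P, forall w, X w 0 = 0%N /\ summable_points (X w)} ->
    (P [set w | 1%:E <= (gap_count (X w) k0)%:E]%E <= e%:E)%E ->
    exists N, [/\ measurable N, (P N <= (5 * e)%:E)%E & forall w, ~ N w ->
      rho (characteristic_limit (X w))
          (polyfun (lcoef [seq inv_cut k x | x <- pts (X w) k.+1%:R]) M) <= e].
Proof.
move=> C0 a0 a1 e0 k00.
have k00' : 0 < k0%:R :> R by rewrite ltr0n.
pose C' := 2 * C + 6 * C / a.
have C'0 : 0 <= C' by rewrite addr_ge0 ?divr_ge0 ?mulr_ge0// ltW.
pose S := Num.max 1 e^-1.
have S1 : 1 <= S by rewrite le_max lexx.
have Se : e^-1 <= S by rewrite le_max lexx orbT.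
have pk0 : 0 <= k0%:R `^ (- a) by exact: powR_ge0.
(* By Markov's inequality, the number of points within [k0] and [tail_control] at [k0] each reach
   this level with probability at most [e]. *)
pose L := (C' * k0%:R `^ (- a) + C * k0%:R) / e + 1.
have L1 : C' * k0%:R `^ (- a) <= e * L.
  have -> : e * L = (C' * k0%:R `^ (- a) + C * k0%:R) + e by rewrite /L; field; rewrite gt_eqF.
  by rewrite -addrA lerDl addr_ge0 ?(ltW e0)// mulr_ge0 ?(ltW k00').
have L2 : C * k0%:R <= e * L.
  have -> : e * L = (C' * k0%:R `^ (- a) + C * k0%:R) + e by rewrite /L; field; rewrite gt_eqF.
  by rewrite (addrC (_ * _)) -addrA lerDl addr_ge0 ?(ltW e0)// mulr_ge0.
have L0 : 0 < L.
  by rewrite ltr_wpDl// divr_ge0 ?(ltW e0)// addr_ge0// mulr_ge0// ltW.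
pose C9 := 9 * expR 1 * (2 * S + S ^+ 2).
pose K := expR (pi * S + (S * (k0%:R * L + (L + 1)) + S ^+ 2 * (k0%:R ^+ 2 * L + L))) *
    (18 * expR 1 ^+ 2 * (2 * S + S ^+ 2)).
have S20 : 0 <= 2 * S + S ^+ 2 by rewrite addr_ge0 ?sqr_ge0//; lra.
have C90 : 0 <= C9 by rewrite !mulr_ge0 ?expR_ge0.
have K0 : 0 <= K by rewrite !mulr_ge0 ?expR_ge0.
(* [C9] comes from the smallness hypothesis of [char_approx] and [K + 1] from its final error. [K]
   does not involve [k], so [k] may now be taken large depending on [eta]. *)
pose eta := Num.min 1 (Num.min (1 / (C9 + 1)) (e / (K + 1 + 1))).
have eta0 : 0 < eta by rewrite !lt_min ltr01 !divr_gt0//; lra.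
have eta1 : eta <= 1 by rewrite ge_min lexx.
have eta9 : C9 * eta <= 1 by apply: prodM3_le => //; rewrite !ge_min lexx ?orbT.
have K10 : 0 <= K + 1 by lra.
have etaK : (K + 1) * eta <= e by apply: prodM3_le => //; rewrite !ge_min lexx ?orbT.
have ee : 0 < e * eta / (C' + 1) by rewrite divr_gt0 ?mulr_gt0//; lra.
have [k1 hk1] := powR_opp_small a0 ee.
pose k := maxn k0 (maxn (Num.truncn S).+1 k1).
have k0k : (k0 <= k)%N by rewrite leq_maxl.
have kS : S <= k%:R.
  apply: ltW; apply: (lt_le_trans (truncnS_gt _)); rewrite ler_nat.
  by rewrite leq_max leq_max leqnn orbT.
have kk1 : (k1 <= k)%N by rewrite !leq_max leqnn !orbT.
have kp : (0 < k)%N by exact: leq_trans k0k.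
have Lk : C' * k%:R `^ (- a) <= e * eta.
  by apply: prodM3_le => //; rewrite ?mulr_gt0//; exact: hk1.
pose M := (Num.truncn (C * k.+1%:R / e)).+1.
have M0 : 0 < M%:R :> R by rewrite ltr0n.
have LM : C * k.+1%:R <= e * M%:R.
  by rewrite [e * _]mulrC -ler_pdivrMr// ltW// truncnS_gt.
exists k, M; split => // d T P X ctrl good gapX.
have [N1 [mN1 N10 sub1]] := filterI good (ae_small_imbalance C0 a0 ctrl).
pose A K w := \sum_(0 <= j < K) annulus (X w) j.
have mA K1 : measurable_fun setT (A K1).
  by apply: measurable_sum => j; exact: measurable_annulus.
have A0 K1 w : 0 <= A K1 w by apply: sumr_ge0 => j _; exact: annulus_ge0.
have EA K1 : (\int[P]_w (A K1 w)%:E <= (C * K1%:R)%:E)%E.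
  under eq_integral do rewrite /A -sumEFin.
  rewrite ge0_integral_sum//; first last.
  - by move=> j w _; rewrite lee_fin annulus_ge0.
  - by move=> j; apply/measurable_EFinP; exact: measurable_annulus.
  apply: (@le_trans _ _ (\sum_(0 <= j < K1) C%:E)%E).
    by apply: lee_sum => j _; exact: ctrl.1.
  by rewrite sumEFin lee_fin big_const_nat iter_addr_0 subn0 mulr_natr.
have mset (f : T -> \bar R) (r : R) : measurable_fun setT f -> measurable [set w | r%:E <= f w]%E.
  move=> mf; rewrite -[X in measurable X]setTI.
  exact: emeasurable_fun_c_infty.
have EA0 K1 w : (0 <= (A K1 w)%:E)%E by rewrite lee_fin.
have markov1 (f : T -> \bar R) (r b : R) : measurable_fun setT f -> (forall w, 0 <= f w)%E ->
    0 < r -> (\int[P]_w f w <= b%:E)%E -> b <= e * r -> (P [set w | r%:E <= f w]%E <= e%:E)%E.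
  move=> mf f0 r0 fb br; apply: (le_trans (markov_le mf f0 r0 fb)).
  by rewrite lee_fin ler_pdivrMr.
pose B1 := [set w | 1%:E <= (gap_count (X w) k0)%:E]%E.
pose B2 := [set w | L%:E <= (A k0 w)%:E]%E.
pose B3 := [set w | L%:E <= tail_control (X w) k0]%E.
pose B4 := [set w | eta%:E <= tail_control (X w) k]%E.
pose B5 := [set w | M%:R%:E <= (A k.+1 w)%:E]%E.
have mB1 : measurable B1.
  apply: mset; apply/measurable_EFinP; apply: measurable_count_pts.
  rewrite (_ : [set x | _] = [set` `[- k0%:R^-1, k0%:R^-1]])//.
  by apply/seteqP; split => x /=; rewrite in_itv /= ler_norml.
have mB2 : measurable B2 by apply: mset; exact/measurable_EFinP.
have mB3 : measurable B3 by apply: mset; exact: measurable_tail_control.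
have mB4 : measurable B4 by apply: mset; exact: measurable_tail_control.
have mB5 : measurable B5 by apply: mset; exact/measurable_EFinP.
have PB2 : (P B2 <= e%:E)%E.
  have mf : measurable_fun setT (fun w => (A k0 w)%:E) by exact/measurable_EFinP.
  exact: (markov1 _ _ _ mf (EA0 _) L0 (EA k0) L2).
have PB3 : (P B3 <= e%:E)%E.
  exact: (markov1 _ _ _ (measurable_tail_control X k0) (fun w => tail_control_ge0 (X w) k0)
    L0 (integral_tail_control C0 a0 a1 ctrl k00) L1).
have PB4 : (P B4 <= e%:E)%E.
  exact: (markov1 _ _ _ (measurable_tail_control X k) (fun w => tail_control_ge0 (X w) k)
    eta0 (integral_tail_control C0 a0 a1 ctrl kp) Lk).
have PB5 : (P B5 <= e%:E)%E.
  have mf : measurable_fun setT (fun w => (A k.+1 w)%:E) by exact/measurable_EFinP.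
  exact: (markov1 _ _ _ mf (EA0 _) M0 (EA k.+1) LM).
exists (N1 `|` (B1 `|` (B2 `|` (B3 `|` (B4 `|` B5))))); split.
- by do 5 apply: measurableU => //.
- have u2 (U V : set T) (u v : R) : measurable U -> measurable V ->
      (P U <= u%:E)%E -> (P V <= v%:E)%E -> (P (U `|` V) <= (u + v)%:E)%E.
    move=> mU mV h1 h2; apply: (@le_trans _ _ (P U + P V)%E); first exact: measureU2.
    by rewrite EFinD leeD.
  have -> : 5 * e = 0 + (e + (e + (e + (e + e)))) by ring.
  apply: (u2) => //; [by do 4 apply: measurableU => //|by rewrite N10|].
  apply: (u2) => //; first by do 3 apply: measurableU => //.
  apply: (u2) => //; first by do 2 apply: measurableU => //.
  apply: (u2) => //; first by apply: measurableU => //.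
  exact: u2.
move=> w; rewrite !not_orP => -[n1 [n2 [n3 [n4 [n5 n6]]]]].
have [[c0 sw] imb] : (X w 0 = 0%N /\ summable_points (X w)) /\
    forall e : R, 0 < e -> forall J0, exists2 J, (J0 <= J)%N &
     `|imbalance (X w) J| <= e * J%:R.
  by apply: contrapT => h; apply: n1; apply: sub1.
have nlt (x y : \bar R) : ~ (x <= y)%E -> (y < x)%E by move=> /negP; rewrite -ltNge.
apply: rho_le_unif => // s se; have sS : normc s <= S by exact: le_trans Se.
have h := @char_approx R (X w) S k0 k L eta M s k00 k0k S1 kS eta0 eta1
  (@truncated_cvg R (X w) s sw) imb.
apply: (le_trans (h _ _ _ _ _ sS _)) => //.
- by apply: gap_count_eq0 => //; rewrite -lte_fin; exact: nlt.
- by rewrite size_pts_annulus// -lee_fin ltW//; exact: nlt.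
- by rewrite ltW//; exact: nlt.
- by rewrite ltW//; exact: nlt.
- by rewrite -(ltr_nat R) size_pts_annulus// -lte_fin; exact: nlt.
- apply: le_trans etaK; rewrite /K.
  by rewrite le_eqVlt; apply/orP; left; apply/eqP; ring.
Qed.

End GoodEvent.

(** * Convergence in law *)

Section LawConvergence.
Variable R : realType.

(** A continuous majorant of the indicator of [|x| <= 1 / k], vanishing beyond [2 / k]: counts in an
    interval are not continuous for the vague topology. *)
Let tent (k : nat) (x : R) : R := Num.min 1 (Num.max 0 (2 - k%:R * `|x|)).

Let tent_ge0 k x : 0 <= tent k x.
Proof. by rewrite le_min ler01 le_max lexx. Qed.

Let continuous_tent k : continuous (tent k).
Proof.
have c1 : continuous (fun x : R => 2 - k%:R * `|x|).
  move=> z; apply: cvgB; first exact: cvg_cst.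
  by apply: cvgM; [exact: cvg_cst|exact: norm_continuous].
have cc (a : R) : continuous (fun _ : R => a) by move=> z; exact: cvg_cst.
exact: min_fun_continuous (cc 1) (max_fun_continuous (cc 0) c1).
Qed.

Let tent_near k x : (0 < k)%N -> `|x| <= k%:R^-1 -> tent k x = 1.
Proof.
move=> k0 xk; have k0' : 0 < k%:R :> R by rewrite ltr0n.
have h : k%:R * `|x| <= 1 by rewrite mulrC -ler_pdivlMr// div1r.
rewrite /tent min_l// le_max; apply/orP; right; lra.
Qed.

Let tent_far k x : (0 < k)%N -> 2 / k%:R < `|x| -> tent k x = 0.
Proof.
move=> k0 xk; have k0' : 0 < k%:R :> R by rewrite ltr0n.
have h : 2 < k%:R * `|x| by rewrite mulrC -ltr_pdivrMr.
have h1 : Num.max 0 (2 - k%:R * `|x|) = 0 by rewrite max_l//; lra.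
by rewrite /tent h1 min_r.
Qed.

(** The cap at one gives a bounded functional, continuous for [k > 1], to which convergence in law
    applies. *)
Let near_zero (k : nat) (c : configuration R) : R :=
  Num.min 1 (\sum_(x <- pts c 1%:R) tent k x).

Let near_zero_ge0 k c : 0 <= near_zero k c.
Proof. by rewrite le_min ler01; apply: sumr_ge0 => x _. Qed.

Let near_zero_le1 k c : `|near_zero k c| <= 1.
Proof. by rewrite ger0_norm ?near_zero_ge0// ge_min lexx. Qed.

Let continuous_near_zero k : (1 < k)%N -> continuous (near_zero k).
Proof.
move=> k1; have cc (a : R) : continuous (fun _ : configuration R => a) by exact: cst_continuous.
apply: min_fun_continuous (cc 1) _; apply: continuous_sum_pts.
  exact: continuous_tent.
move=> x x1; apply: tent_far; first exact: ltnW.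
apply: le_lt_trans x1; rewrite ler_pdivrMr ?ltr0n ?(ltnW k1)//.
by rewrite mul1r ler_nat.
Qed.

Let gap_near_zero k c : (0 < k)%N -> 1 <= gap_count c k -> 1 <= near_zero k c.
Proof.
move=> k0 h; rewrite le_min lexx; apply: (le_trans h).
rewrite /gap_count big_mkcond; apply: ler_sum => x _.
case: ifP => [|_]; last exact: tent_ge0.
by rewrite inE /= => xk; rewrite tent_near.
Qed.

Let near_zero_count k c : (1 < k)%N ->
  near_zero k c <= count_in c [set` `[- (2 / k%:R), 2 / k%:R]].
Proof.
move=> k1; have k0' : 0 < k%:R :> R by rewrite ltr0n (ltnW k1).
have r1 : 2 / k%:R <= 1 :> R by rewrite ler_pdivrMr// mul1r ler_nat.
rewrite (@count_in_pts _ c 1%:R); last first.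
  by move=> x /=; rewrite in_itv /= -ler_norml => /le_trans; apply.
rewrite ge_min; apply/orP; right; rewrite [leRHS]big_mkcond; apply: ler_sum => x _.
case: ifPn => [_|]; first by rewrite /tent ge_min lexx.
rewrite notin_setE /= in_itv /= -ler_norml => /negP; rewrite -ltNge => h.
by rewrite tent_far// ltnW.
Qed.

Let measurable_near_zero d (T : measurableType d) (X : point_process T R) k :
  measurable_fun setT (fun w => near_zero k (X w)).
Proof.
apply: measurable_minr; first exact: measurable_cst.
apply: measurable_sum_pts; apply: continuous_measurable_fun; exact: continuous_tent.
Qed.

Let gap_prob d (T : measurableType d) (P : probability T R) (X : point_process T R) k e :
  (0 < k)%N -> fine 'E_P[(near_zero k) \o X] <= e ->
  (P [set w | 1%:E <= (gap_count (X w) k)%:E]%E <= e%:E)%E.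
Proof.
move=> k0 h; have mF := measurable_near_zero X k.
have mF' : measurable_fun setT (fun w => (near_zero k (X w))%:E) by exact/measurable_EFinP.
have F0 w : (0 <= (near_zero k (X w))%:E)%E by rewrite lee_fin near_zero_ge0.
have hE := bounded_expectation_fin P mF (fun w => near_zero_le1 k (X w)).
have hI : (\int[P]_w (near_zero k (X w))%:E <= e%:E)%E.
  by move: hE; rewrite unlock => ->; rewrite lee_fin; move: h; rewrite unlock.
have := markov_le mF' F0 ltr01 hI; rewrite divr1; apply: le_trans.
apply: le_measure; rewrite ?inE.
- rewrite -[X in measurable X]setTI; apply: emeasurable_fun_c_infty => //.
  apply/measurable_EFinP; apply: measurable_count_pts.
  rewrite (_ : [set x | _] = [set` `[- k%:R^-1, k%:R^-1]])//.
  by apply/seteqP; split => x /=; rewrite in_itv /= ler_norml.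
- by rewrite -[X in measurable X]setTI; exact: emeasurable_fun_c_infty.
- by move=> w /=; rewrite !lee_fin; exact: gap_near_zero.
Qed.

Let lipschitz_approx d (T : measurableType d) (P : probability T R)
    (X : point_process T R) (L C e : R) (G : (R[i] -> R[i]) -> R) k M (N : set T) :
  {ae P, forall w, summable_points (X w)} ->
  lipschitz_rho L G -> 0 <= C -> (forall f, `|G f| <= C) -> (0 < k)%N -> 0 < e ->
  measurable N -> (P N <= (5 * e)%:E)%E ->
  (forall w, ~ N w -> rho (characteristic_limit (X w))
     (polyfun (lcoef [seq inv_cut k x | x <- pts (X w) k.+1%:R]) M) <= e) ->
  `|fine 'E_P[G \o (fun w => characteristic_limit (X w))] -
    fine 'E_P[(fun c => G (polyfun (lcoef [seq inv_cut k x | x <- pts c k.+1%:R]) M)) \o X]|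
  <= `|L| * e + 2 * C * (5 * e).
Proof.
move=> good lipG C0 GC k0 e0 mN PN close.
have lmX := lipschitz_measurable_characteristic good.
have [N' [h [mN' N'0 mh [hC hG] ->]]] := lipschitz_measurable_version lmX lipG C0 GC.
have mp : measurable_fun setT ((fun c =>
    G (polyfun (lcoef [seq inv_cut k x | x <- pts c k.+1%:R]) M)) \o X).
  apply: (measurable_lipschitz_polyfun lipG) => i; apply: measurable_lcoef.
  by apply: continuous_measurable_fun; exact: continuous_cut.
apply: (@expectation_diff_le _ _ _ P h _ C _ (5 * e) (N' `|` N)) => //.
- by move=> w; exact: GC.
- exact: measurableU.
- apply: (@le_trans _ _ (P N' + P N)%E); first exact: measureU2.
  by rewrite N'0 add0e.
- by rewrite mulr_ge0// ltW.
- move=> w; rewrite not_orP => -[n1 n2]; rewrite hG//=.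
  apply: (le_trans (lipG _ _)); apply: (@le_trans _ _ (`|L| * rho (characteristic_limit (X w))
    (polyfun (lcoef [seq inv_cut k x | x <- pts (X w) k.+1%:R]) M))).
    by rewrite ler_wpM2r ?rho_ge0// ler_norm.
  by rewrite ler_wpM2l//; exact: close.
Qed.

(** The bounds in [controlled] say nothing below unit scale, so the rarity of points of [X n] near
    zero is imported from [Y] by convergence in law, hence for large [n] only. *)
Lemma lipschitz_law_cvg (d : nat -> measure_display) (T : forall n, measurableType (d n))
    (P : forall n, probability (T n) R) (X : forall n, point_process (T n) R)
    (d' : measure_display) (T' : measurableType d') (P' : probability T' R)
    (Y : point_process T' R) (C a : R) :
  0 <= C -> 0 < a -> a <= 1 ->
  (forall n, controlled (P n) (X n) C a) -> controlled P' Y C a ->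
  (forall n, {ae P n, forall w, X n w 0 = 0%N /\ summable_points (X n w)}) ->
  {ae P', forall w, Y w 0 = 0%N /\ summable_points (Y w)} ->
  (forall r : R, 0 < r -> (\int[P']_w (count_in (Y w) [set` `[- r, r]])%:E <= (2 * r)%:E)%E) ->
  cvg_in_law [set: configuration R] P X P' Y ->
  forall (L C1 : R) (G : (R[i] -> R[i]) -> R), lipschitz_rho L G ->
    (forall f, `|G f| <= C1) ->
    fine 'E_(P n)[G \o (fun w => characteristic_limit (X n w))]%E @[n --> \oo] -->
    fine 'E_P'[G \o (fun w => characteristic_limit (Y w))]%E.
Proof.
move=> C0 a0 a1 ctrlX ctrlY goodX goodY gapY [_ _ law] L C1 G lipG GC.
have C10 : 0 <= C1 by exact: le_trans (GC (fun=> 0)).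
have goodX' n : {ae P n, forall w, summable_points (X n w)}.
  by apply: filterS (goodX n) => w [].
have goodY' : {ae P', forall w, summable_points (Y w)} by apply: filterS goodY => w [].
have flaw (F : configuration R -> R) (B : R) : continuous F -> (forall c, `|F c| <= B) ->
    measurable_fun setT (F \o Y) ->
    fine 'E_(P n)[F \o X n]%E @[n --> \oo] --> fine 'E_P'[F \o Y]%E.
  move=> cF FB mF; have h := law F (continuous_subspaceT cF) (ex_intro _ B (fun c _ => FB c)).
  rewrite (bounded_expectation_fin P' mF (fun w => FB _)) in h.
  by have := fine_cvg h; rewrite /=; apply.
apply/cvgrPdist_le => eps eps0.
(* Each comparison of [G] with its polynomial version costs [|L| * e] off the exceptional set and
   [2 * C1] times its probability [5 * e] on it; [D] collects these, with [+ 1] for positivity. *)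
pose D : R := `|L| + 10 * C1 + 1.
have D0 : 0 < D by rewrite ltr_wpDl// addr_ge0// mulr_ge0.
pose e : R := eps / (3 * D).
have e0 : 0 < e by rewrite divr_gt0// mulr_gt0.
have De : `|L| * e + 2 * C1 * (5 * e) <= eps / 3.
  have -> : eps / 3 = D * e by rewrite /e; field; rewrite gt_eqF.
  rewrite /D; have : 0 < e := e0; nra.
(* The limit process has mean count at most [4 / k0] on the support of the tent, and [k0 >= 2] keeps
   that support inside the window of radius one. *)
pose k0 := (maxn 2 (Num.truncn (4 / e)).+1).
have k02 : (1 < k0)%N by rewrite leq_maxl.
have k01 : (0 < k0)%N by rewrite ltnW.
have k0' : 0 < k0%:R :> R by rewrite ltr0n.
have ke : 4 / k0%:R < e.
  rewrite ltr_pdivrMr// mulrC -ltr_pdivrMr//; apply: (lt_le_trans (truncnS_gt _)).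
  by rewrite ler_nat leq_maxr.
have gapY1 : fine 'E_P'[near_zero k0 \o Y]%E < e.
  apply: le_lt_trans ke.
  have r0 : 0 < 2 / k0%:R :> R by rewrite divr_gt0.
  have := gapY _ r0; have -> : 2 * (2 / k0%:R) = 4 / k0%:R :> R by field; rewrite gt_eqF.
  move=> h; rewrite -lee_fin.
  rewrite -(bounded_expectation_fin P' (measurable_near_zero Y k0) (fun w => near_zero_le1 k0 (Y w))).
  rewrite unlock; apply: le_trans h; apply: ge0_le_integral => //.
  - by move=> w _; rewrite lee_fin near_zero_ge0.
  - by apply/measurable_EFinP; exact: measurable_near_zero.
  - by apply/measurable_EFinP; exact: measurable_count_itv.
  - by move=> w _; rewrite lee_fin near_zero_count.
have gapX1 : \forall n \near \oo, fine 'E_(P n)[near_zero k0 \o X n]%E < e.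
  exact: (cvgr_lt _ (flaw _ 1 (continuous_near_zero k02) (near_zero_le1 k0)
    (measurable_near_zero Y k0))).
have [k [M [kp approx]]] := good_event C0 a0 a1 e0 k01.
pose H c := G (polyfun (lcoef [seq inv_cut k x | x <- pts c k.+1%:R]) M).
have cH : continuous H by exact: continuous_lipschitz_polyfun.
have mH : measurable_fun setT (H \o Y).
  apply: (measurable_lipschitz_polyfun lipG) => i; apply: measurable_lcoef.
  by apply: continuous_measurable_fun; exact: continuous_cut.
have cvgH := flaw H C1 cH (fun c => GC _) mH.
have e3 : 0 < eps / 3 by rewrite divr_gt0.
have nearH : \forall n \near \oo,
    `|fine 'E_P'[H \o Y]%E - fine 'E_(P n)[H \o X n]%E| <= eps / 3.
  exact: ((cvgrPdist_le _ _).1 cvgH _ e3).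
have [NY [mNY PNY closeY]] := approx _ _ P' Y ctrlY goodY (gap_prob k01 (ltW gapY1)).
have dY := lipschitz_approx goodY' lipG C10 GC kp e0 mNY PNY closeY.
near=> n.
have gX : fine 'E_(P n)[near_zero k0 \o X n]%E < e by near: n.
have hn : `|fine 'E_P'[H \o Y]%E - fine 'E_(P n)[H \o X n]%E| <= eps / 3 by near: n.
have [NX [mNX PNX closeX]] := approx _ _ (P n) (X n) (ctrlX n) (goodX n) (gap_prob k01 (ltW gX)).
have dX := lipschitz_approx (goodX' n) lipG C10 GC kp e0 mNX PNX closeX.
move: hn (le_trans dY De) (le_trans dX De); rewrite -/H.
set u := fine 'E_P'[G \o _]%E; set v := fine 'E_(P n)[G \o _]%E.
move: (fine 'E_P'[H \o Y]%E) (fine 'E_(P n)[H \o X n]%E) => p q h1 h2 h3.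
have -> : u - v = (u - p) + ((p - q) - (v - q)) by ring.
have -> : eps = eps / 3 + (eps / 3 + eps / 3) by field.
apply: (le_trans (ler_normD _ _)); apply: lerD => //.
by apply: (le_trans (ler_normB _ _)); exact: lerD.
Unshelve. all: by end_near.
Qed.

End LawConvergence.

(** * Product-amenable sequences *)

Section AbsoluteMoment.
Context d (T : measurableType d) (R : realType) (P : probability T R).

(* AM-GM: [2 |f| <= f ^ 2 / lam + lam]. *)
Lemma integral_abs_le (f : T -> R) (v lam : R) : measurable_fun setT f -> 0 < lam ->
  (\int[P]_w (f w ^+ 2)%:E <= v%:E)%E ->
  (\int[P]_w (`|f w|)%:E <= ((v / lam + lam) / 2)%:E)%E.
Proof.
move=> mf l0 hv; have l2 : 0 < 2 * lam by rewrite mulr_gt0.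
have mf2 : measurable_fun setT (fun w => f w ^+ 2) by exact: measurable_funX.
have il : 0 <= (2 * lam)^-1 by rewrite invr_ge0 ltW.
apply: (@le_trans _ _ (\int[P]_w ((2 * lam)^-1%:E * (f w ^+ 2)%:E + (lam / 2)%:E))%E).
  apply: ge0_le_integral => //.
  - by apply/measurable_EFinP; apply: measurableT_comp.
  - apply/measurable_EFinP; apply: measurable_funD => //; exact: measurable_funM.
  - move=> w _; rewrite -EFinM -EFinD lee_fin -(real_normK (num_real (f w))).
    have -> : (2 * lam)^-1 * `|f w| ^+ 2 + lam / 2 =
      `|f w| + (2 * lam)^-1 * (`|f w| - lam) ^+ 2 by field; rewrite gt_eqF.
    by rewrite lerDl mulr_ge0// sqr_ge0.
rewrite ge0_integralD//; first last.
- by move=> w _; rewrite lee_fin divr_ge0// ltW.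
- by apply/measurable_EFinP; exact: measurable_funM.
- by move=> w _; rewrite -EFinM lee_fin mulr_ge0// sqr_ge0.
rewrite ge0_integralZl//; last 2 first.
- exact/measurable_EFinP.
- by move=> w _; rewrite lee_fin sqr_ge0.
have -> : (\int[P]_w (lam / 2)%:E = (lam / 2)%:E)%E.
  by transitivity ((lam / 2)%:E * P setT)%E; [exact: integral_cst|rewrite probability_setT mule1].
apply: (@le_trans _ _ ((2 * lam)^-1%:E * v%:E + (lam / 2)%:E)%E); first by rewrite leeD2r// lee_wpmul2l.
rewrite -EFinM -EFinD lee_fin le_eqVlt; apply/orP; left; apply/eqP.
by field; rewrite gt_eqF.
Qed.

Lemma variance_integral (f : T -> R) :
  'V_P[f]%E = (\int[P]_w ((f w - fine 'E_P[f]%E) ^+ 2)%:E)%E.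
Proof.
rewrite /variance covariance.unlock [in LHS]expectation.unlock.
by apply: eq_integral => w _; rewrite /= expr2 expectation.unlock.
Qed.

Lemma integral_abs_diff_le (f g : T -> R) (m m' b v lam : R) :
  measurable_fun setT f -> measurable_fun setT g -> 0 < lam -> `|m - m'| <= b ->
  (\int[P]_w ((f w - m) ^+ 2)%:E <= v%:E)%E -> (\int[P]_w ((g w - m') ^+ 2)%:E <= v%:E)%E ->
  (\int[P]_w (`|f w - g w|)%:E <= (v / lam + lam + b)%:E)%E.
Proof.
move=> mf mg l0 hb hf hg.
have mf' : measurable_fun setT (fun w => f w - m) by exact: measurable_funB.
have mg' : measurable_fun setT (fun w => g w - m') by exact: measurable_funB.
have mnf : measurable_fun setT (fun w => `|f w - m|) by exact: measurableT_comp.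
have mng : measurable_fun setT (fun w => `|g w - m'|) by exact: measurableT_comp.
have b0 : 0 <= b by exact: le_trans hb.
apply: (@le_trans _ _ (\int[P]_w (`|f w - m| + `|g w - m'| + b)%:E)%E).
  apply: ge0_le_integral => //.
  - by apply/measurable_EFinP; apply: measurableT_comp => //; exact: measurable_funB.
  - by apply/measurable_EFinP; apply: measurable_funD => //; exact: measurable_funD.
  - move=> w _; rewrite lee_fin.
    have -> : f w - g w = (f w - m) - (g w - m') + (m - m') by ring.
    by apply: (le_trans (ler_normD _ _)); apply: lerD => //; exact: ler_normB.
have -> : v / lam + lam + b = (v / lam + lam) / 2 + (v / lam + lam) / 2 + b by field; rewrite gt_eqF.
apply: integral_add_le => //.
- exact: measurable_funD.
- by apply: integral_add_le => //; exact: integral_abs_le.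
- have -> : (\int[P]_w b%:E = b%:E)%E => //.
  by transitivity (b%:E * P setT)%E; [exact: integral_cst|rewrite probability_setT mule1].
Qed.

End AbsoluteMoment.

Section Amenable.
Variable R : realType.

Lemma summable_points_of_tail (c : configuration R) :
  cvg (\sum_(x \in [set x | `|x| <= B]) (c x)%:R / x @[B --> +oo]) ->
  (tail_control c 1 < +oo)%E -> summable_points c.
Proof.
move=> h V; split; last exact: tail_control_summable.
rewrite (_ : (fun B => _) =
  (fun B => \sum_(x \in [set x | `|x| <= B]) (c x)%:R / x))//.
apply/funext => B; rewrite (@fsum_pts _ c B)// [LHS]big_seq [RHS]big_seq_cond.
apply: eq_bigl => x; rewrite mem_pts.
by case: (boolP (`|x| <= B)) => //= xB; rewrite mem_set// andbT.
Qed.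

Lemma amenable_controlled (d : nat -> measure_display) (T : forall n, measurableType (d n))
    (P : forall n, probability (T n) R) (X : forall n, point_process (T n) R) :
  uniformly_product_amenable P X ->
  exists C a : R, [/\ 0 <= C, 0 < a <= 1, forall n, controlled (P n) (X n) C a &
    forall n, {ae P n, forall w, X n w 0 = 0%N /\ summable_points (X n w)}].
Proof.
move=> [zero pv _ [delta d0 [K bnd]]].
(* Capping [delta] at one ensures [a <= 1]. Standard deviations are [O(j ^ (1 - a))] for
   [a = dl / 2], and with [lam = j ^ (1 - a)] the bound [v / lam + lam + b] becomes
   [(2 |K| + 1) lam]; [|K|] replaces [K], whose sign is unknown. *)
pose dl := Num.min delta 1; have dl0 : 0 < dl by rewrite lt_min d0 ltr01.
have dl1 : dl <= 1 by rewrite ge_min lexx orbT.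
have dld : dl <= delta by rewrite ge_min lexx.
pose a := dl / 2; pose C := 2 * `|K| + 1.
have C0 : 0 <= C by rewrite addr_ge0// mulr_ge0.
have a0 : 0 < a by rewrite divr_gt0.
have a1 : a <= 1 by rewrite /a; lra.
have KK : K <= `|K| by exact: ler_norm.
have ctrl n : controlled (P n) (X n) C a.
  split=> [j|j j0].
  - have h1 : 1 <= j.+1%:R - j%:R :> R by rewrite -natr1; lra.
    have h2 : 1 <= - j%:R - - j.+1%:R :> R by rewrite -natr1; lra.
    have [_ + _] := bnd n false false _ _ h1; have [_ + _] := bnd n true true _ _ h2.
    rewrite unlock => e2 e1.
    have w1 : j.+1%:R - j%:R = 1 :> R by rewrite -natr1; ring.
    have w2 : - j%:R - - j.+1%:R = 1 :> R by rewrite -natr1; ring.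
    rewrite w1 mulr1 in e1; rewrite w2 mulr1 in e2.
    apply: (@le_trans _ _ (`|K| + `|K|)%:E); last by rewrite lee_fin /C; lra.
    apply: integral_add_le; rewrite ?lee_fin.
    + exact: measurable_count_itv.
    + by move=> w; apply: fsumr_ge0.
    + exact: measurable_count_itv.
    + by move=> w; apply: fsumr_ge0.
    + by apply: le_trans e1 _; rewrite lee_fin.
    + by apply: le_trans e2 _; rewrite lee_fin.
  - have j1 : 1 <= j%:R :> R by rewrite ler1n.
    have jp : 0 < j%:R :> R by rewrite ltr0n.
    have h1 : 1 <= j%:R - 0 :> R by rewrite subr0.
    have h2 : 1 <= 0 - - j%:R :> R by rewrite sub0r opprK.
    have := bnd n false false _ _ h1; have := bnd n true true _ _ h2.
    rewrite /= !subr0 sub0r opprK => -[_ e2 v2] [e1 e3 v1].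
    have opp : [set - t | t in [set` `]0 : R, j%:R]]] = [set` `[- j%:R, 0[].
      apply/seteqP; split => [x /= [t]|x /=]; rewrite !in_itv /=.
        by move=> /andP[t0 tj] <-; rewrite lerN2 tj oppr_lt0.
      by move=> /andP[xj x0]; exists (- x); rewrite ?opprK// in_itv /= oppr_gt0 x0 lerNl.
    rewrite opp in e1.
    set f := fun w => count_in (X n w) [set` `]0, j%:R]] in e1 e3 v1.
    set g := fun w => count_in (X n w) [set` `[- j%:R, 0[] in e1 e2 v2.
    have mf : measurable_fun setT f by exact: measurable_count_itv.
    have mg : measurable_fun setT g by exact: measurable_count_itv.
    have fe (h : T n -> R) (b : R) : (forall w, 0 <= h w) -> ('E_(P n)[h] <= b%:E)%E ->
        'E_(P n)[h]%E = (fine 'E_(P n)[h]%E)%:E.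
      move=> h0 hb; rewrite fineK// ge0_fin_numE ?expectation_ge0//.
      exact: le_lt_trans hb (ltry _).
    rewrite (fe _ _ _ e3) in e1; last by move=> w; apply: fsumr_ge0.
    rewrite (fe _ _ _ e2) in e1; last by move=> w; apply: fsumr_ge0.
    rewrite -EFinB abse_EFin lee_fin in e1.
    pose lam := j%:R `^ (1 - a).
    have lam0 : 0 < lam by rewrite powR_gt0.
    have pw (p q : R) : p <= q -> K * j%:R `^ p <= `|K| * j%:R `^ q.
      move=> pq; apply: (@le_trans _ _ (`|K| * j%:R `^ p)); first by rewrite ler_wpM2r ?powR_ge0.
      by rewrite ler_wpM2l// ler_powR.
    have lam2 : j%:R `^ (2 - 2 * a) = lam ^+ 2.
      by rewrite -powR_mulrn ?powR_ge0// -powRrM; congr (_ `^ _); ring.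
    have v1' : (\int[P n]_w ((f w - fine 'E_(P n)[f]%E) ^+ 2)%:E <= (`|K| * lam ^+ 2)%:E)%E.
      move: v1; rewrite variance_integral => /le_trans; apply.
      by rewrite lee_fin -lam2; apply: pw; rewrite /a; lra.
    have v2' : (\int[P n]_w ((g w - fine 'E_(P n)[g]%E) ^+ 2)%:E <= (`|K| * lam ^+ 2)%:E)%E.
      move: v2; rewrite variance_integral => /le_trans; apply.
      by rewrite lee_fin -lam2; apply: pw; rewrite /a; lra.
    have e1' : `|fine 'E_(P n)[f]%E - fine 'E_(P n)[g]%E| <= `|K| * lam.
      by apply: (le_trans e1); apply: pw; rewrite /a; lra.
    apply: (le_trans (integral_abs_diff_le mf mg lam0 e1' v1' v2')).
    rewrite lee_fin le_eqVlt; apply/orP; left; apply/eqP.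
    by rewrite /C -/lam; field; rewrite gt_eqF.
exists C, a; split => //; first by rewrite a0.
move=> n; have tc := ae_tail_control_fin C0 a0 a1 (ctrl n).
apply: filterS3 (zero n) (pv n) tc => w z p t; split => //; exact: summable_points_of_tail.
Qed.

End Amenable.

(** * The sine process *)

Section Cells.
Variable R : realType.
Implicit Types (c : configuration R) (D : set R) (B m i : nat).

Lemma list_min_pos (s : seq R) : exists2 g : R, 0 < g & forall t, t \in s -> 0 < t -> g <= t.
Proof.
elim: s => [|a s [g g0 IH]]; first by exists 1.
have [a0|a0] := ltP 0 a; last first.
  exists g => // t; rewrite inE => /orP[/eqP ->|]; last exact: IH.
  by move=> /lt_le_trans /(_ a0); rewrite ltxx.
exists (Num.min g a); first by rewrite lt_min g0.
move=> t; rewrite inE => /orP[/eqP -> _|ts t0]; first by rewrite ge_min lexx orbT.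
by rewrite ge_min IH.
Qed.

Let grid B m i : R := i%:R / m.+1%:R - B%:R.

(** Half-open, so that the first [2 * B * m.+1] cells partition []- B, B]] exactly. *)
Definition cell B m i : set R := [set` `]grid B m i, grid B m i.+1]].

Lemma measurable_cell B m i : measurable (cell B m i).
Proof. exact: measurable_itv. Qed.

Let grid_le B m i i' : (i <= i')%N -> grid B m i <= grid B m i'.
Proof. by move=> ii; rewrite lerD2r ler_pM2r ?invr_gt0// ler_nat. Qed.

Lemma cell_disjoint B m i i' : (i < i')%N -> cell B m i `&` cell B m i' = set0.
Proof.
move=> ii; apply/seteqP; split => // x []; rewrite /cell /= !in_itv /= => /andP[_ h1] /andP[h2 _].
by have := lt_le_trans h2 (le_trans h1 (grid_le B m ii)); rewrite ltxx.
Qed.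

Lemma cell_close B m i x z : cell B m i x -> cell B m i z -> `|x - z| < m.+1%:R^-1.
Proof.
have e : grid B m i.+1 = grid B m i + m.+1%:R^-1.
  by rewrite /grid -[i.+1%:R]natr1 mulrDl div1r; ring.
rewrite /cell /= !in_itv /= e => /andP[h1 h2] /andP[h3 h4].
move: (m.+1%:R^-1) (grid B m i) h1 h2 h3 h4 => h t h1 h2 h3 h4.
by rewrite ltr_norml; apply/andP; split; lra.
Qed.

Lemma cell_indicator_sum B m x : - B%:R < x -> x <= B%:R ->
  \sum_(i < 2 * B * m.+1) (x \in cell B m i)%:R = 1 :> R.
Proof.
move=> Bx xB; pose u i : R := (grid B m i < x)%R%:R.
have uE i : (x \in cell B m i)%:R = u i - u i.+1.
  rewrite /u /cell mem_setE /= in_itv /=.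
  have [h|h] := ltP (grid B m i.+1) x; rewrite ?andbF ?andbT ?subr0.
    by rewrite (le_lt_trans (grid_le B m (leqnSn i)) h) subrr.
  by [].
under eq_bigr do rewrite uE.
have -> n : \sum_(i < n) (u i - u i.+1) = u 0%N - u n.
  by elim: n => [|n IH]; rewrite ?big_ord0 ?subrr// big_ord_recr/= IH; ring.
have g0 : grid B m 0 = - B%:R by rewrite /grid mul0r add0r.
have gM : grid B m (2 * B * m.+1) = B%:R.
  by rewrite /grid !natrM; field; rewrite addrC natr1 pnatr_eq0.
by rewrite /u g0 gM Bx ltNge xB subr0.
Qed.

Lemma count_in_cells c D B m : D `<=` [set` `]- B%:R, B%:R]] ->
  count_in c D = \sum_(i < 2 * B * m.+1) count_in c (D `&` cell B m i).
Proof.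
move=> DB; have DB' x : D x -> `|x| <= B%:R.
  by move=> /DB /=; rewrite in_itv /= ler_norml => /andP[/ltW -> ->].
rewrite (count_in_pts c DB') big_mkcond.
have e i : count_in c (D `&` cell B m i) =
    \sum_(x <- pts c B%:R) (x \in D)%:R * (x \in cell B m i)%:R.
  rewrite (@count_in_pts _ c B%:R); last by move=> x [/DB'].
  rewrite big_mkcond; apply: eq_bigr => x _; rewrite in_setI.
  by case: (x \in D); case: (x \in cell _ _ _); rewrite ?mulr1 ?mulr0.
under [RHS]eq_bigr do rewrite e.
rewrite exchange_big /=; apply: eq_bigr => x _; rewrite -mulr_sumr.
case: ifPn => [|_]; last by rewrite mul0r.
rewrite inE => /DB /=; rewrite in_itv /= => /andP[h1 h2].
by rewrite cell_indicator_sum// mulr1.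
Qed.

Lemma uniq_pts c (B : R) : (forall x, (c x <= 1)%N) -> uniq (pts c B).
Proof.
move=> c1; apply: count_mem_uniq => x; rewrite count_pts mem_pts.
by case: ifP => //= _; have := c1 x; case: (c x) => [|[|]].
Qed.

(** Once the mesh is below the smallest distance between two points of the window, a cell holds at
    most one point, and [0] and [1] are their own squares. The threshold depends on the
    configuration, so only pointwise convergence results, to which Fatou's lemma is suited. *)
Lemma count_in_cell_simple c D B : (forall x, (c x <= 1)%N) ->
  D `<=` [set` `]- B%:R, B%:R]] ->
  \forall m \near \oo, forall i, count_in c (D `&` cell B m i) ^+ 2 =
    count_in c (D `&` cell B m i).
Proof.
move=> c1 DB; pose l := pts c B%:R.
have [g g0 hg] := list_min_pos [seq `|x - z| | x <- l, z <- l].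
exists (Num.truncn g^-1) => // m /= gm i.
have DB' x : (D `&` cell B m i) x -> `|x| <= B%:R.
  by move=> [/DB /=]; rewrite in_itv /= ler_norml => /andP[/ltW -> ->].
have mg : m.+1%:R^-1 <= g.
  rewrite -[leRHS]invrK lef_pV2 ?posrE ?invr_gt0//; apply: ltW.
  by apply: (lt_le_trans (truncnS_gt _)); rewrite ler_nat ltnS.
rewrite (count_in_pts c DB') -big_filter -/l.
case E : [seq x <- l | x \in D `&` cell B m i] => [|x [|z s]].
- by rewrite big_nil expr0n.
- by rewrite big_seq1 expr1n.
- have : uniq [:: x, z & s] by rewrite -E filter_uniq// uniq_pts.
  have : x \in [:: x, z & s] by rewrite inE eqxx.
  have : z \in [:: x, z & s] by rewrite !inE eqxx orbT.
  rewrite -E !mem_filter => /andP[]; rewrite inE => -[_ hz] zl /andP[].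
  rewrite inE => -[_ hx] xl; rewrite E /= inE negb_or => /andP[/andP[xz _] _].
  have := cell_close hx hz; rewrite ltNge (le_trans mg)// hg//.
    by apply: allpairs_f.
  by rewrite normr_gt0 subr_eq0.
Qed.

(* The number of ordered pairs of points in distinct cells. *)
Definition cross_count c D B m : R :=
  \sum_(i < 2 * B * m.+1) \sum_(j < 2 * B * m.+1 | j != i)
    count_in c (D `&` cell B m i) * count_in c (D `&` cell B m j).

Lemma cross_count_cvg c D B : (forall x, (c x <= 1)%N) ->
  D `<=` [set` `]- B%:R, B%:R]] ->
  cross_count c D B m @[m --> \oo] --> count_in c D ^+ 2 - count_in c D.
Proof.
move=> c1 DB; apply: cvg_near_cst; have := count_in_cell_simple c1 DB.
apply: filterS => m hm; pose N i := count_in c (D `&` cell B m i).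
rewrite (count_in_cells c m DB) expr2 mulr_suml -sumrB; apply: eq_bigr => i _.
rewrite mulr_sumr [X in _ = X - _](bigD1 i)//= -expr2 hm addrC.
by rewrite addrK.
Qed.

Lemma count_in_ge0 c (A : set R) : 0 <= count_in c A.
Proof. by apply: fsumr_ge0. Qed.

Lemma cross_count_ge0 c D B m : 0 <= cross_count c D B m.
Proof.
by apply: sumr_ge0 => i _; apply: sumr_ge0 => j _; rewrite mulr_ge0 ?count_in_ge0.
Qed.

Lemma count_in_sqr_ge c D (B : R) : (forall x, D x -> `|x| <= B) ->
  0 <= count_in c D ^+ 2 - count_in c D.
Proof.
move=> DB; rewrite (count_in_pts c DB).
have -> : \sum_(x <- pts c B | x \in D) 1 = (\sum_(x <- pts c B | x \in D) 1)%N%:R :> R.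
  by rewrite natr_sum.
rewrite -natrX subr_ge0 ler_nat.
by case: (\sum_(_ <- _ | _) _)%N => // n; rewrite expnS expn1 leq_pmulr.
Qed.

End Cells.

Section SineKernel.
Variable R : realType.

Lemma sine_kernelC (u v : R) : sine_kernel u v = sine_kernel v u.
Proof.
rewrite /sine_kernel eq_sym; case: eqP => // _.
by rewrite -[u - v]opprB mulrN sinN invrN mulrNN.
Qed.

Lemma sine_kernel_sqr_le1 (u v : R) : sine_kernel u v ^+ 2 <= 1.
Proof.
rewrite -(real_normK (num_real _)) expr_le1// /sine_kernel.
have [_|uv] := eqVneq u v; first by rewrite normr1.
have h : 0 < `|pi * (u - v)| by rewrite normr_gt0 mulf_neq0 ?subr_eq0// gt_eqF// pi_gt0.
by rewrite normf_div ler_pdivrMr// mul1r norm_sin_le.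
Qed.

End SineKernel.

Lemma measurable_sum_cond d (T : measurableType d) (R : realType) (I : Type) (s : seq I)
    (p : pred I) (f : I -> T -> R) : (forall i, measurable_fun setT (f i)) ->
  measurable_fun setT (fun w => \sum_(i <- s | p i) f i w).
Proof.
move=> mf; under eq_fun do rewrite -big_filter.
exact: measurable_sum.
Qed.

Section SineMoments.
Context d (T : measurableType d) (R : realType) (P : probability T R)
  (y : point_process T R).
Hypothesis sine : sine_process P y.
Let mu := @lebesgue_measure R.

Let simple : {ae P, forall w, forall x, (y w x <= 1)%N}.
Proof. by case: sine. Qed.

Lemma mean_count (D : set R) : measurable D -> bounded_set D ->
  (\int[P]_w (count_in (y w) D)%:E = mu D)%E.
Proof.
move=> mD bD; have [_ /(_ 1%N (fun=> D))] := sine.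
move=> /(_ (fun=> mD) (fun=> bD)) h.
have /h : trivIset setT (fun _ : 'I_1 => D) by move=> i j _ _ _; rewrite !ord1.
rewrite unlock enum_ordSl enum_ord0 /=.
under eq_integral do rewrite big_ord1.
move=> ->; rewrite -(mul1e (mu D)) -(@integral_cst _ _ _ mu _ mD 1%E).
by apply: eq_integral => x _; rewrite det_mx11 mxE /= /sine_kernel eqxx.
Qed.

(** The two-point intensity is the determinant [1 - sine_kernel u v ^+ 2], which lies between zero
    and one: points repel. *)
Lemma mean_product_le (D1 D2 : set R) : measurable D1 -> measurable D2 ->
  bounded_set D1 -> bounded_set D2 -> D1 `&` D2 = set0 ->
  (\int[P]_w (count_in (y w) D1 * count_in (y w) D2)%:E <= mu D1 * mu D2)%E.
Proof.
move=> m1 m2 b1 b2 D12; pose D (i : 'I_2) := if i == ord0 then D1 else D2.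
have [_ /(_ 2%N D)] := sine.
have tD : trivIset setT D.
  apply/trivIsetP => -[[|[|//]] ?] [[|[|//]] ?] _ _ //= _; rewrite /D//=.
  by rewrite setIC.
have mD i : measurable (D i) by rewrite /D; case: ifP.
have bD i : bounded_set (D i) by rewrite /D; case: ifP.
move=> /(_ mD bD tD); rewrite unlock !enum_ordSl enum_ord0 /= /D /=.
under eq_integral do rewrite big_ord_recl big_ord1 /=.
move=> ->.
have det2 (u v : R) : \det (\matrix_(i < 2, j < 2)
    sine_kernel [:: u; v]`_i [:: u; v]`_j) = 1 - sine_kernel u v ^+ 2.
  rewrite (expand_det_row _ ord0) !big_ord_recl big_ord0 /cofactor !det_mx11 !mxE /=.
  rewrite /bump /= addr0 !expr0 !expr1 !mul1r mulN1r mulrN -(sine_kernelC u v) -expr2.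
  by rewrite /sine_kernel !eqxx mul1r.
have inner u : (0 <= \int[mu]_(v in D2) (\det (\matrix_(i < 2, j < 2)
    sine_kernel [:: u; v]`_i [:: u; v]`_j))%:E <= mu D2)%E.
  apply/andP; split.
    by apply: integral_ge0 => v _; rewrite det2 lee_fin subr_ge0 sine_kernel_sqr_le1.
  rewrite -(mul1e (mu D2)) -(@integral_cst _ _ _ mu _ m2 1%E).
  apply: (@ge0_integral_le_off _ _ _ _ _ set0) => //.
  - by move=> v _; rewrite det2 lee_fin subr_ge0 sine_kernel_sqr_le1.
  - by move=> v _ _; rewrite det2 lee_fin lerBlDr lerDl sqr_ge0.
rewrite muleC -(@integral_cst _ _ _ mu _ m1 (mu D2)); apply: (@ge0_integral_le_off _ _ _ _ _ set0) => //.
  by move=> u _; have /andP[] := inner u.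
by move=> u _ _; have /andP[] := inner u.
Qed.

Let bounded_itv (B : nat) (D : set R) : D `<=` [set` `]- B%:R, B%:R]] -> bounded_set D.
Proof.
move=> DB; exists B%:R; split; first exact: num_real.
move=> z hz t /DB /=; rewrite in_itv /= => /andP[h1 h2].
by rewrite (le_trans _ (ltW hz))// ler_norml (ltW h1).
Qed.

Let measure_fin (B : nat) (D : set R) : measurable D -> D `<=` [set` `]- B%:R, B%:R]] ->
  mu D = (fine (mu D))%:E.
Proof.
move=> mD DB; rewrite fineK// ge0_fin_numE//.
apply: (@le_lt_trans _ _ (mu [set` `]- B%:R, B%:R]])).
  by apply: le_measure; rewrite ?inE//; exact: measurable_itv.
by rewrite /mu lebesgue_measure_itv; case: ifP => _; rewrite ?ltry// -EFinB ltry.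
Qed.

(* For a simple configuration [cross_count] tends to [N ^ 2 - N] as the cells
   shrink, while its mean is at most [|D| ^ 2] since the two-point intensity is at
   most one; conclude by Fatou. *)
Lemma second_moment (B : nat) (D : set R) : measurable D -> D `<=` [set` `]- B%:R, B%:R]] ->
  (\int[P]_w (count_in (y w) D ^+ 2)%:E <= (fine (mu D) ^+ 2 + fine (mu D))%:E)%E.
Proof.
move=> mD DB; have DB' x : D x -> `|x| <= B%:R.
  by move=> /DB /=; rewrite in_itv /= ler_norml => /andP[/ltW -> ->].
have mN : measurable_fun setT (fun w => count_in (y w) D).
  by apply: measurable_count => //; exact: bounded_itv DB.
have [N0 [mN0 N00 sub]] := simple.
have simple' w : ~ N0 w -> forall x, (y w x <= 1)%N.
  by move=> Nw; apply: contrapT => h; apply: Nw; exact: sub.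
pose Dc m i := D `&` cell B m i.
have mDc m i : measurable (Dc m i) by apply: measurableI => //; exact: measurable_cell.
have DcB m i : Dc m i `<=` [set` `]- B%:R, B%:R]] by move=> x [/DB].
have mNc m i : measurable_fun setT (fun w => count_in (y w) (Dc m i)).
  by apply: measurable_count => //; exact: bounded_itv (DcB m i).
pose a m i := fine (mu (Dc m i)).
have a0 m i : 0 <= a m i by exact: fine_ge0.
have sum_a m : \sum_(i < 2 * B * m.+1) a m i = fine (mu D).
  apply: EFin_inj; rewrite -(measure_fin mD DB) -(mean_count mD (bounded_itv DB)) -sumEFin.
  under [RHS]eq_integral do rewrite (count_in_cells _ m DB) -sumEFin.
  rewrite ge0_integral_sum//; first last.
  - by move=> i w _; rewrite lee_fin count_in_ge0.
  - by move=> i; apply/measurable_EFinP; exact: mNc.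
  apply: eq_bigr => i _; rewrite -(measure_fin (mDc m i) (DcB m i)).
  by rewrite -(mean_count (mDc m i) (bounded_itv (DcB m i))).
have cross m : (\int[P]_w (cross_count (y w) D B m)%:E <= (fine (mu D) ^+ 2)%:E)%E.
  under eq_integral do rewrite /cross_count -sumEFin.
  rewrite ge0_integral_sum//; first last.
  - move=> i w _; rewrite lee_fin; apply: sumr_ge0 => j _.
    by rewrite mulr_ge0 ?count_in_ge0.
  - move=> i; apply/measurable_EFinP; apply: measurable_sum_cond => j.
    exact: (measurable_funM (mNc m i) (mNc m j)).
  rewrite expr2 -{1}(sum_a m) mulr_suml -sumEFin; apply: lee_sum => i _.
  rewrite -(sum_a m) mulr_sumr.
  under eq_integral do rewrite -sumEFin -big_filter.
  rewrite ge0_integral_sum//; first last.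
  - by move=> j w _; rewrite lee_fin mulr_ge0 ?count_in_ge0.
  - by move=> j; apply/measurable_EFinP; exact: (measurable_funM (mNc m i) (mNc m j)).
  rewrite big_filter big_mkcond -sumEFin; apply: lee_sum => j _; case: ifPn => [ji|_]; last first.
    by rewrite lee_fin mulr_ge0.
  rewrite EFinM -(measure_fin (mDc m i) (DcB m i)) -(measure_fin (mDc m j) (DcB m j)).
  have bm k : bounded_set (Dc m k) by exact: bounded_itv (DcB m k).
  apply: (mean_product_le (mDc m i) (mDc m j) (bm i) (bm j)).
  have disj : cell B m i `&` cell B m j = set0 :> set R.
    have := ji; rewrite neq_ltn => /orP[h|h]; last exact: cell_disjoint.
    by rewrite setIC; exact: cell_disjoint.
  by rewrite /Dc setIACA disj setI0.
have V0 w : 0 <= count_in (y w) D ^+ 2 - count_in (y w) D by exact: count_in_sqr_ge DB'.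
have h : (\int[P]_w (count_in (y w) D ^+ 2 - count_in (y w) D)%:E <= (fine (mu D) ^+ 2)%:E)%E.
  apply: (integral_le_of_cvg (f_ := fun m w => (cross_count (y w) D B m)%:E) mN0 N00) => //.
  - move=> m; apply/measurable_EFinP; apply: measurable_sum => i.
    apply: measurable_sum_cond => j; exact: (measurable_funM (mNc m i) (mNc m j)).
  - by move=> m w; rewrite lee_fin cross_count_ge0.
  - move=> w /simple' s; apply: cvg_EFin; first by apply: nearW => m.
    exact: cross_count_cvg.
have -> : (\int[P]_w (count_in (y w) D ^+ 2)%:E =
  \int[P]_w ((count_in (y w) D ^+ 2 - count_in (y w) D) + count_in (y w) D)%:E)%E.
  by apply: eq_integral => w _; rewrite subrK.
apply: integral_add_le => //.
- by apply: measurable_funB => //; exact: measurable_funX.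
- by move=> w; exact: count_in_ge0.
- by rewrite (mean_count mD (bounded_itv DB)) -(measure_fin mD DB).
Qed.

Lemma centred_second_moment (B : nat) (D : set R) (L : R) : measurable D ->
  D `<=` [set` `]- B%:R, B%:R]] -> mu D = L%:E ->
  (\int[P]_w ((count_in (y w) D - L) ^+ 2)%:E <= L%:E)%E.
Proof.
move=> mD DB DL; have bD := bounded_itv DB.
have L0 : 0 <= L by rewrite -lee_fin -DL.
have mN : measurable_fun setT (fun w => count_in (y w) D) by exact: measurable_count.
have N0 w : 0 <= count_in (y w) D by exact: count_in_ge0.
have := second_moment mD DB; rewrite DL /= => h.
have cst (b : R) : (\int[P]_w b%:E = b%:E)%E.
  by transitivity (b%:E * P setT)%E; [exact: integral_cst|rewrite probability_setT mule1].
have h1 : (\int[P]_w (count_in (y w) D ^+ 2 + L ^+ 2)%:E <= (L ^+ 2 + L + L ^+ 2)%:E)%E.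
  apply: (@integral_add_le _ _ _ P (fun w => count_in (y w) D ^+ 2) (fun=> L ^+ 2)) => //.
  - exact: measurable_funX.
  - by move=> w; exact: sqr_ge0.
  - by move=> w; exact: sqr_ge0.
  - by rewrite cst.
(* The square is expanded with only nonnegative terms on both sides, so that integrals are added and
   never subtracted; the cross term is known since the mean of the count is [L]. *)
have h2 : (\int[P]_w (count_in (y w) D ^+ 2 + L ^+ 2)%:E =
   \int[P]_w ((count_in (y w) D - L) ^+ 2)%:E + (2 * L * L)%:E)%E.
  rewrite EFinM -DL -(mean_count mD bD) -ge0_integralZl//; first last.
  - by rewrite lee_fin mulr_ge0.
  - by move=> w _; rewrite lee_fin.
  - exact/measurable_EFinP.
  rewrite -ge0_integralD//; first last.
  - by apply/measurable_EFinP; exact: measurable_funM.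
  - by move=> w _; rewrite -EFinM lee_fin mulr_ge0// mulr_ge0.
  - by apply/measurable_EFinP; apply: measurable_funX; exact: measurable_funB.
  - by move=> w _; rewrite lee_fin sqr_ge0.
  by apply: eq_integral => w _; rewrite -EFinM -EFinD; congr (_%:E); ring.
move: h1; rewrite h2 -leeBrDr// -EFinB => /le_trans; apply.
by rewrite lee_fin le_eqVlt; apply/orP; left; apply/eqP; ring.
Qed.

End SineMoments.

(** * Principal values along the squares *)

Section PrincipalValue.
Variable R : realType.
Implicit Types (c : configuration R) (m : nat).

Definition square_annulus c m : R :=
  count_in c [set` `](m ^ 2)%:R, (m.+1 ^ 2)%:R]] +
  count_in c [set` `[- (m.+1 ^ 2)%:R, - (m ^ 2)%:R[].

Let square_annulus_pts c m : square_annulus c m =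
  \sum_(x <- pts c (m.+1 ^ 2)%:R | (m ^ 2)%:R < `|x|) 1.
Proof.
have mm : (m ^ 2)%:R <= (m.+1 ^ 2)%:R :> R by rewrite ler_nat leq_exp2r.
rewrite /square_annulus !(@count_in_pts _ c (m.+1 ^ 2)%:R); first last.
- move=> x /=; rewrite in_itv /= => /andP[h1 h2]; rewrite ler_norml h2 andbT.
  by rewrite (le_trans _ (ltW h1))// (le_trans (_ : _ <= 0)) ?oppr_le0.
- move=> x /=; rewrite in_itv /= => /andP[h1 h2]; rewrite ler_norml h1 /=.
  by rewrite (le_trans (ltW h2))// (le_trans (_ : _ <= 0)) ?oppr_le0.
rewrite big_mkcond [X in _ + X]big_mkcond -big_split /= [RHS]big_mkcond.
rewrite big_seq [RHS]big_seq; apply: eq_bigr => x; rewrite mem_pts => /andP[+ _].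
rewrite ler_norml => /andP[h1 h2]; rewrite !mem_setE !in_itv /= h1 h2 andbT/= ltr_normr.
rewrite (ltrNr x); case: (ltP _ x) => [mx|_]; last by rewrite add0r.
rewrite ifN ?addr0//; rewrite -leNgt (le_trans (_ : _ <= 0)) ?oppr_le0//.
exact: (le_trans _ (ltW mx)).
Qed.

(** Summation by parts handles the cutoffs [m ^ 2]; between consecutive squares the sum moves by at
    most [square_annulus c m / m ^ 2]. Squares are sparse enough for variances of order [m ^ 2],
    divided by [m ^ 4], to be summable, and dense enough for these gaps to be negligible. *)
Lemma principal_value_cvg c :
  (forall e : R, 0 < e -> exists m0, forall m, (m0 <= m)%N -> (0 < m)%N ->
     `|imbalance c (m ^ 2)| <= e * (m ^ 2)%:R /\ square_annulus c m <= e * (m ^ 2)%:R) ->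
  (tail_control c 1 < +oo)%E -> cvg (\sum_(x <- pts c B) x^-1 @[B --> +oo]).
Proof.
move=> sq V1; apply: real_cauchy_cvg => e e0; pose e' := e / 4.
have e'0 : 0 < e' by rewrite divr_gt0.
have [m0 hm] := sq _ e'0.
have tail : exists k0, forall k J, (k0 <= k)%N -> (0 < k)%N ->
    \sum_(k <= j < J) tail_term c j <= e'.
  have fin : (\sum_(0 <= i <oo) (tail_term c (i + 1))%:E < +oo)%E.
    apply: le_lt_trans V1; rewrite /tail_control leeDr// lee_fin divr_ge0// addr_ge0//.
    exact: annulus_ge0.
  have t0 i : xpredT i -> (0 <= (tail_term c (i + 1))%:E)%E by rewrite lee_fin tail_term_ge0.
  have := nneseries_tail_cvg fin t0 => /fine_cvgP[+ /cvgrPdist_le /(_ _ e'0)] => h1 h2.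
  have [N _ hN] := filterI h1 h2.
  exists N.+1 => k J Nk k0; have Nk' : (N <= k.-1)%N by rewrite -ltnS prednK.
  have [/= fk] := hN _ Nk'; rewrite sub0r normrN => h.
  have {}h := le_trans (ler_norm _) h; rewrite -lee_fin fineK// in h.
  rewrite -lee_fin; apply: le_trans h; rewrite -sumEFin.
  (* The series in [tail_control c 1] starts with the term of index [1], hence the shift to
     [k.-1]. *)
  have -> : (\sum_(k <= j < J) (tail_term c j)%:E =
     \sum_(k.-1 <= j < J.-1) (tail_term c (j + 1))%:E)%E.
    case: k k0 {Nk Nk' fk} => // k _; case: J => [|J]; first by rewrite !big_geq.
    by rewrite big_add1 /=; apply: eq_bigr => j _; rewrite addn1.
  by apply: nneseries_lim_ge => j _ _; rewrite lee_fin tail_term_ge0.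
have [k0 hk] := tail.
pose K := (maxn m0 k0).+1; pose l0 := \sum_(x <- pts c (K ^ 2)%:R) x^-1.
have sumP (m : nat) (B : R) : (0 < m)%N -> (K <= m)%N -> (m ^ 2)%:R <= B -> B < (m.+1 ^ 2)%:R ->
    `|\sum_(x <- pts c B) x^-1 - \sum_(x <- pts c (m ^ 2)%:R) x^-1| <= e'.
  move=> mp Km mB Bm; have m2 : 0 < (m ^ 2)%:R :> R by rewrite ltr0n expn_gt0 mp.
  have mm : (m ^ 2)%:R <= (m.+1 ^ 2)%:R :> R by rewrite ler_nat leq_exp2r.
  rewrite (sum_pts_filter c _ (ltW Bm)) (sum_pts_filter c _ mm).
  rewrite (bigID (fun x => `|x| <= (m ^ 2)%:R)) /=.
  rewrite (eq_bigl (fun x => `|x| <= (m ^ 2)%:R)); last first.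
    by move=> x; rewrite andb_idl// => /le_trans; apply.
  rewrite addrAC subrr add0r; have [_ hW] := hm m (leq_trans (leq_maxl _ _) (ltnW Km)) mp.
  have : square_annulus c m / (m ^ 2)%:R <= e' by rewrite ler_pdivrMr.
  apply: le_trans; rewrite square_annulus_pts mulr_suml.
  apply: (le_trans (ler_norm_sum _ _ _)).
  rewrite big_mkcond [leRHS]big_mkcond; apply: ler_sum => x _.
  rewrite -ltNge; case: (ltP _ `|x|) => [mx|_]; last by rewrite andbF.
  rewrite andbT; case: ifP => _; last by rewrite div1r invr_ge0 ltW.
  by rewrite div1r normfV lef_pV2 ?posrE ?(lt_trans m2 mx)// ltW.
have sumQ (m : nat) : (K <= m)%N ->
    `|\sum_(x <- pts c (m ^ 2)%:R) x^-1 - l0| <= e' + e' + e'.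
  move=> Km; have Kp : (0 < K ^ 2)%N by rewrite expn_gt0.
  have mp : (0 < m)%N by exact: leq_trans Km.
  have m2 : (0 < m ^ 2)%N by rewrite expn_gt0 mp.
  have KJ : (K ^ 2 <= m ^ 2)%N by rewrite leq_exp2r.
  have KJ' : (K ^ 2)%:R <= (m ^ 2)%:R :> R by rewrite ler_nat.
  have := sum_inv_shell_le (pts c (m ^ 2)%:R) Kp KJ.
  rewrite -!imbalance_pts//.
  have -> : \sum_(x <- pts c (m ^ 2)%:R | (K ^ 2)%:R < `|x| <= (m ^ 2)%:R) x^-1 =
      \sum_(x <- pts c (m ^ 2)%:R) x^-1 - l0.
    rewrite /l0 (sum_pts_filter c _ KJ') [X in X - _](bigID (fun x => `|x| <= (K ^ 2)%:R)) /=.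
    rewrite addrAC subrr add0r big_seq_cond [RHS]big_seq_cond; apply: eq_bigl => x.
    by rewrite mem_pts -ltNge; case: (`|x| <= _) => //=; rewrite !andbT.
  have hv : \sum_(K ^ 2 <= j < m ^ 2) varterm (pts c (m ^ 2)%:R) j <= e'.
    apply: le_trans (hk (K ^ 2)%N (m ^ 2)%N _ Kp); last first.
      by rewrite (leq_trans (leq_maxr m0 k0))// (leq_trans (leqnSn _))// leq_pmulr.
    rewrite le_eqVlt; apply/orP; left; apply/eqP; rewrite !big_nat; apply: eq_bigr => j /andP[_ jm].
    by rewrite -tail_term_pts// ler_nat.
  have bnd n : (K <= n)%N -> `|imbalance c (n ^ 2) / (n ^ 2)%:R| <= e'.
    move=> Kn; have np : (0 < n)%N by exact: leq_trans Kn.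
    have n2 : 0 < (n ^ 2)%:R :> R by rewrite ltr0n expn_gt0 np.
    have [h _] := hm n (leq_trans (leq_maxl _ _) (ltnW Kn)) np.
    by rewrite normrM normfV (gtr0_norm n2) ler_pdivrMr.
  have b1 := bnd _ Km; have b2 := bnd _ (leqnn K).
  move=> /le_trans /(_ hv).
  move: (imbalance c (m ^ 2) / _) (imbalance c (K ^ 2) / _) (\sum_(x <- _) _ - l0) b1 b2 => p q s b1 b2 h.
  have -> : s = (s - p + q) + (p - q) by ring.
  rewrite -[leRHS]addrA; apply: (le_trans (ler_normD _ _)); apply: lerD => //.
  by apply: (le_trans (ler_normB _ _)); exact: lerD.
exists l0, (K ^ 2)%:R => B KB.
have B0 : 0 <= B by exact: le_trans KB.
pose m := Num.truncn (Num.sqrt B).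
have s0 : 0 <= Num.sqrt B by exact: sqrtr_ge0.
have sB : Num.sqrt B ^+ 2 = B by exact: sqr_sqrtr.
have mB : (m ^ 2)%:R <= B.
  by rewrite -sB natrX lerXn2r ?nnegrE//; have /andP[] := truncn_itv s0.
have Bm : B < (m.+1 ^ 2)%:R.
  by rewrite -sB natrX ltrXn2r ?nnegrE//; exact: truncnS_gt.
have Km : (K <= m)%N.
  by move: (le_lt_trans KB Bm); rewrite ltr_nat ltn_exp2r.
have mp : (0 < m)%N by exact: leq_trans Km.
have -> : \sum_(x <- pts c B) x^-1 - l0 = (\sum_(x <- pts c B) x^-1 -
   \sum_(x <- pts c (m ^ 2)%:R) x^-1) + (\sum_(x <- pts c (m ^ 2)%:R) x^-1 - l0) by ring.
have -> : e = e' + (e' + e' + e') by rewrite /e'; field.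
apply: (le_trans (ler_normD _ _)); apply: lerD; [exact: sumP|exact: sumQ].
Qed.

End PrincipalValue.

Section SineProcess.
Context d (T : measurableType d) (R : realType) (P : probability T R)
  (y : point_process T R).
Hypothesis sine : sine_process P y.

Let itv_measure b1 b2 (u v : R) : u <= v ->
  @lebesgue_measure R [set` Interval (BSide b1 u) (BSide b2 v)] = (v - u)%:E.
Proof.
move=> uv; rewrite lebesgue_measure_itv /= lte_fin; case: ltP => [_|vu]; first by rewrite EFinB.
by have -> : v = u; [exact/le_anti/andP|rewrite subrr].
Qed.

Lemma mean_count_itv b1 b2 (u v : R) : u <= v ->
  (\int[P]_w (count_in (y w) [set` Interval (BSide b1 u) (BSide b2 v)])%:E = (v - u)%:E)%E.
Proof.
move=> uv; rewrite (mean_count sine); [exact: itv_measure|exact: measurable_itv|].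
exact: bounded_set_interval.
Qed.

Lemma centred_second_moment_itv b1 b2 (u v : R) : u <= v ->
  (\int[P]_w ((count_in (y w) [set` Interval (BSide b1 u) (BSide b2 v)] - (v - u)) ^+ 2)%:E
    <= (v - u)%:E)%E.
Proof.
move=> uv; apply: (@centred_second_moment _ _ _ _ _ sine (Num.truncn (`|u| + `|v|)).+1).
- exact: measurable_itv.
- move=> x /=; rewrite itv_boundlr => /andP[h1 h2].
  have {}h1 : u <= x by move: h1; case: b1; rewrite ?bnd_simp// => /ltW.
  have {}h2 : x <= v by move: h2; case: b2; rewrite ?bnd_simp// => /ltW.
  have := truncnS_gt (`|u| + `|v|); rewrite in_itv /=.
  have := ler_norm v; have := ler_norm (- u); rewrite normrN.
  move: (_.+1%:R) => B nu nv hB; have := normr_ge0 u; have := normr_ge0 v => *.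
  by apply/andP; split; lra.
- exact: itv_measure.
Qed.

(** The variance on an interval of length [j] is at most [j = lam ^ 2] with [lam = j ^ (1 / 2)], and
    the two means agree, so the bound is [lam + lam]: hence the exponent [1 / 2] and the constant
    [2], which is also the mean of an annulus. *)
Lemma sine_controlled : controlled P y 2 2^-1.
Proof.
split=> [j|j j0].
- have h1 : j%:R <= j.+1%:R :> R by rewrite ler_nat.
  have h2 : - j.+1%:R <= - j%:R :> R by rewrite lerN2.
  have -> : 2 = (j.+1%:R - j%:R) + (- j%:R - - j.+1%:R) :> R by rewrite -natr1; ring.
  apply: integral_add_le; rewrite ?mean_count_itv//; do ?[exact: measurable_count_itv];
    by move=> w; exact: count_in_ge0.
- have jp : 0 < j%:R :> R by rewrite ltr0n.
  have h1 : 0 <= j%:R :> R by exact: ltW.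
  have h2 : - j%:R <= 0 :> R by rewrite oppr_le0.
  have v1 := centred_second_moment_itv false false h1; rewrite subr0 in v1.
  have v2 := centred_second_moment_itv true true h2; rewrite sub0r !opprK in v2.
  pose lam := j%:R `^ (1 - 2^-1) : R.
  have lam0 : 0 < lam by rewrite powR_gt0.
  have lam2 : lam ^+ 2 = j%:R.
    rewrite -powR_mulrn ?powR_ge0// -powRrM -[RHS]powRr1//; by congr (_ `^ _); field.
  have d0 : `|j%:R - j%:R| <= 0 :> R by rewrite subrr normr0.
  apply: (le_trans (integral_abs_diff_le _ _ lam0 d0 v1 v2)).
  + exact: measurable_count_itv.
  + exact: measurable_count_itv.
  rewrite lee_fin -/lam -{1}lam2 le_eqVlt; apply/orP; left; apply/eqP.
  by field; rewrite gt_eqF.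
Qed.

Lemma sine_no_zero : {ae P, forall w, y w 0 = 0%N}.
Proof.
pose N := [set w | 1%:E <= (count_in (y w) [set` `[0%R, 0%R]])%:E]%E.
have mc : measurable_fun setT (fun w => (count_in (y w) [set` `[0%R, 0%R]])%:E).
  by apply/measurable_EFinP; exact: measurable_count_itv.
exists N; split.
- by rewrite -[N]setTI; exact: emeasurable_fun_c_infty.
- apply/eqP; rewrite eq_le measure_ge0 andbT.
  have c0 w : (0 <= (count_in (y w) [set` `[0%R, 0%R]])%:E)%E by rewrite lee_fin count_in_ge0.
  have := @markov_le _ _ _ P _ 1 0 mc c0 ltr01.
  by rewrite mul0r; apply; rewrite mean_count_itv// subrr.
- move=> w /= /eqP; rewrite -lt0n => y0.
  by rewrite /N /= lee_fin set_itv1 /count_in fsbig_set1 ler1n.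
Qed.

(* By the second moment bounds [square_defect m] has mean [O(m^-2)], hence its
   sum over [m] is almost surely finite. *)
Let square_defect (w : T) (m : nat) : R :=
  ((count_in (y w) [set` `]0, (m ^ 2)%:R]] - (m ^ 2)%:R) ^+ 2 +
   (count_in (y w) [set` `[- (m ^ 2)%:R, 0[] - (m ^ 2)%:R) ^+ 2 +
   (count_in (y w) [set` `](m ^ 2)%:R, (m.+1 ^ 2)%:R]] - ((m.+1 ^ 2)%:R - (m ^ 2)%:R)) ^+ 2 +
   (count_in (y w) [set` `[- (m.+1 ^ 2)%:R, - (m ^ 2)%:R[]
     - ((m.+1 ^ 2)%:R - (m ^ 2)%:R)) ^+ 2) / (m ^ 2)%:R ^+ 2.

Let square_defect_ge0 w m : 0 <= square_defect w m.
Proof. by rewrite divr_ge0 ?sqr_ge0// !addr_ge0 ?sqr_ge0. Qed.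

Let mcount b1 b2 (u v a : R) : measurable_fun setT (fun w =>
  (count_in (y w) [set` Interval (BSide b1 u) (BSide b2 v)] - a) ^+ 2).
Proof.
by apply: measurable_funX; apply: measurable_funB => //; exact: measurable_count_itv.
Qed.

Let measurable_square_defect m : measurable_fun setT (square_defect ^~ m).
Proof.
by apply: measurable_funM => //; do 3 apply: measurable_funD => //; exact: mcount.
Qed.

(** The four variances add up to at most [2 (m + 1) ^ 2]; after division by [m ^ 4] the claim is
    [(m + 1) ^ 3 <= 8 m ^ 3], with equality at [m = 1]. The bound is written as a difference so that
    its series telescopes. *)
Let mean_square_defect m : (0 < m)%N ->
  (\int[P]_w (square_defect w m)%:E <= (16 * (m%:R^-1 - m.+1%:R^-1))%:E)%E.
Proof.
move=> m0; have mp : 0 < m%:R :> R by rewrite ltr0n.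
have m2 : 0 <= (m ^ 2)%:R :> R by [].
have mm : (m ^ 2)%:R <= (m.+1 ^ 2)%:R :> R by rewrite ler_nat leq_exp2r.
have mm' : - (m.+1 ^ 2)%:R <= - (m ^ 2)%:R :> R by rewrite lerN2.
have m2' : - (m ^ 2)%:R <= 0 :> R by rewrite oppr_le0.
have v1 := centred_second_moment_itv false false m2; rewrite subr0 in v1.
have v2 := centred_second_moment_itv true true m2'; rewrite sub0r !opprK in v2.
have v3 := centred_second_moment_itv false false mm.
have v4 := centred_second_moment_itv true true mm'; rewrite opprK addrC in v4.
have s0 b1 b2 (u v a : R) w :
  0 <= (count_in (y w) [set` Interval (BSide b1 u) (BSide b2 v)] - a) ^+ 2 by exact: sqr_ge0.
have h := integral_add_le (measurable_funD (measurable_funD (mcount _ _ _ _ _) (mcount _ _ _ _ _))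
  (mcount _ _ _ _ _)) (fun w => addr_ge0 (addr_ge0 (s0 _ _ _ _ _ w) (s0 _ _ _ _ _ w)) (s0 _ _ _ _ _ w))
  (mcount _ _ _ _ _) (s0 _ _ _ _ _)
  (integral_add_le (measurable_funD (mcount _ _ _ _ _) (mcount _ _ _ _ _))
    (fun w => addr_ge0 (s0 _ _ _ _ _ w) (s0 _ _ _ _ _ w)) (mcount _ _ _ _ _) (s0 _ _ _ _ _)
    (integral_add_le (mcount _ _ _ _ _) (s0 _ _ _ _ _) (mcount _ _ _ _ _) (s0 _ _ _ _ _) v1 v2) v3) v4.
have i0 : 0 <= ((m ^ 2)%:R ^+ 2)^-1 :> R by rewrite invr_ge0 sqr_ge0.
apply: (le_trans (integral_scale_le _ _ i0 h)).
- by do 3 apply: measurable_funD => //; exact: mcount.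
- by move=> w; rewrite !addr_ge0 ?sqr_ge0.
rewrite lee_fin ler_pdivrMr ?exprn_gt0 ?ltr0n ?expn_gt0 ?m0// !natrX -natr1.
have m1 : 1 <= m%:R :> R by rewrite ler1n.
move: (m%:R) mp m1 => t tp t1; have t10 : 0 < t + 1 by rewrite ltr_wpDl// ltW.
have -> : 16 * (t^-1 - (t + 1)^-1) * (t ^+ 2) ^+ 2 = 16 * (t ^+ 3 / (t + 1)).
  by field; rewrite !gt_eqF.
have -> : 16 * (t ^+ 3 / (t + 1)) = 16 * t ^+ 3 / (t + 1) by ring.
rewrite ler_pdivlMr//; have t2 : t <= t ^+ 2 by rewrite expr2 ler_peMr// ltW.
have t3 : t ^+ 2 <= t ^+ 3 by rewrite exprS ler_peMl ?sqr_ge0.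
nra.
Qed.

Let square_defect_cvg0 : {ae P, forall w, square_defect w m @[m --> \oo] --> 0}.
Proof.
have fin : {ae P, forall w, (\sum_(0 <= i <oo) (square_defect w i.+1)%:E < +oo)%E}.
  have ms : measurable_fun setT (fun w => (\sum_(0 <= i <oo) (square_defect w i.+1)%:E)%E).
    apply: (@ge0_emeasurable_sum _ _ _ _ (fun i w => (square_defect w i.+1)%:E) xpredT).
      by move=> i w _ _; rewrite lee_fin.
    by move=> i _; apply/measurable_EFinP; exact: measurable_square_defect.
  have s0 w : (0 <= \sum_(0 <= i <oo) (square_defect w i.+1)%:E)%E.
    by apply: nneseries_ge0 => i _ _; rewrite lee_fin.
  have h : P.-integrable setT (fun w => \sum_(0 <= i <oo) (square_defect w i.+1)%:E)%E.
    apply/integrableP; split => //.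
    under eq_integral do rewrite gee0_abs//.
    apply: (@le_lt_trans _ _ 16%:E); last exact: ltry.
    rewrite integral_nneseries//; first last.
    - by move=> i w _; rewrite lee_fin.
    - by move=> i; apply/measurable_EFinP; exact: measurable_square_defect.
    apply: lime_le.
      by apply: is_cvg_nneseries => i _ _; apply: integral_ge0 => w _; rewrite lee_fin.
    apply: nearW => n.
    apply: (@le_trans _ _ (\sum_(0 <= i < n) (16 * (i.+1%:R^-1 - i.+2%:R^-1))%:E)%E).
      by apply: lee_sum => i _; exact: mean_square_defect.
    rewrite sumEFin lee_fin -mulr_sumr -[leRHS]mulr1 ler_wpM2l//.
    have -> : \sum_(0 <= i < n) (i.+1%:R^-1 - i.+2%:R^-1) = 1 - n.+1%:R^-1 :> R.
      elim: n => [|n IH]; first by rewrite big_geq// invr1 subrr.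
      by rewrite big_nat_recr//= IH; ring.
    by rewrite lerBlDr lerDl invr_ge0.
  by have := integrable_ae measurableT h; apply: filterS => w /(_ I); rewrite ge0_fin_numE.
apply: filterS fin => w fw; pose v := fine (\sum_(0 <= i <oo) (square_defect w i.+1)%:E)%E.
have s0 : (0 <= \sum_(0 <= i <oo) (square_defect w i.+1)%:E)%E.
  by apply: nneseries_ge0 => i _ _; rewrite lee_fin.
have fv : (\sum_(0 <= i <oo) (square_defect w i.+1)%:E = v%:E)%E by rewrite fineK// ge0_fin_numE.
rewrite -(cvg_shiftS (square_defect w)); apply: cvg_series_cvg_0.
apply: nondecreasing_is_cvgn; first by apply: nondecreasing_series => n _ _; exact: square_defect_ge0.
exists v => _ [n _ <-]; rewrite -lee_fin -fv /series /= -sumEFin.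
by apply: nneseries_lim_ge => i _ _; rewrite lee_fin.
Qed.

Lemma sine_summable : {ae P, forall w, y w 0 = 0%N /\ summable_points (y w)}.
Proof.
have h0 : 0 < 2^-1 :> R by rewrite invr_gt0.
have h1 : 2^-1 <= 1 :> R by lra.
have h2 : 0 <= 2 :> R by [].
have tc := ae_tail_control_fin h2 h0 h1 sine_controlled.
apply: filterS3 sine_no_zero square_defect_cvg0 tc => w z sq V; split => //.
split; last exact: tail_control_summable.
apply: principal_value_cvg => // e e0; pose e' := e / 4.
have e'0 : 0 < e' by rewrite divr_gt0.
have e'2 : 0 < e' ^+ 2 by rewrite exprn_gt0.
have [M0 _ hM] := (cvgrPdist_le _ _).1 sq _ e'2.
(* The two intervals of [square_annulus] have total mean [2 (2 m + 1) <= 6 m], at most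
   [e / 2 * m ^ 2] once [m >= 12 / e]; their two deviations take up the other half, [e' = e / 4]
   each. *)
exists (maxn M0 (Num.truncn (12 / e)).+1) => m; rewrite geq_max => /andP[/hM /= hm em] m0.
have mp : 0 < m%:R :> R by rewrite ltr0n.
have m1 : 1 <= m%:R :> R by rewrite ler1n.
have em' : 12 <= e * m%:R.
  rewrite mulrC -ler_pdivrMr//; apply: ltW; apply: (lt_le_trans (truncnS_gt _)).
  by rewrite ler_nat.
have m2 : 0 < (m ^ 2)%:R :> R by rewrite ltr0n expn_gt0 m0.
move: hm; rewrite sub0r normrN ger0_norm// /square_defect ler_pdivrMr ?exprn_gt0//.
rewrite -exprMn /imbalance /square_annulus.
move: (count_in _ _) (count_in _ _) (count_in _ _) (count_in _ _) => s r q p hm.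
have em2 : 0 <= e' * (m ^ 2)%:R by rewrite mulr_ge0// ltW.
have bnd (t : R) : t ^+ 2 <= (e' * (m ^ 2)%:R) ^+ 2 -> `|t| <= e' * (m ^ 2)%:R.
  by rewrite -(real_normK (num_real t)) ler_pXn2r ?nnegrE.
have hp : `|p - (m ^ 2)%:R| <= e' * (m ^ 2)%:R.
  apply: bnd; apply: le_trans hm; rewrite -!addrA lerDl !addr_ge0 ?sqr_ge0//.
have hq : `|q - (m ^ 2)%:R| <= e' * (m ^ 2)%:R.
  apply: bnd; apply: le_trans hm; rewrite -!addrA ler_wpDl ?sqr_ge0// lerDl !addr_ge0 ?sqr_ge0//.
have hr : `|r - ((m.+1 ^ 2)%:R - (m ^ 2)%:R)| <= e' * (m ^ 2)%:R.
  apply: bnd; apply: le_trans hm; rewrite addrAC lerDr !addr_ge0 ?sqr_ge0//.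
have hs : `|s - ((m.+1 ^ 2)%:R - (m ^ 2)%:R)| <= e' * (m ^ 2)%:R.
  apply: bnd; apply: le_trans hm; rewrite lerDr !addr_ge0 ?sqr_ge0//.
have width : 2 * ((m.+1 ^ 2)%:R - (m ^ 2)%:R) <= e / 2 * (m ^ 2)%:R :> R.
  have h12 : 12 * m%:R <= e * m%:R * m%:R by rewrite ler_pM2r.
  have -> : e / 2 * (m ^ 2)%:R = e * m%:R * m%:R / 2 by rewrite natrX; field.
  have -> : (m.+1 ^ 2)%:R - (m ^ 2)%:R = 2 * m%:R + 1 :> R by rewrite !natrX -natr1; ring.
  lra.
have ee : e' = e / 4 by [].
split.
  have -> : p - q = (p - (m ^ 2)%:R) - (q - (m ^ 2)%:R) by ring.
  apply: (le_trans (ler_normB _ _)); apply: (le_trans (lerD hp hq)).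
  by rewrite -mulrDl ler_wpM2r ?(ltW m2)// ee; lra.
have := ler_norm (r - ((m.+1 ^ 2)%:R - (m ^ 2)%:R)).
have := ler_norm (s - ((m.+1 ^ 2)%:R - (m ^ 2)%:R)).
have -> : e * (m ^ 2)%:R = e / 2 * (m ^ 2)%:R + (e' * (m ^ 2)%:R + e' * (m ^ 2)%:R).
  by rewrite ee; field.
move: hr hs width; set t := e' * _; set u := e / 2 * _; lra.
Qed.

End SineProcess.

Lemma controlled_weaken d (T : measurableType d) (R : realType) (P : probability T R)
    (X : point_process T R) (C C' a a' : R) : 0 <= C -> C <= C' -> a' <= a ->
  controlled P X C a -> controlled P X C' a'.
Proof.
move=> C0 CC aa [h1 h2]; split=> [j|j j0].
  by apply: (le_trans (h1 j)); rewrite lee_fin.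
apply: (le_trans (h2 j j0)); rewrite lee_fin ler_pM ?powR_ge0//.
by apply: ler_powR; rewrite ?ler1n// lerD2l lerN2.
Qed.

Theorem theorem1p2 (R : realType) (d : nat -> measure_display)
    (T : forall n, measurableType (d n)) (P : forall n, probability (T n) R)
    (x : forall n, point_process (T n) R) :
  uniformly_product_amenable P x ->
  (forall n, {ae P n, forall w, forall s : R[i],
     cvg (truncated_product (x n w) s B @[B --> +oo])}) /\
  (forall (d' : measure_display) (T' : measurableType d')
      (P' : probability T' R) (y : point_process T' R),
     sine_process P' y ->
     cvg_in_law [set: configuration R] P x P' y ->
     cvg_in_law
       [set f : {family compact, R[i]^o -> R[i]^o}
         | continuous (f : R[i]^o -> R[i]^o)]
       P (fun n w => characteristic_limit (x n w))
       P' (fun w => characteristic_limit (y w))).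
Proof.
move=> amenable; have [C [a [C0 /andP[a0 a1] ctrl good]]] := amenable_controlled amenable.
have goodX n : {ae P n, forall w, summable_points (x n w)}.
  by apply: filterS (good n) => w [].
split=> [n|d' T' P' y sine law].
  by apply: filterS (goodX n) => w sw s; exact: truncated_cvg.
have goody := sine_summable sine.
have goodY : {ae P', forall w, summable_points (y w)} by apply: filterS goody => w [].
have cont c : summable_points c ->
    continuous (characteristic_limit c : R[i]^o -> R[i]^o).
  by move=> sc; apply: ncont_continuous; exact: ncont_characteristic_limit.
split.
- by move=> n; apply: filterS (goodX n) => w; exact: cont.
- by apply: filterS goodY => w; exact: cont.
(* Common constants for the sequence and its limit: [good_event] must provide the same [k] and [M]
   for both. *)
- pose C' := Num.max C 2; pose a' := Num.min a 2^-1.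
  have C'0 : 0 <= C' by rewrite le_max C0.
  have a'0 : 0 < a' by rewrite lt_min a0 invr_gt0 ltr0n.
  have a'1 : a' <= 1 by rewrite ge_min a1.
  have ctrlX n : controlled (P n) (x n) C' a'.
    by apply: controlled_weaken (ctrl n) => //; rewrite ?le_max ?ge_min lexx.
  have ctrlY : controlled P' y C' a'.
    by apply: controlled_weaken (sine_controlled sine) => //; rewrite ?le_max ?ge_min lexx ?orbT.
  have gap (r : R) : 0 < r ->
      (\int[P']_w (count_in (y w) [set` `[(- r)%R, r]])%:E <= (2 * r)%:E)%E.
    move=> r0; rewrite (mean_count_itv sine); first by rewrite lee_fin; lra.
    by lra.
  have lip := lipschitz_law_cvg C'0 a'0 a'1 ctrlX ctrlY good goody gap law.
  apply: portmanteau => //.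
  + by move=> n; exact: lipschitz_measurable_characteristic.
  + exact: lipschitz_measurable_characteristic.
Qed.
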